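(* The functor $\mathscr{F}$ sending a representation $U$ of $\mathbf{O}(\infty)$ to the functor on $T_1$ whose value on a $d$-dimensional quadratic space $V$ is the invariant space $U^{H_d}$ induces a left-exact fully faithful tensor functor $\mathrm{Rep}(\mathbf{O})\to\mathrm{Fun}(T_1,\mathrm{Vec}^{\mathrm{f}})$.
   Context: Everything is over $\mathbf{C}$. $\mathbf{V}=\mathbf{C}^\infty$ has basis $e_1,e_2,\dots$ and symmetric form $\omega(\sum a_ie_i,\sum b_je_j)=\sum_{k\ge1}(a_{2k-1}b_{2k}+a_{2k}b_{2k-1})$; $\mathbf{O}(\infty)\subset\mathbf{GL}(\infty)=\bigcup_d\mathbf{GL}(d)$ is its stabilizer. $\mathrm{Rep}(\mathbf{O})$ is the category of algebraic representations, i.e. subquotients of finite direct sums of the $\mathbf{V}^{\otimes n}$, with the usual tensor product. $T_1$ is the category of pairs $(V,\omega_V)$ with $V$ a finite dimensional vector space and $\omega_V$ a perfect (nondegenerate) symmetric bilinear form; morphisms are linear maps preserving the forms (necessarily injective). $\mathrm{Vec}^{\mathrm{f}}$ is the category of finite dimensional vector spaces; $\mathrm{Fun}(T_1,\mathrm{Vec}^{\mathrm{f}})$ has the pointwise abelian and tensor structures. For $d\ge0$ let $\mathbf{V}_d\subset\mathbf{V}$ be the span of $e_1,\dots,e_d$ if $d$ is even, and of $e_1,\dots,e_{d-1},e_d+e_{d+1}$ if $d$ is odd; $\omega$ is nondegenerate on $\mathbf{V}_d$, $\mathbf{V}_d\subset\mathbf{V}_{d+1}$, and $\mathbf{V}=\mathbf{V}_d\oplus\mathbf{V}_d'$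 with $\mathbf{V}'_d$ the orthogonal complement. $G_d\cong\mathbf{O}(d)$ (resp. $H_d\cong\mathbf{O}(\infty)$) is the subgroup of $\mathbf{O}(\infty)$ preserving $\mathbf{V}_d$ (resp. $\mathbf{V}_d'$) and acting as the identity on $\mathbf{V}'_d$ (resp. $\mathbf{V}_d$). These commute, so $U^{H_d}$ is a representation of $G_d$. Definition of $\mathscr{F}(U)$: for $V\in T_1$ of dimension $d$, choose an isometry $\varphi\colon V\to\mathbf{V}_d$ and put $\mathscr{F}(U)(V)=U^{H_d}$; canonically, $\mathscr{F}(U)(V)$ is the space of families $(u_\varphi)$ in $U^{H_d}$ indexed by isometries $\varphi\colon V\to\mathbf{V}_d$ with $u_{g\varphi}=gu_\varphi$ for $g\in G_d$. A morphism $h\colon V\to W$ in $T_1$ with $\dim W=d'$ acts as follows: choose isometries $\varphi\colon V\to\mathbf{V}_d$ and $\psi\colon W\to\mathbf{V}_{d'}$ with $\psi h=\varphi$ (using $\mathbf{V}_d\subset\mathbf{V}_{d'}$); in these coordinates the map is the inclusion $U^{H_d}\subset U^{H_{d'}}$ (independent of choices). A tensor functor is a $\mathbf{C}$-linear symmetric monoidal functor. *)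

(* Defs.v *)
From HB Require Import structures.
From mathcomp Require Import all_boot all_order all_algebra.
From mathcomp Require Import boolp classical_sets functions reals.
From mathcomp.real_closed Require Import complex.

Set Implicit Arguments.
Unset Strict Implicit.
Unset Printing Implicit Defensive.

Import GRing.Theory.
Local Open Scope ring_scope.
Local Open Scope quotient_scope.

Section LinearMaps.
Variable K : fieldType.
Implicit Types U W X : lmodType K.

Definition mklin U W (f : U -> W) (hf : linear f) : {linear U -> W} :=
  HB.pack f (GRing.isLinear.Build K U W _ f hf).

Lemma lin_eq U W (f g : {linear U -> W}) : f =1 g -> f = g.
Proof.
case: f => f cf; case: g => g cg /= e.
have {}e : f = g by apply: funext.
case: _ / e in cg *; congr GRing.Linear.Pack.
case: cf => -[f1] [f2]; case: cg => -[g1] [g2].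
by rewrite (Prop_irrelevance f1 g1) (Prop_irrelevance f2 g2).
Qed.

Definition lin_id U : {linear U -> U} := mklin (fun a (x y : U) => erefl (a *: x + y)).

Definition lin_comp U W X (g : {linear W -> X}) (f : {linear U -> W}) :
  {linear U -> X} := g \o f.

Lemma lin_compE U W X (g : {linear W -> X}) (f : {linear U -> W}) x :
  lin_comp g f x = g (f x).
Proof. by []. Qed.

Lemma lin_idE U (x : U) : lin_id U x = x.
Proof. by []. Qed.

End LinearMaps.

Section Tensor.
Variables (K : fieldType) (U W : lmodType K).

Definition bilinear_map (X : lmodType K) (b : U -> W -> X) : Prop :=
  (forall w, linear (b^~ w)) /\ (forall u, linear (b u)).

(* U (x) W is the set of formal sums of pairs, two of them being identified when
   every bilinear map gives them the same value; see tens_universal. *)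
Definition bisum (X : lmodType K) (b : U -> W -> X) (s : seq (U * W)) : X :=
  \sum_(p <- s) b p.1 p.2.

Definition tensor_rel (s t : seq (U * W)) : bool :=
  `[< forall (X : lmodType K) (b : U -> W -> X),
        bilinear_map b -> bisum b s = bisum b t >].

Lemma tensor_rel_refl : reflexive tensor_rel.
Proof. by move=> s; apply/asboolP. Qed.

Lemma tensor_rel_sym : symmetric tensor_rel.
Proof.
by move=> s t; apply/asboolP/asboolP => h X b hb; rewrite h.
Qed.

Lemma tensor_rel_trans : transitive tensor_rel.
Proof.
move=> t s r /asboolP h1 /asboolP h2; apply/asboolP => X b hb.
by rewrite h1 // h2.
Qed.

Canonical tensor_equiv :=
  EquivRel tensor_rel tensor_rel_refl tensor_rel_sym tensor_rel_trans.

Definition tens := {eq_quot tensor_rel}.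

HB.instance Definition _ : EqQuotient _ tensor_rel tens := EqQuotient.on tens.
HB.instance Definition _ := Choice.on tens.

Definition tev (X : lmodType K) (b : U -> W -> X) (x : tens) : X :=
  bisum b (repr x).

Lemma tev_pi X b s : @bilinear_map X b -> tev b (\pi_tens s) = bisum b s.
Proof.
move=> hb; rewrite /tev; case: piP => r /eqmodP /asboolP h.
by rewrite h.
Qed.

Lemma tev_ext (x y : tens) :
  (forall X b, @bilinear_map X b -> tev b x = tev b y) -> x = y.
Proof.
move=> h; rewrite -[x]reprK -[y]reprK; apply/eqmodP/asboolP => X b hb.
exact: h.
Qed.

Definition tadd (x y : tens) : tens := \pi_tens (repr x ++ repr y).
Definition tzero : tens := \pi_tens [::].
Definition tscale (a : K) (x : tens) : tens :=
  \pi_tens [seq (a *: p.1, p.2) | p <- repr x].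
Definition topp (x : tens) : tens := tscale (-1) x.

Lemma tev_add X b x y : @bilinear_map X b -> tev b (tadd x y) = tev b x + tev b y.
Proof. by move=> hb; rewrite tev_pi // /bisum big_cat. Qed.

Lemma tev0 X b : @bilinear_map X b -> tev b tzero = 0.
Proof. by move=> hb; rewrite tev_pi // /bisum big_nil. Qed.

Lemma tev_scale X b a x : @bilinear_map X b -> tev b (tscale a x) = a *: tev b x.
Proof.
move=> hb; rewrite tev_pi // /bisum big_map /tev /bisum scaler_sumr.
apply: eq_bigr => p _ /=.
by case: hb => /(_ p.2) hb _; exact: (linearZ_LR (mklin hb)).
Qed.

Lemma tev_opp X b x : @bilinear_map X b -> tev b (topp x) = - tev b x.
Proof. by move=> hb; rewrite tev_scale // scaleN1r. Qed.

Definition tevE := (tev_add, tev0, tev_scale, tev_opp).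

Lemma taddA : associative tadd.
Proof. by move=> x y z; apply: tev_ext => X b hb; rewrite !tevE // addrA. Qed.
Lemma taddC : commutative tadd.
Proof. by move=> x y; apply: tev_ext => X b hb; rewrite !tevE // addrC. Qed.
Lemma tadd0 : left_id tzero tadd.
Proof. by move=> x; apply: tev_ext => X b hb; rewrite !tevE // add0r. Qed.
Lemma taddN : left_inverse tzero topp tadd.
Proof. by move=> x; apply: tev_ext => X b hb; rewrite !tevE // addNr. Qed.

HB.instance Definition _ := GRing.isZmodule.Build tens taddA taddC tadd0 taddN.

Lemma tscaleA a b (x : tens) : tscale a (tscale b x) = tscale (a * b) x.
Proof. by apply: tev_ext => X c hc; rewrite !tevE // scalerA. Qed.
Lemma tscale1 : left_id 1 tscale.
Proof. by move=> x; apply: tev_ext => X b hb; rewrite !tevE // scale1r. Qed.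
Lemma tscaleDr : right_distributive tscale +%R.
Proof. by move=> a x y; apply: tev_ext => X b hb; rewrite !tevE // scalerDr. Qed.
Lemma tscaleDl (x : tens) : {morph tscale^~ x : a b / a + b}.
Proof. by move=> a c; apply: tev_ext => X b hb; rewrite !tevE // scalerDl. Qed.

HB.instance Definition _ :=
  GRing.Zmodule_isLmodule.Build K tens tscaleA tscale1 tscaleDr tscaleDl.

Definition pure (u : U) (w : W) : tens := \pi_tens [:: (u, w)].

Lemma tev_pure X b u w : @bilinear_map X b -> tev b (pure u w) = b u w.
Proof. by move=> hb; rewrite tev_pi // /bisum big_seq1. Qed.

Lemma pure_bilinear : bilinear_map pure.
Proof.
split=> [w|u] a x y; apply: tev_ext => X b hb;
  rewrite tev_pure // (tev_add _ _ hb) (tev_scale _ _ hb) !tev_pure //; case: hb => h1 h2.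
- exact: h1.
- exact: h2.
Qed.

Lemma tev_linear X b : @bilinear_map X b -> linear (tev b).
Proof. by move=> hb a x y; rewrite (tev_add _ _ hb) (tev_scale _ _ hb). Qed.

Definition tlift X b (hb : @bilinear_map X b) : {linear tens -> X} :=
  mklin (tev_linear hb).

Lemma tlift_pure X b (hb : @bilinear_map X b) u w : tlift hb (pure u w) = b u w.
Proof. exact: tev_pure. Qed.

Lemma tens_pureE (x : tens) : x = \sum_(p <- repr x) pure p.1 p.2.
Proof.
apply: tev_ext => X b hb.
rewrite -[tev b (\sum_(p <- _) _)]/(tlift hb _) linear_sum.
by apply: eq_bigr => p _; rewrite tlift_pure.
Qed.

Lemma tens_ext (X : lmodType K) (f g : {linear tens -> X}) :
  (forall u w, f (pure u w) = g (pure u w)) -> f =1 g.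
Proof.
move=> h x; rewrite (tens_pureE x) !linear_sum.
by apply: eq_bigr => p _; exact: h.
Qed.

Lemma tens_universal (X : lmodType K) b : @bilinear_map X b ->
  exists! f : {linear tens -> X}, forall u w, f (pure u w) = b u w.
Proof.
move=> hb; exists (tlift hb); split=> [u w|g hg]; first exact: tlift_pure.
by apply/lin_eq/tens_ext => u w; rewrite tlift_pure hg.
Qed.

End Tensor.

Arguments mklin : simpl never.
Arguments tlift {K U W X b} hb : simpl never.

Section TensorMaps.
Variable K : fieldType.
Implicit Types U W X Y Z : lmodType K.

Lemma bilinZl U W X b a u w : @bilinear_map K U W X b -> b (a *: u) w = a *: b u w.
Proof. by case=> /(_ w) h _; exact: (linearZ_LR (mklin h)). Qed.
Lemma bilinZr U W X b a u w : @bilinear_map K U W X b -> b u (a *: w) = a *: b u w.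
Proof. by case=> _ /(_ u) h; exact: (linearZ_LR (mklin h)). Qed.
Lemma bilin0l U W X b w : @bilinear_map K U W X b -> b 0 w = 0.
Proof. by case=> /(_ w) h _; exact: (linear0 (mklin h)). Qed.

Lemma tmap_bilinear U U' W W' (f : {linear U -> U'}) (g : {linear W -> W'}) :
  bilinear_map (fun u w => pure (f u) (g w)).
Proof.
have [h1 h2] := pure_bilinear U' W'.
by split=> [w|u] a x y; rewrite linearP ?h1 ?h2.
Qed.

Definition tmap U U' W W' (f : {linear U -> U'}) (g : {linear W -> W'}) :
  {linear tens U W -> tens U' W'} := tlift (tmap_bilinear f g).

Lemma tmap_pure U U' W W' (f : {linear U -> U'}) (g : {linear W -> W'}) u w :
  tmap f g (pure u w) = pure (f u) (g w).
Proof. exact: tlift_pure. Qed.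

Lemma tassoc1_bilinear U W X (x : X) :
  bilinear_map (fun (u : U) (w : W) => pure u (pure w x)).
Proof.
have [h1 h2] := pure_bilinear U (tens W X).
have [h3 h4] := pure_bilinear W X.
by split=> [w|u] a y z; rewrite ?h1 ?h3 ?h2.
Qed.

Lemma tassoc_bilinear U W X :
  bilinear_map (fun (t : tens U W) (x : X) => tlift (tassoc1_bilinear U W x) t).
Proof.
have [h1 h2] := pure_bilinear U (tens W X).
have [h3 h4] := pure_bilinear W X.
split=> [x|t] a y z; first by rewrite linearP.
pose f := tlift (tassoc1_bilinear U W y); pose g := tlift (tassoc1_bilinear U W z).
apply: (tens_ext (g := (a \*: f \+ g : {linear _ -> _}))) => u w.
by rewrite -[RHS]/(a *: f _ + g _) !tlift_pure h4 h2.
Qed.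

Definition tassoc U W X : {linear tens (tens U W) X -> tens U (tens W X)} :=
  tlift (tassoc_bilinear U W X).

Lemma tassoc_pure U W X (u : U) (w : W) (x : X) :
  tassoc U W X (pure (pure u w) x) = pure u (pure w x).
Proof. by rewrite /tassoc !tlift_pure. Qed.

Lemma tassoci1_bilinear U W X (u : U) :
  bilinear_map (fun (w : W) (x : X) => pure (pure u w) x).
Proof.
have [h1 h2] := pure_bilinear U W.
have [h3 h4] := pure_bilinear (tens U W) X.
by split=> [w|x] a y z; rewrite ?h2 ?h3 ?h4.
Qed.

Lemma tassoci_bilinear U W X :
  bilinear_map (fun (u : U) (t : tens W X) => tlift (tassoci1_bilinear W X u) t).
Proof.
have [h1 h2] := pure_bilinear U W.
have [h3 h4] := pure_bilinear (tens U W) X.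
split=> [t|u] a y z; last by rewrite linearP.
pose f := tlift (tassoci1_bilinear W X y); pose g := tlift (tassoci1_bilinear W X z).
apply: (tens_ext (g := (a \*: f \+ g : {linear _ -> _}))) => w x.
by rewrite -[RHS]/(a *: f _ + g _) !tlift_pure h1 h3.
Qed.

Definition tassoci U W X : {linear tens U (tens W X) -> tens (tens U W) X} :=
  tlift (tassoci_bilinear U W X).

Lemma tassoci_pure U W X (u : U) (w : W) (x : X) :
  tassoci U W X (pure u (pure w x)) = pure (pure u w) x.
Proof. by rewrite /tassoci !tlift_pure. Qed.

Lemma tbraid_bilinear U W : bilinear_map (fun (u : U) (w : W) => pure w u).
Proof.
have [h1 h2] := pure_bilinear W U.
by split=> [w|u] a y z; rewrite ?h1 ?h2.
Qed.

Definition tbraid U W : {linear tens U W -> tens W U} := tlift (tbraid_bilinear U W).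

Lemma tbraid_pure U W (u : U) (w : W) : tbraid U W (pure u w) = pure w u.
Proof. exact: tlift_pure. Qed.

Lemma tlunit_bilinear U : bilinear_map (fun (a : K^o) (u : U) => a *: u).
Proof.
by split=> [u|b] a y z; rewrite ?scalerDl ?scalerDr -?scalerA // !scalerA mulrC.
Qed.

Definition tlunit U : {linear tens K^o U -> U} := tlift (tlunit_bilinear U).

Lemma tlunit_pure U (a : K^o) (u : U) : tlunit U (pure a u) = a *: u.
Proof. exact: tlift_pure. Qed.

Definition trunit U : {linear tens U K^o -> U} := lin_comp (tlunit U) (tbraid U K^o).

Lemma trunit_pure U (a : K^o) (u : U) : trunit U (pure u a) = a *: u.
Proof. by rewrite -[LHS]/(tlunit U (tbraid U K^o _)) tbraid_pure tlunit_pure. Qed.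

Definition tluniti U : {linear U -> tens K^o U} := mklin ((pure_bilinear K^o U).2 1).
Definition truniti U : {linear U -> tens U K^o} := mklin ((pure_bilinear U K^o).1 1).

Definition tensE := (tmap_pure, tassoc_pure, tassoci_pure, tbraid_pure, tlunit_pure,
  trunit_pure).

Lemma tens_eq U W X (f g : {linear tens U W -> X}) :
  (forall u w, f (pure u w) = g (pure u w)) -> f = g.
Proof. by move=> h; apply/lin_eq/tens_ext. Qed.

Lemma tens_eq3l U W X Y (f g : {linear tens (tens U W) X -> Y}) :
  (forall u w x, f (pure (pure u w) x) = g (pure (pure u w) x)) -> f = g.
Proof.
move=> h; apply: tens_eq => t x; move: t.
by apply: (tens_ext (f := lin_comp f (mklin ((pure_bilinear _ X).1 x)))
  (g := lin_comp g (mklin ((pure_bilinear _ X).1 x)))) => u w; exact: h.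
Qed.

Lemma tens_eq3r U W X Y (f g : {linear tens U (tens W X) -> Y}) :
  (forall u w x, f (pure u (pure w x)) = g (pure u (pure w x))) -> f = g.
Proof.
move=> h; apply: tens_eq => u.
by apply: (tens_ext (f := lin_comp f (mklin ((pure_bilinear U _).2 u)))
  (g := lin_comp g (mklin ((pure_bilinear U _).2 u)))) => w x; exact: h.
Qed.

Lemma tens_eq4l U W X Y Z (f g : {linear tens (tens (tens U W) X) Y -> Z}) :
  (forall u w x y, f (pure (pure (pure u w) x) y) = g (pure (pure (pure u w) x) y)) ->
  f = g.
Proof.
move=> h; apply: tens_eq => t y.
pose p := mklin ((pure_bilinear (tens (tens U W) X) Y).1 y).
suff e : lin_comp f p = lin_comp g p.
  exact: (f_equal (fun F : {linear _ -> _} => F t) e).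
by apply: tens_eq3l => u w x; exact: h.
Qed.

End TensorMaps.

Arguments tassoc {K} U W X.
Arguments tassoci {K} U W X.
Arguments tbraid {K} U W.
Arguments tlunit {K} U.
Arguments trunit {K} U.
Arguments tluniti {K} U.
Arguments truniti {K} U.

Record category := Category {
  obj :> Type;
  hom : obj -> obj -> Type;
  idm : forall a, hom a a;
  comp : forall a b c, hom b c -> hom a b -> hom a c;
  comp_idl : forall a b (f : hom a b), comp (idm b) f = f;
  comp_idr : forall a b (f : hom a b), comp f (idm a) = f;
  compA : forall a b c d (f : hom c d) (g : hom b c) (h : hom a b),
    comp f (comp g h) = comp (comp f g) h }.

Arguments hom {A} : rename.
Arguments idm {A} a : rename.
Arguments comp {A a b c} : rename.
Notation "g \oc f" := (comp g f) (at level 50, left associativity).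

Definition is_iso (A : category) (a b : A) (f : hom a b) : Prop :=
  exists g : hom b a, g \oc f = idm a /\ f \oc g = idm b.

(* The K-module structure on hom-sets is spelled out rather than bundled as an
   lmodType: hom-sets of the functor category on all finite dimensional
   quadratic spaces live in a universe above that of lmodType K. *)
Record linear_structure (K : fieldType) (A : category) := LinearStructure {
  hzero : forall a b : A, hom a b;
  hadd : forall a b : A, hom a b -> hom a b -> hom a b;
  hopp : forall a b : A, hom a b -> hom a b;
  hscale : forall a b : A, K -> hom a b -> hom a b;
  haddA : forall a b : A, associative (@hadd a b);
  haddC : forall a b : A, commutative (@hadd a b);
  hadd0 : forall a b : A, left_id (hzero a b) (@hadd a b);
  haddN : forall a b : A, left_inverse (hzero a b) (@hopp a b) (@hadd a b);
  hscaleA : forall (a b : A) s t (f : hom a b),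
    hscale s (hscale t f) = hscale (s * t) f;
  hscale1 : forall (a b : A) (f : hom a b), hscale 1 f = f;
  hscaleDr : forall (a b : A) s (f g : hom a b),
    hscale s (hadd f g) = hadd (hscale s f) (hscale s g);
  hscaleDl : forall (a b : A) s t (f : hom a b),
    hscale (s + t) f = hadd (hscale s f) (hscale t f);
  comp_linl : forall (a b c : A) s (g h : hom b c) (f : hom a b),
    hadd (hscale s g) h \oc f = hadd (hscale s (g \oc f)) (h \oc f);
  comp_linr : forall (a b c : A) s (f : hom b c) (g h : hom a b),
    f \oc hadd (hscale s g) h = hadd (hscale s (f \oc g)) (f \oc h) }.

Arguments hzero {K A} l a b.
Arguments hadd {K A} l {a b}.
Arguments hopp {K A} l {a b}.
Arguments hscale {K A} l {a b}.

Record monoidal_structure (A : category) := MonoidalStructure {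
  ot : A -> A -> A;
  otm : forall a a' b b' : A, hom a a' -> hom b b' -> hom (ot a b) (ot a' b');
  un : A;
  assoc : forall a b c : A, hom (ot (ot a b) c) (ot a (ot b c));
  lunit : forall a : A, hom (ot un a) a;
  runit : forall a : A, hom (ot a un) a;
  braid : forall a b : A, hom (ot a b) (ot b a);
  otm_id : forall a b : A, otm (idm a) (idm b) = idm (ot a b);
  otm_comp : forall (a a' a'' b b' b'' : A)
      (f' : hom a' a'') (f : hom a a') (g' : hom b' b'') (g : hom b b'),
    otm (f' \oc f) (g' \oc g) = otm f' g' \oc otm f g;
  assoc_iso : forall a b c : A, is_iso (assoc a b c);
  lunit_iso : forall a : A, is_iso (lunit a);
  runit_iso : forall a : A, is_iso (runit a);
  assoc_nat : forall (a a' b b' c c' : A)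
      (f : hom a a') (g : hom b b') (h : hom c c'),
    assoc a' b' c' \oc otm (otm f g) h = otm f (otm g h) \oc assoc a b c;
  lunit_nat : forall (a a' : A) (f : hom a a'),
    lunit a' \oc otm (idm un) f = f \oc lunit a;
  runit_nat : forall (a a' : A) (f : hom a a'),
    runit a' \oc otm f (idm un) = f \oc runit a;
  braid_nat : forall (a a' b b' : A) (f : hom a a') (g : hom b b'),
    braid a' b' \oc otm f g = otm g f \oc braid a b;
  pentagon : forall a b c d : A,
    assoc a b (ot c d) \oc assoc (ot a b) c d =
    otm (idm a) (assoc b c d) \oc assoc a (ot b c) d
      \oc otm (assoc a b c) (idm d);
  triangle : forall a b : A,
    otm (idm a) (lunit b) \oc assoc a un b = otm (runit a) (idm b);
  hexagon : forall a b c : A,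
    assoc b c a \oc braid a (ot b c) \oc assoc a b c =
    otm (idm b) (braid a c) \oc assoc b a c \oc otm (braid a b) (idm c);
  braidK : forall a b : A, braid b a \oc braid a b = idm (ot a b) }.

Arguments ot {A} m a b.
Arguments otm {A} m {a a' b b'}.
Arguments un {A} m.
Arguments assoc {A} m a b c.
Arguments lunit {A} m a.
Arguments runit {A} m a.
Arguments braid {A} m a b.

Record tensor_category (K : fieldType) := TensorCategory {
  tcat :> category;
  tlin : linear_structure K tcat;
  tmon : monoidal_structure tcat;
  otm_linl : forall (a a' b b' : tcat) s (f g : hom a a') (h : hom b b'),
    otm tmon (hadd tlin (hscale tlin s f) g) h =
    hadd tlin (hscale tlin s (otm tmon f h)) (otm tmon g h);
  otm_linr : forall (a a' b b' : tcat) s (f : hom a a') (g h : hom b b'),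
    otm tmon f (hadd tlin (hscale tlin s g) h) =
    hadd tlin (hscale tlin s (otm tmon f g)) (otm tmon f h) }.

Arguments tlin {K}.
Arguments tmon {K}.

Record functor (A B : category) := Functor {
  fobj :> A -> B;
  fmor : forall a b : A, hom a b -> hom (fobj a) (fobj b);
  fmor_id : forall a : A, fmor (idm a) = idm (fobj a);
  fmor_comp : forall (a b c : A) (g : hom b c) (f : hom a b),
    fmor (g \oc f) = fmor g \oc fmor f }.

Arguments fmor {A B} F {a b} : rename.

Section LinearLemmas.
Variables (K : fieldType) (A : category) (L : linear_structure K A).
Implicit Types a b c : A.

Lemma hadd_cancel0 a b (f : hom a b) : hadd L f f = f -> f = hzero L a b.
Proof.
by move=> h; rewrite -[LHS](hadd0 L) -(haddN L f) -haddA h.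
Qed.

Lemma hscale0l a b (f : hom a b) : hscale L 0 f = hzero L a b.
Proof. by apply: hadd_cancel0; rewrite -hscaleDl addr0. Qed.

Lemma hscale0r a b s : hscale L s (hzero L a b) = hzero L a b.
Proof. by apply: hadd_cancel0; rewrite -hscaleDr hadd0. Qed.

Lemma hopp_scale a b (f : hom a b) : hopp L f = hscale L (-1) f.
Proof.
have e : hadd L (hscale L (-1) f) f = hzero L a b.
  by rewrite -{2}[f](hscale1 L) -hscaleDl addNr hscale0l.
rewrite -[LHS](hadd0 L) haddC -e (haddC L _ f) haddA haddN.
by rewrite hadd0.
Qed.

Lemma comp_zerol a b c (f : hom a b) : hzero L b c \oc f = hzero L a c.
Proof.
apply: hadd_cancel0; rewrite -{1}[_ \oc f](hscale1 L) -comp_linl.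
by rewrite hscale0r hadd0.
Qed.

Lemma comp_zeror a b c (f : hom b c) : f \oc hzero L a b = hzero L a c.
Proof.
apply: hadd_cancel0; rewrite -{1}[f \oc _](hscale1 L) -comp_linr.
by rewrite hscale0r hadd0.
Qed.

Lemma comp_addl a b c (g h : hom b c) (f : hom a b) :
  hadd L g h \oc f = hadd L (g \oc f) (h \oc f).
Proof. by rewrite -{1}[g](hscale1 L) comp_linl hscale1. Qed.

Lemma comp_addr a b c (f : hom b c) (g h : hom a b) :
  f \oc hadd L g h = hadd L (f \oc g) (f \oc h).
Proof. by rewrite -{1}[g](hscale1 L) comp_linr hscale1. Qed.

Lemma comp_scalel a b c s (g : hom b c) (f : hom a b) :
  hscale L s g \oc f = hscale L s (g \oc f).
Proof.
rewrite -[hscale L s g](hadd0 L) haddC comp_linl comp_zerol haddC.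
by rewrite hadd0.
Qed.

Lemma comp_scaler a b c s (f : hom b c) (g : hom a b) :
  f \oc hscale L s g = hscale L s (f \oc g).
Proof.
rewrite -[hscale L s g](hadd0 L) haddC comp_linr comp_zeror haddC.
by rewrite hadd0.
Qed.

End LinearLemmas.

Section FunctorProperties.
Variable K : fieldType.

Definition fully_faithful (A B : category) (F : functor A B) : Prop :=
  forall a b : A, bijective (@fmor A B F a b).

Variables A B : tensor_category K.
Implicit Type F : functor A B.

Definition linear_functor F : Prop :=
  forall (a b : A) (s : K) (f g : hom a b),
    fmor F (hadd (tlin A) (hscale (tlin A) s f) g) =
    hadd (tlin B) (hscale (tlin B) s (fmor F f)) (fmor F g).

(* In an abelian category, 0 -> a -> b -> c is exact iff a -> b is a kernel
   of b -> c. *)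
Definition is_kernel (D : tensor_category K) (a b c : D)
    (k : hom a b) (f : hom b c) : Prop :=
  f \oc k = hzero (tlin D) a c /\
  forall (x : D) (g : hom x b), f \oc g = hzero (tlin D) x c ->
    exists! g' : hom x a, k \oc g' = g.

Definition left_exact F : Prop :=
  forall (a b c : A) (k : hom a b) (f : hom b c),
    is_kernel k f -> is_kernel (fmor F k) (fmor F f).

Let mA := tmon A.
Let mB := tmon B.

Record symmetric_monoidal F := SymmetricMonoidal {
  mu : forall a b : A, hom (ot mB (F a) (F b)) (F (ot mA a b));
  eps : hom (un mB) (F (un mA));
  mu_iso : forall a b : A, is_iso (mu a b);
  eps_iso : is_iso eps;
  mu_nat : forall (a a' b b' : A) (f : hom a a') (g : hom b b'),
    mu a' b' \oc otm mB (fmor F f) (fmor F g) = fmor F (otm mA f g) \oc mu a b;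
  mu_assoc : forall a b c : A,
    fmor F (assoc mA a b c) \oc mu (ot mA a b) c
      \oc otm mB (mu a b) (idm (F c)) =
    mu a (ot mA b c) \oc otm mB (idm (F a)) (mu b c)
      \oc assoc mB (F a) (F b) (F c);
  mu_lunit : forall a : A,
    fmor F (lunit mA a) \oc mu (un mA) a \oc otm mB eps (idm (F a)) =
    lunit mB (F a);
  mu_runit : forall a : A,
    fmor F (runit mA a) \oc mu a (un mA) \oc otm mB (idm (F a)) eps =
    runit mB (F a);
  mu_braid : forall a b : A,
    fmor F (braid mA a b) \oc mu a b = mu b a \oc braid mB (F a) (F b) }.

End FunctorProperties.

Section FunctorCategory.
Variable A : category.

Record nat_trans (B : category) (F G : functor A B) := NatTrans {
  ncomp :> forall a : A, hom (F a) (G a);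
  ncomp_nat : forall (a b : A) (f : hom a b),
    ncomp b \oc fmor F f = fmor G f \oc ncomp a }.

Lemma nat_trans_eq (B : category) (F G : functor A B) (s t : nat_trans F G) :
  (forall a, s a = t a) -> s = t.
Proof.
case: s t => s hs [t ht] /= h.
have e : s = t by exact: functional_extensionality_dep.
by case: _ / e in ht *; rewrite (Prop_irrelevance hs ht).
Qed.

Definition nat_id (B : category) (F : functor A B) : nat_trans F F.
Proof.
refine (@NatTrans B F F (fun a => idm (F a)) _); abstract (by move=> a b f;
   rewrite comp_idl comp_idr).
Defined.

Definition nat_comp (B : category) (F G H : functor A B)
  (s : nat_trans G H) (t : nat_trans F G) : nat_trans F H.
Proof.
refine (@NatTrans B F H (fun a => s a \oc t a) _); abstract (by move=> a b f;
   rewrite -compA ncomp_nat compA ncomp_nat compA).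
Defined.

Definition functor_cat (B : category) : category.
Proof.
refine (@Category (functor A B) (@nat_trans B) (@nat_id B) (@nat_comp B) _ _ _).
- abstract (by move=> F G s; apply: nat_trans_eq => a; exact: comp_idl).
- abstract (by move=> F G s; apply: nat_trans_eq => a; exact: comp_idr).
- abstract (by move=> F G H I s t r; apply: nat_trans_eq => a; exact: compA).
Defined.

Lemma nat_hom_eq (B : category) (F G : functor_cat B) (s t : hom F G) :
  (forall a, (s : nat_trans F G) a = (t : nat_trans F G) a) -> s = t.
Proof. exact: nat_trans_eq. Qed.

Lemma nat_iso (B : category) (F G : functor A B) (s : nat_trans F G) :
  (forall a, is_iso (s a)) -> is_iso (s : @hom (functor_cat B) F G).
Proof.
move=> h; pose t a : hom (G a) (F a) := projT1 (cid (h a)).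
have ht a : t a \oc s a = idm (F a) /\ s a \oc t a = idm (G a).
  exact: projT2 (cid (h a)).
suff nt (a b : A) (f : hom a b) : t b \oc fmor G f = fmor F f \oc t a.
  exists (NatTrans nt : @hom (functor_cat B) G F).
  by split; apply: nat_hom_eq => a; case: (ht a).
have [_ h1] := ht a; have [h2 _] := ht b.
by rewrite -[LHS]comp_idr -h1 compA -[_ \oc _ \oc s a]compA -ncomp_nat compA h2 comp_idl.
Qed.

Variables (K : fieldType) (B : tensor_category K).
Let lB := tlin B.
Let mB := tmon B.

Implicit Types F G H : functor A B.

Definition nat_zero F G : nat_trans F G.
Proof.
refine (@NatTrans B F G (fun a => hzero lB (F a) (G a)) _); abstract (by move=> a b f;
   rewrite comp_zerol comp_zeror).
Defined.

Definition nat_add F G (s t : nat_trans F G) : nat_trans F G.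
Proof.
refine (@NatTrans B F G (fun a => hadd lB (s a) (t a)) _); abstract (by move=> a b f;
   rewrite comp_addl comp_addr !ncomp_nat).
Defined.

Definition nat_scale F G (x : K) (s : nat_trans F G) : nat_trans F G.
Proof.
refine (@NatTrans B F G (fun a => hscale lB x (s a)) _); abstract (by move=> a b f;
   rewrite comp_scalel comp_scaler !ncomp_nat).
Defined.

Definition nat_opp F G (s : nat_trans F G) : nat_trans F G.
Proof.
refine (@NatTrans B F G (fun a => hopp lB (s a)) _); abstract (by move=> a b f;
   rewrite !hopp_scale comp_scalel comp_scaler !ncomp_nat).
Defined.

Definition functor_lin : linear_structure K (functor_cat B).
Proof.
refine (@LinearStructure K (functor_cat B)
  nat_zero nat_add nat_opp nat_scale _ _ _ _ _ _ _ _ _ _).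
- abstract (by move=> F G s t r; apply: nat_hom_eq => a; exact: haddA).
- abstract (by move=> F G s t; apply: nat_hom_eq => a; exact: haddC).
- abstract (by move=> F G s; apply: nat_hom_eq => a; exact: hadd0).
- abstract (by move=> F G s; apply: nat_hom_eq => a; exact: haddN).
- abstract (by move=> *; apply: nat_hom_eq => a; exact: hscaleA).
- abstract (by move=> *; apply: nat_hom_eq => a; exact: hscale1).
- abstract (by move=> *; apply: nat_hom_eq => a; exact: hscaleDr).
- abstract (by move=> *; apply: nat_hom_eq => a; exact: hscaleDl).
- abstract (by move=> *; apply: nat_hom_eq => a; exact: comp_linl).
- abstract (by move=> *; apply: nat_hom_eq => a; exact: comp_linr).
Defined.

Definition functor_ot F G : functor A B.
Proof.
refine (@Functor A B (fun a => ot mB (F a) (G a))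
  (fun a b f => otm mB (fmor F f) (fmor G f)) _ _).
- abstract (by move=> a; rewrite !fmor_id otm_id).
- abstract (by move=> a b c g f; rewrite !fmor_comp otm_comp).
Defined.

Definition functor_un : functor A B.
Proof.
refine (@Functor A B (fun=> un mB) (fun a b f => idm (un mB)) _ _); abstract (by move=> *;
   rewrite ?comp_idl).
Defined.

Definition nat_otm F F' G G' (s : nat_trans F F') (t : nat_trans G G') :
  nat_trans (functor_ot F G) (functor_ot F' G').
Proof.
refine (@NatTrans B (functor_ot F G) (functor_ot F' G')
     (fun a => otm mB (s a) (t a)) _); abstract (by move=> a b f /=;
   rewrite -!otm_comp !ncomp_nat).
Defined.

Definition nat_assoc F G H :
  nat_trans (functor_ot (functor_ot F G) H) (functor_ot F (functor_ot G H)) :=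
  @NatTrans B (functor_ot (functor_ot F G) H) (functor_ot F (functor_ot G H))
    (fun a => assoc mB (F a) (G a) (H a))
    (fun a b f => assoc_nat mB (fmor F f) (fmor G f) (fmor H f)).

Definition nat_lunit F : nat_trans (functor_ot functor_un F) F :=
  @NatTrans B (functor_ot functor_un F) F (fun a => lunit mB (F a))
    (fun a b f => lunit_nat mB (fmor F f)).

Definition nat_runit F : nat_trans (functor_ot F functor_un) F :=
  @NatTrans B (functor_ot F functor_un) F (fun a => runit mB (F a))
    (fun a b f => runit_nat mB (fmor F f)).

Definition nat_braid F G : nat_trans (functor_ot F G) (functor_ot G F) :=
  @NatTrans B (functor_ot F G) (functor_ot G F) (fun a => braid mB (F a) (G a))
    (fun a b f => braid_nat mB (fmor F f) (fmor G f)).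

Definition functor_mon : monoidal_structure (functor_cat B).
Proof.
refine (@MonoidalStructure (functor_cat B) functor_ot nat_otm functor_un
  nat_assoc nat_lunit nat_runit nat_braid _ _ _ _ _ _ _ _ _ _ _ _ _).
- abstract (by move=> F G; apply: nat_hom_eq => a; exact: otm_id).
- abstract (by move=> *; apply: nat_hom_eq => a; exact: otm_comp).
- abstract (by move=> F G H; apply: nat_iso => a; exact: assoc_iso).
- abstract (by move=> F; apply: nat_iso => a; exact: lunit_iso).
- abstract (by move=> F; apply: nat_iso => a; exact: runit_iso).
- abstract (by move=> *; apply: nat_hom_eq => a; exact: assoc_nat).
- abstract (by move=> *; apply: nat_hom_eq => a; exact: lunit_nat).
- abstract (by move=> *; apply: nat_hom_eq => a; exact: runit_nat).
- abstract (by move=> *; apply: nat_hom_eq => a; exact: braid_nat).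
- abstract (by move=> *; apply: nat_hom_eq => a; exact: pentagon).
- abstract (by move=> *; apply: nat_hom_eq => a; exact: triangle).
- abstract (by move=> *; apply: nat_hom_eq => a; exact: hexagon).
- abstract (by move=> *; apply: nat_hom_eq => a; exact: braidK).
Defined.

Definition functor_tcat : tensor_category K.
Proof.
refine (@TensorCategory K (functor_cat B) functor_lin functor_mon _ _).
- abstract (by move=> *; apply: nat_hom_eq => a; exact: otm_linl).
- abstract (by move=> *; apply: nat_hom_eq => a; exact: otm_linr).
Defined.

End FunctorCategory.

Section FullSubcategory.
Variables (K : fieldType) (A : tensor_category K) (P : A -> Prop).

Definition full_cat : category :=
  @Category {a : A | P a} (fun a b => hom (sval a) (sval b))
    (fun a => idm (sval a)) (fun a b c g f => g \oc f)
    (fun a b => @comp_idl A (sval a) (sval b))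
    (fun a b => @comp_idr A (sval a) (sval b))
    (fun a b c d => @compA A (sval a) (sval b) (sval c) (sval d)).

Hypothesis P_un : P (un (tmon A)).
Hypothesis P_ot : forall a b, P a -> P b -> P (ot (tmon A) a b).

Definition full_lin : linear_structure K full_cat.
Proof.
refine (@LinearStructure K full_cat
  (fun a b => hzero (tlin A) (sval a) (sval b)) (fun a b => hadd (tlin A))
  (fun a b => hopp (tlin A)) (fun a b => hscale (tlin A))
  _ _ _ _ _ _ _ _ _ _) => *.
- abstract (exact: (@haddA K A (tlin A))).
- abstract (exact: (@haddC K A (tlin A))).
- abstract (exact: (@hadd0 K A (tlin A))).
- abstract (exact: (@haddN K A (tlin A))).
- abstract (exact: (@hscaleA K A (tlin A))).
- abstract (exact: (@hscale1 K A (tlin A))).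
- abstract (exact: (@hscaleDr K A (tlin A))).
- abstract (exact: (@hscaleDl K A (tlin A))).
- abstract (exact: (@comp_linl K A (tlin A))).
- abstract (exact: (@comp_linr K A (tlin A))).
Defined.

Let M := tmon A.

Definition full_ot (a b : full_cat) : full_cat :=
  exist P (ot M (sval a) (sval b)) (P_ot (svalP a) (svalP b)).

Definition full_mon : monoidal_structure full_cat.
Proof.
refine (@MonoidalStructure full_cat full_ot
  (fun a a' b b' f g => otm M f g) (exist P (un M) P_un)
  (fun a b c => assoc M (sval a) (sval b) (sval c))
  (fun a => lunit M (sval a)) (fun a => runit M (sval a))
  (fun a b => braid M (sval a) (sval b)) _ _ _ _ _ _ _ _ _ _ _ _ _) => *.
- abstract (exact: (@otm_id A M)).
- abstract (exact: (@otm_comp A M)).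
- abstract (exact: (@assoc_iso A M)).
- abstract (exact: (@lunit_iso A M)).
- abstract (exact: (@runit_iso A M)).
- abstract (exact: (@assoc_nat A M)).
- abstract (exact: (@lunit_nat A M)).
- abstract (exact: (@runit_nat A M)).
- abstract (exact: (@braid_nat A M)).
- abstract (exact: (@pentagon A M)).
- abstract (exact: (@triangle A M)).
- abstract (exact: (@hexagon A M)).
- abstract (exact: (@braidK A M)).
Defined.

Definition full_tcat : tensor_category K.
Proof.
refine (@TensorCategory K full_cat full_lin full_mon _ _) => *.
- abstract (exact: (@otm_linl K A)).
- abstract (exact: (@otm_linr K A)).
Defined.

End FullSubcategory.

Section Vect.
Variable K : fieldType.
Implicit Types U W X Y : lmodType K.

Definition vect_cat : category.
Proof.
refine (@Category (lmodType K) (fun U W => {linear U -> W}) (@lin_id K)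
  (fun U W X g f => lin_comp g f) _ _ _); abstract (by move=> *; exact: lin_eq).
Defined.

Definition vect_lin : linear_structure K vect_cat.
Proof.
refine (@LinearStructure K vect_cat
  (fun U W => (\0 : {linear U -> W}))
  (fun U W f g => (f \+ g : {linear U -> W}))
  (fun U W f => (\- f : {linear U -> W}))
  (fun U W a f => (a \*: f : {linear U -> W})) _ _ _ _ _ _ _ _ _ _).
- abstract (by move=> U W f g h; apply: lin_eq => x; exact: addrA).
- abstract (by move=> U W f g; apply: lin_eq => x; exact: addrC).
- abstract (by move=> U W f; apply: lin_eq => x; exact: add0r).
- abstract (by move=> U W f; apply: lin_eq => x; exact: addNr).
- abstract (by move=> U W s t f; apply: lin_eq => x; exact: scalerA).
- abstract (by move=> U W f; apply: lin_eq => x; exact: scale1r).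
- abstract (by move=> U W s f g; apply: lin_eq => x; exact: scalerDr).
- abstract (by move=> U W s t f; apply: lin_eq => x; exact: scalerDl).
- abstract (by move=> U W X s g h f; apply: lin_eq).
- abstract (by move=> U W X s f g h; apply: lin_eq => x; exact: linearP).
Defined.

Lemma vect_compE U W X (g : {linear W -> X}) (f : {linear U -> W}) x :
  (@comp vect_cat U W X g f : {linear U -> X}) x = g (f x).
Proof. by []. Qed.

Lemma vect_idE U x : (@idm vect_cat U : {linear U -> U}) x = x.
Proof. by []. Qed.

Lemma vect_otm_id U W : tmap (lin_id U) (lin_id W) = lin_id (tens U W).
Proof. by apply: tens_eq => u w; rewrite tensE !lin_idE. Qed.

Lemma tassocK U W X :
  lin_comp (tassoci U W X) (tassoc U W X) = lin_id (tens (tens U W) X) /\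
  lin_comp (tassoc U W X) (tassoci U W X) = lin_id (tens U (tens W X)).
Proof.
split; [apply: tens_eq3l | apply: tens_eq3r] => u w x;
  by rewrite lin_compE lin_idE !tensE.
Qed.

Lemma tbraidK U W : lin_comp (tbraid W U) (tbraid U W) = lin_id (tens U W).
Proof. by apply: tens_eq => u w; rewrite lin_compE lin_idE !tensE. Qed.

Lemma tlunitK U :
  lin_comp (tluniti U) (tlunit U) = lin_id (tens K^o U) /\
  lin_comp (tlunit U) (tluniti U) = lin_id U.
Proof.
split; first apply: tens_eq => a u.
  rewrite -[LHS]/(pure 1 (tlunit U (pure a u))) tensE.
  by rewrite (bilinZr _ _ _ (pure_bilinear _ _))
    -(bilinZl _ _ _ (pure_bilinear _ _)) [a *: _]mulr1.
by apply: lin_eq => u; rewrite -[LHS]/(tlunit U (pure 1 u)) tensE scale1r.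
Qed.

Lemma trunitK U :
  lin_comp (truniti U) (trunit U) = lin_id (tens U K^o) /\
  lin_comp (trunit U) (truniti U) = lin_id U.
Proof.
split; first apply: tens_eq => u a.
  rewrite -[LHS]/(pure (trunit U (pure u a)) 1) tensE.
  by rewrite (bilinZl _ _ _ (pure_bilinear _ _))
    -(bilinZr _ _ _ (pure_bilinear _ _)) [a *: _]mulr1.
by apply: lin_eq => u; rewrite -[LHS]/(trunit U (pure u 1)) tensE scale1r.
Qed.

Definition vect_mon : monoidal_structure vect_cat.
Proof.
refine (@MonoidalStructure vect_cat (fun U W => tens U W)
  (fun U U' W W' f g => tmap f g) K^o tassoc tlunit trunit tbraid
  _ _ _ _ _ _ _ _ _ _ _ _ _).
- abstract (exact: vect_otm_id).
- abstract (by move=> *; apply: tens_eq => u w; rewrite vect_compE !tensE).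
- abstract (by move=> U W X; exists (tassoci U W X); exact: tassocK).
- abstract (by move=> U; exists (tluniti U); exact: tlunitK).
- abstract (by move=> U; exists (truniti U); exact: trunitK).
- abstract (by move=> *; apply: tens_eq3l => u w x; rewrite !vect_compE !tensE).
- abstract (by move=> *; apply: tens_eq => a u; rewrite !vect_compE !tensE linearZ_LR).
- abstract (by move=> *; apply: tens_eq => u a; rewrite !vect_compE !tensE linearZ_LR).
- abstract (by move=> *; apply: tens_eq => u w; rewrite !vect_compE !tensE).
- abstract (by move=> *; apply: tens_eq4l => u w x y; rewrite !vect_compE !tensE !vect_idE).
- abstract (move=> U W;
    apply: tens_eq3l => u a w;
    rewrite !vect_compE !tensE !vect_idE;
    by rewrite (bilinZl _ _ _ (pure_bilinear _ _)) (bilinZr _ _ _ (pure_bilinear _ _))).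
- abstract (by move=> *; apply: tens_eq3l => u w x; rewrite !vect_compE !tensE !vect_idE).
- abstract (by move=> U W; exact: tbraidK).
Defined.

Definition vect_tcat : tensor_category K.
Proof.
refine (@TensorCategory K vect_cat vect_lin vect_mon _ _).
- abstract (move=> U U' W W' s f g h;
    apply: tens_eq => u w;
    rewrite -[RHS]/(s *: tmap f h _ + tmap g h _) !tensE;
    exact: (pure_bilinear U' W').1).
- abstract (move=> U U' W W' s f g h;
    apply: tens_eq => u w;
    rewrite -[RHS]/(s *: tmap f g _ + tmap f h _) !tensE;
    exact: (pure_bilinear U' W').2).
Defined.

(* Finite dimensionality of an arbitrary lmodType, as existence of a finite
   spanning family. *)
Definition findim U : Prop :=
  exists (n : nat) (e : 'I_n -> U), forall u, exists c : 'I_n -> K,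
    u = \sum_(i < n) c i *: e i.

Lemma findimP (T : finType) U (e : T -> U) :
  (forall u, exists c : T -> K, u = \sum_i c i *: e i) -> findim U.
Proof.
move=> h; exists #|T|, (e \o enum_val) => u; have [c ->] := h u.
exists (c \o enum_val); rewrite (reindex_onto enum_val enum_rank) /=; last first.
  by move=> t _; rewrite enum_rankK.
by apply: eq_bigl => i; rewrite enum_valK eqxx.
Qed.

Lemma findim_unit : findim K^o.
Proof. by exists 1, (fun=> 1) => a; exists (fun=> a); rewrite big_ord1 [a *: _]mulr1. Qed.

Lemma findim_tens U W : findim U -> findim W -> findim (tens U W).
Proof.
move=> [n [e he]] [m [f hf]].
apply: (@findimP ('I_n * 'I_m)%type _ (fun p => pure (e p.1) (f p.2))) => x.
rewrite (tens_pureE x); elim: (repr x) => [|p s [c IH]].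
  by exists (fun=> 0); rewrite big_nil big1 // => i _; rewrite scale0r.
have [a ha] := he p.1; have [b hb] := hf p.2.
exists (fun q => a q.1 * b q.2 + c q); rewrite big_cons IH.
under [RHS]eq_bigr do rewrite scalerDl.
rewrite big_split /=; congr (_ + _).
rewrite {1}ha {1}hb.
pose F := mklin ((pure_bilinear U W).1 (\sum_(j < m) b j *: f j)).
transitivity (\sum_i \sum_j (a i * b j) *: pure (e i) (f j)); last first.
  by rewrite pair_bigA.
rewrite -[LHS]/(F _) linear_sum; apply: eq_bigr => i _; rewrite linearZ_LR.
rewrite -[F _]/(mklin ((pure_bilinear U W).2 (e i)) _) linear_sum scaler_sumr.
by apply: eq_bigr => j _; rewrite linearZ_LR scalerA.
Qed.

Definition vectf_tcat : tensor_category K :=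
  @full_tcat K vect_tcat findim findim_unit findim_tens.

End Vect.

Section Rep.
Variables (K : fieldType) (G : groupType).

Record rep := Rep {
  rep_sp :> lmodType K;
  act : G -> {linear rep_sp -> rep_sp};
  act1 : forall x, act 1%g x = x;
  actM : forall g h x, act (g * h)%g x = act g (act h x) }.

Record rep_hom (U W : rep) := RepHom {
  rep_lin :> {linear U -> W};
  rep_equiv : forall g x, rep_lin (act U g x) = act W g (rep_lin x) }.

Lemma rep_hom_eq U W (f g : rep_hom U W) :
  rep_lin f = rep_lin g -> f = g.
Proof.
case: f g => f hf [g hg] /= e.
by case: _ / e in hg *; rewrite (Prop_irrelevance hf hg).
Qed.

Definition rep_id U : rep_hom U U := @RepHom U U (lin_id U) (fun g x => erefl).

Definition rep_comp U W X (g : rep_hom W X) (f : rep_hom U W) : rep_hom U X.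
Proof.
refine (@RepHom U X (lin_comp g f) _); abstract (by move=> a x;
   rewrite lin_compE !rep_equiv).
Defined.

Definition rep_cat : category.
Proof.
refine (@Category rep rep_hom rep_id rep_comp _ _ _); abstract (by move=> *;
   apply/rep_hom_eq/lin_eq).
Defined.

Lemma rep_cat_eq (U W : rep_cat) (f g : hom U W) :
  rep_lin f = rep_lin g -> f = g.
Proof. exact: rep_hom_eq. Qed.

Lemma rep_iso (U W : rep) (f : rep_hom U W) :
  is_iso (rep_lin f : @hom (vect_cat K) U W) -> is_iso (f : @hom rep_cat U W).
Proof.
move=> [g [gf fg]].
have gfE x : g (f x) = x by exact: (f_equal (fun F : {linear _ -> _} => F x) gf).
have fgE x : f (g x) = x by exact: (f_equal (fun F : {linear _ -> _} => F x) fg).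
have ge a x : g (act W a x) = act U a (g x).
  by rewrite -{1}[x]fgE -rep_equiv gfE.
by exists (RepHom ge : @hom rep_cat W U); split; apply: rep_cat_eq.
Qed.

Definition rep_zero U W : rep_hom U W.
Proof.
refine (@RepHom U W (\0 : {linear U -> W}) _); abstract (by move=> g x; rewrite linear0).
Defined.

Definition rep_add U W (f f' : rep_hom U W) : rep_hom U W.
Proof.
refine (@RepHom U W (f \+ f' : {linear U -> W}) _); abstract (by move=> g x /=;
   rewrite !rep_equiv linearD).
Defined.

Definition rep_opp U W (f : rep_hom U W) : rep_hom U W.
Proof.
refine (@RepHom U W (\- f : {linear U -> W}) _); abstract (by move=> g x /=;
   rewrite !rep_equiv linearN).
Defined.

Definition rep_scale U W (a : K) (f : rep_hom U W) : rep_hom U W.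
Proof.
refine (@RepHom U W (a \*: f : {linear U -> W}) _); abstract (by move=> g x /=;
   rewrite !rep_equiv linearZ_LR).
Defined.

Let L := vect_lin K.
Let M := vect_mon K.

Definition rep_lins : linear_structure K rep_cat.
Proof.
refine (@LinearStructure K rep_cat rep_zero rep_add rep_opp rep_scale
  _ _ _ _ _ _ _ _ _ _).
- abstract (by move=> U W f g h; apply: rep_cat_eq; exact: (haddA L)).
- abstract (by move=> U W f g; apply: rep_cat_eq; exact: (haddC L)).
- abstract (by move=> U W f; apply: rep_cat_eq; exact: (hadd0 L)).
- abstract (by move=> U W f; apply: rep_cat_eq; exact: (haddN L)).
- abstract (by move=> *; apply: rep_cat_eq; exact: (hscaleA L)).
- abstract (by move=> *; apply: rep_cat_eq; exact: (hscale1 L)).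
- abstract (by move=> *; apply: rep_cat_eq; exact: (hscaleDr L)).
- abstract (by move=> *; apply: rep_cat_eq; exact: (hscaleDl L)).
- abstract (by move=> *; apply: rep_cat_eq; exact: (comp_linl L)).
- abstract (by move=> *; apply: rep_cat_eq; exact: (comp_linr L)).
Defined.

Definition triv_rep : rep :=
  @Rep K^o (fun=> lin_id K^o) (fun x => erefl) (fun g h x => erefl).

Definition tens_rep (U W : rep) : rep.
Proof.
refine (@Rep (tens U W) (fun g => tmap (act U g) (act W g)) _ _).
- abstract (move=> x;
    apply: (tens_ext (g := lin_id _)) => u w;
    by rewrite tensE lin_idE !act1).
- abstract (move=> g h x;
    apply: (tens_ext (g := lin_comp (tmap (act U g) (act W g)) (tmap (act U h) (act W h))))
    => u w; by rewrite lin_compE !tensE !actM).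
Defined.

Definition rep_tmap U U' W W' (f : rep_hom U U') (g : rep_hom W W') :
  rep_hom (tens_rep U W) (tens_rep U' W').
Proof.
refine (@RepHom (tens_rep U W) (tens_rep U' W') (tmap f g) _).
abstract (move=> a x;
  apply: (tens_ext (f := lin_comp (tmap f g) (act (tens_rep U W) a))
    (g := lin_comp (act (tens_rep U' W') a) (tmap f g))) => u w;
  by rewrite !lin_compE !tensE !rep_equiv).
Defined.

Definition rep_assoc U W X :
  rep_hom (tens_rep (tens_rep U W) X) (tens_rep U (tens_rep W X)).
Proof.
refine (@RepHom (tens_rep (tens_rep U W) X) (tens_rep U (tens_rep W X))
  (tassoc U W X) _).
abstract (move=> g x; exact: (f_equal (fun F : {linear _ -> _} => F x)
  (assoc_nat M (act U g) (act W g) (act X g)))).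
Defined.

Definition rep_lunit U : rep_hom (tens_rep triv_rep U) U.
Proof.
refine (@RepHom (tens_rep triv_rep U) U (tlunit U) _).
abstract (move=> g x;
    exact: (f_equal (fun F : {linear _ -> _} => F x) (lunit_nat M (act U g)))).
Defined.

Definition rep_runit U : rep_hom (tens_rep U triv_rep) U.
Proof.
refine (@RepHom (tens_rep U triv_rep) U (trunit U) _).
abstract (move=> g x;
    exact: (f_equal (fun F : {linear _ -> _} => F x) (runit_nat M (act U g)))).
Defined.

Definition rep_braid U W : rep_hom (tens_rep U W) (tens_rep W U).
Proof.
refine (@RepHom (tens_rep U W) (tens_rep W U) (tbraid U W) _).
abstract (move=> g x; exact: (f_equal (fun F : {linear _ -> _} => F x)
  (braid_nat M (act U g) (act W g)))).
Defined.

Definition rep_mon : monoidal_structure rep_cat.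
Proof.
refine (@MonoidalStructure rep_cat tens_rep rep_tmap triv_rep
  rep_assoc rep_lunit rep_runit rep_braid _ _ _ _ _ _ _ _ _ _ _ _ _).
- abstract (by move=> *; apply: rep_cat_eq; exact: (otm_id M)).
- abstract (by move=> *; apply: rep_cat_eq; exact: (otm_comp M)).
- abstract (by move=> *; apply: rep_iso; exact: (assoc_iso M)).
- abstract (by move=> *; apply: rep_iso; exact: (lunit_iso M)).
- abstract (by move=> *; apply: rep_iso; exact: (runit_iso M)).
- abstract (by move=> *; apply: rep_cat_eq; exact: (assoc_nat M)).
- abstract (by move=> *; apply: rep_cat_eq; exact: (lunit_nat M)).
- abstract (by move=> *; apply: rep_cat_eq; exact: (runit_nat M)).
- abstract (by move=> *; apply: rep_cat_eq; exact: (braid_nat M)).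
- abstract (by move=> *; apply: rep_cat_eq; exact: (pentagon M)).
- abstract (by move=> *; apply: rep_cat_eq; exact: (triangle M)).
- abstract (by move=> *; apply: rep_cat_eq; exact: (hexagon M)).
- abstract (by move=> *; apply: rep_cat_eq; exact: (braidK M)).
Defined.

Definition rep_tcat : tensor_category K.
Proof.
refine (@TensorCategory K rep_cat rep_lins rep_mon _ _).
- abstract (by move=> *; apply: rep_cat_eq; exact: (@otm_linl _ (vect_tcat K))).
- abstract (by move=> *; apply: rep_cat_eq; exact: (@otm_linr _ (vect_tcat K))).
Defined.

End Rep.

Arguments act {K G} r g.

Section Retraction.
Local Open Scope classical_set_scope.
Variables (K : fieldType) (U W : lmodType K) (f : {linear U -> W}).
Hypothesis f_inj : injective f.

Lemma lin_retract : exists r : {linear W -> U}, forall u, r (f u) = u.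
Proof.
pose P (A : set W) := (forall a x y, A x -> A y -> A (a *: x + y)) /\
  (forall u, A (f u) -> u = 0).
have [A [[Alin Aker] Amax]] : exists A, P A /\ forall B, A `<` B -> ~ P B.
  apply: Zorn_bigcup => F FP Ftot; split.
    move=> a x y [X FX Xx] [Y FY Yy].
    have [XY|YX] := Ftot _ _ FX FY.
      by exists Y => //; apply: (FP _ FY).1 => //; exact: XY.
    by exists X => //; apply: (FP _ FX).1 => //; exact: YX.
  by move=> u [X FX]; exact: (FP _ FX).2.
have A0 : A 0.
  apply: contrapT => nA0.
  have nA x : ~ A x by move=> Ax; apply: nA0; rewrite -(addNr x) -scaleN1r; exact: Alin.
  apply: (Amax [set 0]); split.
  - by move=> x /nA.
  - by move=> h; apply: nA0; exact: h.
  - by move=> a x y -> ->; rewrite scaler0 addr0.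
  - by move=> u /= e; apply: f_inj; rewrite e linear0.
have Adec w : exists u, A (w - f u).
  apply: contrapT => nw.
  apply: (Amax [set x | exists y c, A y /\ x = y + c *: w]); split.
  - by move=> x Ax; exists x, 0; rewrite scale0r addr0.
  - move=> h; apply: nw; exists 0; rewrite linear0 subr0; apply: h.
    by exists 0, 1; rewrite scale1r add0r.
  - move=> a x y [x' [c [Ax ->]]] [y' [d [Ay ->]]].
    exists (a *: x' + y'), (a * c + d); split; first exact: Alin.
    by rewrite scalerDr scalerDl scalerA addrACA.
  - move=> u [y [c [Ay e]]]; have [c0|c0] := eqVneq c 0.
      by apply: Aker; rewrite e c0 scale0r addr0.
    case: nw; exists (c^-1 *: u); rewrite linearZ_LR e scalerDr scalerA mulVf //.
    rewrite scale1r opprD addrCA subrr addr0 -[- _]addr0 -scalerN -[- y]scaleN1r scalerA.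
    exact: Alin.
have [r hr] := choice Adec.
have runiq w u : A (w - f u) -> r w = u.
  move=> Au; apply/eqP; rewrite -subr_eq0; apply/eqP/Aker.
  have := Alin (-1) _ _ (hr w) Au.
  by rewrite scaleN1r opprB addrA subrK linearB.
have rlin : linear r.
  move=> a x y; apply: runiq.
  have := Alin a _ _ (hr x) (hr y).
  by rewrite linearP scalerBr opprD addrACA.
by exists (mklin rlin) => u; apply: runiq; rewrite subrr.
Qed.

End Retraction.

Lemma tmap_inj (K : fieldType) (U U' W W' : lmodType K)
    (f : {linear U -> U'}) (g : {linear W -> W'}) :
  injective f -> injective g -> injective (tmap f g).
Proof.
move=> /lin_retract[r hr] /lin_retract[s hs]; apply: (can_inj (g := tmap r s)).
apply: (tens_ext (f := lin_comp (tmap r s) (tmap f g)) (g := lin_id _)) => u w.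
by rewrite lin_compE lin_idE !tensE hr hs.
Qed.

Lemma tmap_surj (K : fieldType) (U U' W W' : lmodType K)
    (f : {linear U -> U'}) (g : {linear W -> W'}) :
  (forall x, exists u, f u = x) -> (forall y, exists w, g w = y) ->
  forall z, exists t, tmap f g t = z.
Proof.
move=> fs gs z; rewrite (tens_pureE z); elim: (repr z) => [|p s [t ht]].
  by exists 0; rewrite linear0 big_nil.
have [u hu] := fs p.1; have [w hw] := gs p.2.
by exists (pure u w + t); rewrite linearD ht tensE hu hw big_cons.
Qed.

Section Algebraic.
Variables (K : fieldType) (G : groupType).
Implicit Types U W X : rep K G.

Definition zero_rep : rep K G :=
  @Rep K G 'rV[K]_0 (fun=> lin_id _) (fun x => erefl) (fun g h x => erefl).

Lemma dsum_act_linear U W (g : G) :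
  linear (fun p : U * W => (act U g p.1, act W g p.2)).
Proof. by move=> a p q /=; rewrite !linearP. Qed.

Definition dsum_rep U W : rep K G.
Proof.
refine (@Rep K G (U * W)%type (fun g => mklin (@dsum_act_linear U W g)) _ _).
- abstract (by move=> [u w]; rewrite -[LHS]/(act U 1%g u, act W 1%g w) !act1).
- abstract (move=> g h [u w]; by rewrite -[LHS]/(act U (g * h)%g u, act W (g * h)%g w) !actM).
Defined.

Variable V : rep K G.

Fixpoint tpow (n : nat) : rep K G :=
  if n is n'.+1 then tens_rep V (tpow n') else triv_rep K G.

Definition tpow_sum (ns : seq nat) : rep K G :=
  foldr (fun n W => dsum_rep (tpow n) W) zero_rep ns.

(* U is a subquotient of a finite direct sum of tensor powers of V: a quotient
   (by p) of a subrepresentation (embedded by i) of such a sum. *)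
Definition algebraic U : Prop :=
  exists (ns : seq nat) (S : rep K G)
    (i : rep_hom S (tpow_sum ns)) (p : rep_hom S U),
    injective i /\ (forall u, exists s, p s = u).

Definition embeds U W : Prop := exists f : rep_hom U W, injective f.

Lemma embeds_id U : embeds U U.
Proof. by exists (rep_id U). Qed.

Lemma embeds_trans W U X : embeds U W -> embeds W X -> embeds U X.
Proof. by move=> [f hf] [g hg]; exists (rep_comp g f); exact: inj_comp. Qed.

Lemma embeds_tens U U' W W' :
  embeds U U' -> embeds W W' -> embeds (tens_rep U W) (tens_rep U' W').
Proof. by move=> [f hf] [g hg]; exists (rep_tmap f g); exact: tmap_inj. Qed.

Lemma embeds_dsum U U' W W' :
  embeds U U' -> embeds W W' -> embeds (dsum_rep U W) (dsum_rep U' W').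
Proof.
move=> [f hf] [g hg].
have lin : linear (fun p : U * W => (f p.1, g p.2)).
  by move=> a p q /=; rewrite !linearP.
have equiv a (x : dsum_rep U W) : (mklin lin : {linear dsum_rep U W -> dsum_rep U' W'})
    (act (dsum_rep U W) a x) = act (dsum_rep U' W') a (mklin lin x).
  case: x => u w.
  rewrite -[LHS]/(f (act U a u), g (act W a w)) !rep_equiv.
  by [].
by exists (@RepHom K G (dsum_rep U W) (dsum_rep U' W') _ equiv)
  => -[u w] [u' w'] [] /hf -> /hg ->.
Qed.

Lemma embeds_braid U W : embeds (tens_rep U W) (tens_rep W U).
Proof.
exists (rep_braid U W); apply: (can_inj (g := tbraid W U)) => x.
exact: (f_equal (fun F : {linear _ -> _} => F x) (tbraidK U W)).
Qed.

Lemma embeds_assoc U W X :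
  embeds (tens_rep (tens_rep U W) X) (tens_rep U (tens_rep W X)).
Proof.
exists (rep_assoc U W X); apply: (can_inj (g := tassoci U W X)) => x.
exact: (f_equal (fun F : {linear _ -> _} => F x) (tassocK U W X).1).
Qed.

Lemma embeds_lunit U : embeds (tens_rep (triv_rep K G) U) U.
Proof.
exists (rep_lunit U); apply: (can_inj (g := tluniti U)) => x.
exact: (f_equal (fun F : {linear _ -> _} => F x) (tlunitK U).1).
Qed.

Lemma embeds_zero U : embeds (tens_rep zero_rep U) zero_rep.
Proof.
exists (@rep_zero K G (tens_rep zero_rep U) zero_rep) => x y _.
have z : forall t : tens_rep zero_rep U, t = 0.
  apply: (tens_ext (f := lin_id _) (g := \0)) => a u.
  rewrite lin_idE (_ : a = 0); last exact: thinmx0.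
  exact: (bilin0l _ (pure_bilinear _ _)).
by rewrite (z x) (z y).
Qed.

Lemma embeds_distr U W X :
  embeds (tens_rep (dsum_rep U W) X) (dsum_rep (tens_rep U X) (tens_rep W X)).
Proof.
have l1 : linear (fun p : U * W => p.1) by [].
have l2 : linear (fun p : U * W => p.2) by [].
have k1 : linear (fun u : U => (u, 0) : U * W).
  by move=> a x y; rewrite -[RHS]/(a *: x + y, a *: 0 + 0) scaler0 addr0.
have k2 : linear (fun w : W => (0, w) : U * W).
  by move=> a x y; rewrite -[RHS]/(a *: 0 + 0, a *: x + y) scaler0 addr0.
pose f1 := tmap (mklin l1) (lin_id X); pose f2 := tmap (mklin l2) (lin_id X).
pose g1 := tmap (mklin k1) (lin_id X); pose g2 := tmap (mklin k2) (lin_id X).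
have lin : linear (fun t : tens (U * W)%type X => (f1 t, f2 t)).
  by move=> a p q; rewrite !linearP.
pose T1 := tens_rep (dsum_rep U W) X.
pose T2 := dsum_rep (tens_rep U X) (tens_rep W X).
have equiv a (x : T1) : (mklin lin : {linear T1 -> T2}) (act T1 a x) =
    act T2 a (mklin lin x).
  rewrite -[LHS]/(f1 _, f2 _)
    -[RHS]/(act (tens_rep U X) a (f1 x), act (tens_rep W X) a (f2 x)).
  congr (_, _).
  - apply: (tens_ext (f := lin_comp f1 (act T1 a))
      (g := lin_comp (act (tens_rep U X) a) f1)) => u w.
    by rewrite !lin_compE !tensE.
  - apply: (tens_ext (f := lin_comp f2 (act T1 a))
      (g := lin_comp (act (tens_rep W X) a) f2)) => u w.
    by rewrite !lin_compE !tensE.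
exists (@RepHom K G T1 T2 _ equiv).
apply: (can_inj (g := fun p : T2 => g1 p.1 + g2 p.2)) => t.
rewrite -[LHS]/((lin_comp g1 f1 \+ lin_comp g2 f2) t).
apply: (tens_ext (f := (lin_comp g1 f1 \+ lin_comp g2 f2 : {linear _ -> _}))
  (g := lin_id _)) => p x.
rewrite -[LHS]/(g1 (f1 _) + g2 (f2 _)) !tensE lin_idE.
rewrite -[LHS](_ : pure ((p.1, 0) + (0, p.2) : U * W) x = _); last first.
  have := (pure_bilinear (U * W)%type X).1 x 1 (p.1, 0) (0, p.2).
  by rewrite !scale1r.
by congr (pure _ _); case: p => u w; congr (_, _); rewrite ?addr0 ?add0r.
Qed.

Lemma embeds_tpow n m : embeds (tens_rep (tpow n) (tpow m)) (tpow (n + m)).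
Proof.
elim: n => [|n IH] /=; first exact: embeds_lunit.
apply: embeds_trans (embeds_assoc _ _ _) _.
exact: embeds_tens (embeds_id _) IH.
Qed.

Lemma embeds_sum_cat ns ms :
  embeds (dsum_rep (tpow_sum ns) (tpow_sum ms)) (tpow_sum (ns ++ ms)).
Proof.
elim: ns => [|n ns IH] /=.
  have equiv a (x : dsum_rep zero_rep (tpow_sum ms)) :
    (snd : {linear _ -> _}) (act (dsum_rep zero_rep (tpow_sum ms)) a x) =
    act (tpow_sum ms) a (snd x).
    by case: x.
  exists (@RepHom K G (dsum_rep zero_rep (tpow_sum ms)) (tpow_sum ms) snd equiv).
  by move=> [u w] [u' w'] /= ->; congr (_, _); rewrite [u]thinmx0 [u']thinmx0.
apply: embeds_trans (embeds_dsum (embeds_id (tpow n)) IH).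
pose T1 := dsum_rep (dsum_rep (tpow n) (tpow_sum ns)) (tpow_sum ms).
pose T2 := dsum_rep (tpow n) (dsum_rep (tpow_sum ns) (tpow_sum ms)).
have lin : linear (fun p : T1 => (p.1.1, (p.1.2, p.2)) : T2) by [].
have equiv a (x : T1) : (mklin lin : {linear T1 -> T2}) (act T1 a x) =
  act T2 a (mklin lin x) by case: x => -[].
by exists (@RepHom K G T1 T2 _ equiv) => -[[u v] w] [[u' v'] w'] [-> -> ->].
Qed.

Lemma embeds_tens_tpow_sum n ms :
  embeds (tens_rep (tpow n) (tpow_sum ms)) (tpow_sum [seq (n + m)%N | m <- ms]).
Proof.
elim: ms => [|m ms IH] /=.
  exact: embeds_trans (embeds_braid _ _) (embeds_zero _).
apply: embeds_trans (embeds_braid _ _) _.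
apply: embeds_trans (embeds_distr _ _ _) _.
apply: embeds_dsum; first exact: embeds_trans (embeds_braid _ _) (embeds_tpow _ _).
exact: embeds_trans (embeds_braid _ _) IH.
Qed.

Lemma embeds_tens_sum ns ms : exists rs,
  embeds (tens_rep (tpow_sum ns) (tpow_sum ms)) (tpow_sum rs).
Proof.
elim: ns => [|n ns [rs IH]] /=; first by exists [::]; exact: embeds_zero.
exists ([seq (n + m)%N | m <- ms] ++ rs).
apply: embeds_trans (embeds_distr _ _ _) _.
apply: embeds_trans (embeds_sum_cat _ _).
exact: embeds_dsum (embeds_tens_tpow_sum _ _) IH.
Qed.

Lemma algebraic_triv : algebraic (triv_rep K G).
Proof.
have lin : linear (fun a : K^o => (a, 0) : tpow_sum [:: 0%N]).
  by move=> a x y; rewrite -[RHS]/(a *: x + y, a *: 0 + 0) scaler0 addr0.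
have equiv g (x : triv_rep K G) :
    (mklin lin : {linear triv_rep K G -> tpow_sum [:: 0%N]}) (act (triv_rep K G) g x)
    = act (tpow_sum [:: 0%N]) g (mklin lin x) by [].
exists [:: 0%N], (triv_rep K G), (RepHom equiv), (rep_id _).
by split=> [x y []|u]; last by exists u.
Qed.

Lemma algebraic_tens U W : algebraic U -> algebraic W -> algebraic (tens_rep U W).
Proof.
move=> [ns [S [i [p [hi hp]]]]] [ms [T [j [q [hj hq]]]]].
have [rs [e he]] := embeds_tens_sum ns ms.
exists rs, (tens_rep S T), (rep_comp e (rep_tmap i j)), (rep_tmap p q).
split; last exact: tmap_surj.
exact: inj_comp he (tmap_inj hi hj).
Qed.

Definition alg_rep_tcat : tensor_category K :=
  @full_tcat K (rep_tcat K G) algebraic algebraic_triv algebraic_tens.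

End Algebraic.

Section InfiniteOrthogonalGroup.
Variable K : fieldType.

(* C^oo is modelled by {poly K}, the finitely supported sequences of scalars;
   indices are shifted by one, the basis vector e_(i+1) being 'X^i. *)
Notation V := {poly K}.

Definition omega (v w : V) : K :=
  \sum_(k < maxn (size v) (size w))
    (v`_k.*2 * w`_k.*2.+1 + v`_k.*2.+1 * w`_k.*2).

(* size v <= d says that v lies in the span of e_1, .., e_d. For bijective
   linear g this is membership in GL(d), embedded in GL(oo). *)
Definition in_GL (d : nat) (g : V -> V) : Prop :=
  (forall v : V, (size v <= d)%N -> (size (g v) <= d)%N) /\
  (forall i, (d <= i)%N -> g 'X^i = 'X^i).

Record Oinf := MkOinf {
  oval :> {linear V -> V};
  oval_bij : bijective oval;
  oval_GL : exists d, in_GL d oval;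
  oval_omega : forall v w, omega (oval v) (oval w) = omega v w }.

Lemma Oinf_eq (g h : Oinf) : g =1 h -> g = h.
Proof.
case: g h => g g1 g2 g3 [h h1 h2 h3] /= /lin_eq e.
case: _ / e in h1 h2 h3 *.
by rewrite (Prop_irrelevance g1 h1) (Prop_irrelevance g2 h2) (Prop_irrelevance g3 h3).
Qed.

HB.instance Definition _ := gen_eqMixin Oinf.
HB.instance Definition _ := gen_choiceMixin Oinf.

Lemma lin_polyE (g : {linear V -> V}) n (v : V) : (size v <= n)%N ->
  g v = \sum_(i < n) v`_i *: g 'X^i.
Proof.
move=> hn; have {1}-> : v = \sum_(i < n) v`_i *: 'X^i.
  rewrite -poly_def; apply/polyP => i; rewrite coef_poly.
  by case: ltnP => // h; rewrite nth_default // (leq_trans hn).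
by rewrite linear_sum; apply: eq_bigr => i _; rewrite linearZ_LR.
Qed.

Lemma in_GL_mono (g : {linear V -> V}) d d' : (d <= d')%N -> in_GL d g -> in_GL d' g.
Proof.
move=> dd' [g1 g2]; split=> [v hv|i hi]; last by apply: g2; exact: leq_trans hi.
rewrite (lin_polyE _ hv); apply: leq_trans (size_sum _ _ _) _.
apply/bigmax_leqP => i _; apply: leq_trans (size_scale_leq _ _) _.
have [di|id] := leqP d i; first by rewrite g2 // size_polyXn.
by apply: leq_trans dd'; apply: g1; rewrite size_polyXn.
Qed.

Lemma in_GL_inv (g h : {linear V -> V}) d :
  cancel g h -> cancel h g -> in_GL d g -> in_GL d h.
Proof.
move=> gh hg [g1 g2]; split=> [v hv|i hi]; last by rewrite -{1}(g2 _ hi) gh.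
set w := h v; pose p := take_poly d w; pose q := w - p.
have qE i : q`_i = if (i < d)%N then 0 else w`_i.
  by rewrite coefB coef_take_poly; case: ifP => _; rewrite ?subrr ?subr0.
have gq : g q = q.
  rewrite (lin_polyE _ (leqnn _)) -[RHS]coefK poly_def.
  apply: eq_bigr => i _; rewrite qE; case: ltnP => [|/g2 -> //].
  by rewrite !scale0r.
have e : q = v - g p.
  by rewrite -{1}gq linearB /= -[g w]/(g (h v)) hg.
have sq : (size q <= d)%N.
  rewrite e; apply: leq_trans (size_polyD _ _) _.
  by rewrite geq_max hv size_polyN g1 // size_take_poly.
have q0 : q = 0.
  apply/polyP => i; rewrite coef0; have [di|di] := ltnP i d; first by rewrite qE di.
  by rewrite nth_default // (leq_trans sq).
by rewrite -[w](subrK p) -/q q0 add0r size_take_poly.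
Qed.

Definition oone : Oinf.
Proof.
refine (@MkOinf (lin_id V) _ _ _).
- abstract (by exists id).
- abstract (by exists 0%N; split).
- abstract (by []).
Defined.

Definition omul (g h : Oinf) : Oinf.
Proof.
refine (@MkOinf (lin_comp g h) _ _ _).
- abstract (exact: bij_comp (oval_bij g) (oval_bij h)).
- abstract (have [d hd] := oval_GL g;
    have [e he] := oval_GL h;
    exists (maxn d e);
    have [g1 g2] := in_GL_mono (leq_maxl d e) hd;
    have [h1 h2] := in_GL_mono (leq_maxr d e) he;
    by split=> [v /h1/g1|i hi] //;
    rewrite lin_compE h2 // g2).
- abstract (by move=> v w; rewrite !lin_compE !oval_omega).
Defined.

Lemma oinv_ex (g : Oinf) : exists h : Oinf, cancel g h /\ cancel h g.
Proof.
have [h gh hg] := oval_bij g.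
have hl : linear h.
  by move=> a x y; apply: (can_inj gh); rewrite hg linearP !hg.
have hf v w : omega (h v) (h w) = omega v w by rewrite -(oval_omega g) !hg.
have hGL : exists d, in_GL d h.
  by have [d hd] := oval_GL g; exists d; exact: (@in_GL_inv g (mklin hl)).
have hb : bijective h by exists g.
by exists (@MkOinf (mklin hl) hb hGL hf).
Qed.

Definition oinv (g : Oinf) : Oinf := projT1 (cid (oinv_ex g)).

Lemma omulA : associative omul.
Proof. by move=> f g h; apply: Oinf_eq. Qed.
Lemma omul1 : left_id oone omul.
Proof. by move=> g; apply: Oinf_eq. Qed.
Lemma omulr1 : right_id oone omul.
Proof. by move=> g; apply: Oinf_eq. Qed.
Lemma omulV : left_inverse oone oinv omul.
Proof. by move=> g; apply: Oinf_eq; exact: (projT2 (cid (oinv_ex g))).1. Qed.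
Lemma omulrV : right_inverse oone oinv omul.
Proof. by move=> g; apply: Oinf_eq; exact: (projT2 (cid (oinv_ex g))).2. Qed.

HB.instance Definition _ :=
  isGroup.Build Oinf omulA omul1 omulr1 omulV omulrV.

Definition std_rep : rep K Oinf :=
  @Rep K Oinf V oval (fun x => erefl) (fun g h x => erefl).

Definition RepO : tensor_category K := alg_rep_tcat std_rep.

(* Vd_gen d 0, .., Vd_gen d d.-1 is the given basis of V_d; for odd d the last
   vector is e_d + e_(d+1). *)
Definition Vd_gen (d i : nat) : V :=
  if odd d && (i == d.-1) then 'X^i + 'X^(i.+1) else 'X^i.

Definition in_Vd (d : nat) (v : V) : Prop :=
  exists c : 'I_d -> K, v = \sum_(i < d) c i *: Vd_gen d i.

Definition in_Vd' (d : nat) (v : V) : Prop :=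
  forall w, in_Vd d w -> omega v w = 0.

Definition in_Gd (d : nat) (g : Oinf) : Prop :=
  (forall v, in_Vd d v -> in_Vd d (g v)) /\ (forall v, in_Vd' d v -> g v = v).

Definition in_Hd (d : nat) (g : Oinf) : Prop :=
  (forall v, in_Vd' d v -> in_Vd' d (g v)) /\ (forall v, in_Vd d v -> g v = v).

Definition invariant (U : rep K Oinf) (d : nat) (u : U) : Prop :=
  forall g, in_Hd d g -> act U g u = u.

End InfiniteOrthogonalGroup.

Section QuadraticSpaces.
Variable K : fieldType.

Record quad_space := QuadSpace {
  qsp :> vectType K;
  qform : qsp -> qsp -> K;
  qform_bilinear : @bilinear_map K qsp qsp K^o qform;
  qform_sym : forall x y, qform x y = qform y x;
  qform_nondeg : forall x, (forall y, qform x y = 0) -> x = 0 }.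

Record quad_hom (V W : quad_space) := QuadHom {
  qlin :> {linear V -> W};
  qlin_form : forall x y, qform (qlin x) (qlin y) = qform x y }.

Lemma quad_hom_eq V W (f g : quad_hom V W) : qlin f = qlin g -> f = g.
Proof.
case: f g => f hf [g hg] /= e.
by case: _ / e in hg *; rewrite (Prop_irrelevance hf hg).
Qed.

Definition quad_id V : quad_hom V V := @QuadHom V V (lin_id V) (fun x y => erefl).

Definition quad_comp U V W (g : quad_hom V W) (f : quad_hom U V) : quad_hom U W.
Proof.
refine (@QuadHom U W (lin_comp g f) _); abstract (by move=> x y; rewrite !lin_compE !qlin_form).
Defined.

Definition T1 : category.
Proof.
refine (@Category quad_space quad_hom quad_id quad_comp _ _ _); abstract (by move=> *;
   apply/quad_hom_eq/lin_eq).
Defined.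

(* Isometries of V with V_d, where d is the dimension of V. *)
Record isometry (V : quad_space) := Isometry {
  iso_lin :> {linear V -> {poly K}};
  iso_Vd : forall v, in_Vd (\dim {:V}) (iso_lin v);
  iso_onto : forall w, in_Vd (\dim {:V}) w -> exists v, iso_lin v = w;
  iso_omega : forall v w, omega (iso_lin v) (iso_lin w) = qform v w }.

End QuadraticSpaces.

Section InvariantsFunctor.
Variable K : fieldType.
Implicit Types (U : rep K (Oinf K)) (V W X : quad_space K).

(* The value at V of the functor attached to U: families of H_d-invariants of U
   indexed by the isometries V -> V_d, compatible with the action of G_d. *)
Definition is_family U V (u : isometry V -> U) : Prop :=
  (forall phi, invariant (\dim {:V}) (u phi)) /\
  (forall g (phi psi : isometry V), in_Gd (\dim {:V}) g -> (forall v, psi v = g (phi v)) ->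
    u psi = act U g (u phi)).

Definition is_familyb U V : pred (isometry V -> U) := fun u => `[< is_family u >].

Record inv_sp U V := InvSp {
  fam :> isometry V -> U;
  famP : fam \in @is_familyb U V }.

HB.instance Definition _ U V := [isSub for @fam U V].
HB.instance Definition _ U V := [Choice of inv_sp U V by <:].

Lemma is_familyb_closed U V : submod_closed (@is_familyb U V).
Proof.
split; first by apply/asboolP; split=> [phi g _|*]; rewrite ?linear0.
move=> a u w /asboolP[u1 u2] /asboolP[w1 w2]; apply/asboolP; split.
- by move=> phi g hg; rewrite -[(a *: u + w) phi]/(a *: u phi + w phi) linearP u1 // w1.
- move=> g phi psi hg hphi.
  rewrite -[LHS]/(a *: u psi + w psi) -[(a *: u + w) phi]/(a *: u phi + w phi).
  by rewrite linearP -(u2 g phi psi) // -(w2 g phi psi).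
Qed.

HB.instance Definition _ U V :=
  GRing.isSubmodClosed.Build K (isometry V -> U) (@is_familyb U V) (is_familyb_closed U V).
HB.instance Definition _ U V := [SubChoice_isSubLmodule of inv_sp U V by <:].

Lemma inv_sp_eq U V (u w : inv_sp U V) : (forall phi, u phi = w phi) -> u = w.
Proof. by move=> h; apply/val_inj/funext. Qed.

(* With isometries such that psi h = phi chosen, inv_map h u is the family whose
   psi-component is the phi-component of u, i.e. in these coordinates the map is
   the inclusion of H_d-invariants into H_d'-invariants. xget returns 0 if there
   is no such family; inv_choice and inv_mapE below assert that isometries can be
   so chosen and that inv_map h u is as described for every choice. *)
Definition inv_map U V W (h : quad_hom V W) (u : inv_sp U V) : inv_sp U W :=
  xget 0 [set w : inv_sp U W | exists (phi : isometry V) (psi : isometry W),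
    (forall v, psi (h v) = phi v) /\ w psi = u phi]%classic.

Lemma inv_mor_family U U' (f : rep_hom U U') V (u : inv_sp U V) :
  (fun phi => f (u phi)) \in @is_familyb U' V.
Proof.
case: u => u /= /asboolP[u1 u2]; apply/asboolP; split.
- by move=> phi g hg; rewrite -rep_equiv u1.
- by move=> g phi psi hg e; rewrite (u2 g phi psi) // rep_equiv.
Qed.

Definition inv_mor U U' (f : rep_hom U U') V : {linear inv_sp U V -> inv_sp U' V}.
Proof.
refine (@mklin K (inv_sp U V) (inv_sp U' V) (fun u => InvSp (inv_mor_family f u)) _).
abstract (by move=> a u w; apply: inv_sp_eq => phi; exact: linearP).
Defined.

End InvariantsFunctor.

Section TheFunctor.
Variable K : fieldType.
Implicit Types V W X : quad_space K.

(* What has to hold for the data inv_sp, inv_map and inv_mor to define a functor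
   from Rep(O) to Fun(T_1, Vec^f): the choices in inv_map can be made and do not
   matter, values are finite dimensional, inv_map is linear and functorial, and
   inv_mor is natural. *)
Record inv_well_defined : Prop := InvWellDefined {
  inv_choice : forall V W (h : quad_hom V W),
    exists (phi : isometry V) (psi : isometry W), forall v, psi (h v) = phi v;
  inv_mapE : forall (U : RepO K) V W (h : quad_hom V W) (u : inv_sp (sval U) V)
      (phi : isometry V) (psi : isometry W),
    (forall v, psi (h v) = phi v) -> inv_map h u psi = u phi;
  inv_findim : forall (U : RepO K) V, findim (inv_sp (sval U) V);
  inv_map_linear : forall (U : RepO K) V W (h : quad_hom V W),
    linear (@inv_map K (sval U) V W h);
  inv_map_id : forall (U : RepO K) V (u : inv_sp (sval U) V),
    inv_map (quad_id V) u = u;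
  inv_map_comp : forall (U : RepO K) V W X (h : quad_hom W X) (k : quad_hom V W)
      (u : inv_sp (sval U) V),
    inv_map (quad_comp h k) u = inv_map h (inv_map k u);
  inv_mor_nat : forall (U U' : RepO K) (f : rep_hom (sval U) (sval U')) V W
      (h : quad_hom V W) (u : inv_sp (sval U) V),
    inv_mor f W (inv_map h u) = inv_map h (inv_mor f V u) }.

Definition FunT1 : tensor_category K := functor_tcat (T1 K) (vectf_tcat K).

Variable wd : inv_well_defined.

Definition inv_obj (U : RepO K) : FunT1.
Proof.
refine (@Functor (T1 K) (vectf_tcat K)
  (fun V => exist _ (inv_sp (sval U) V : lmodType K) (inv_findim wd U V))
  (fun V W h => mklin (@inv_map_linear wd U V W h)) _ _).
- abstract (by move=> V; apply: lin_eq; exact: inv_map_id).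
- abstract (by move=> V W X h k; apply: lin_eq; exact: inv_map_comp).
Defined.

Definition inv_fmor (U U' : RepO K) (f : hom U U') : hom (inv_obj U) (inv_obj U').
Proof.
refine (@NatTrans (T1 K) (vectf_tcat K) (inv_obj U) (inv_obj U')
  (inv_mor f) _).
abstract (by move=> V W h; apply: lin_eq; exact: inv_mor_nat).
Defined.

Definition invariants_functor : functor (RepO K) FunT1.
Proof.
refine (@Functor (RepO K) FunT1 inv_obj inv_fmor _ _).
- abstract (by move=> U; apply: nat_hom_eq => V; apply: lin_eq => u; exact: inv_sp_eq).
- abstract (by move=> U U' U'' g f;
    apply: nat_hom_eq => V;
    apply: lin_eq => u;
    exact: inv_sp_eq).
Defined.

Definition mu_at (M : symmetric_monoidal invariants_functor) (U W : RepO K) V :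
    {linear tens (inv_sp (sval U) V) (inv_sp (sval W) V) ->
      inv_sp (sval (ot (tmon (RepO K)) U W)) V} :=
  @ncomp (T1 K) (vectf_tcat K) (functor_ot (inv_obj U) (inv_obj W))
    (inv_obj (ot (tmon (RepO K)) U W)) (mu M U W) V.

(* The monoidal structure is the one induced by the inclusion of
   U^H (x) W^H into (U (x) W)^H. *)
Definition pointwise_mu (M : symmetric_monoidal invariants_functor) : Prop :=
  forall (U W : RepO K) V (u : inv_sp (sval U) V) (w : inv_sp (sval W) V)
      (phi : isometry V),
    mu_at M U W V (pure u w) phi = pure (u phi) (w phi).

End TheFunctor.

(* Main.v *)
Require Import Defs.
From HB Require Import structures.
From mathcomp Require Import all_boot all_order all_algebra reals.
From mathcomp Require Import fingroup perm generic_quotient.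
From mathcomp Require Import boolp classical_sets.
From mathcomp.real_closed Require Import complex.
From mathcomp Require Import ring zify.
(* Again, since the libraries above shadow [isometry] and [invariant]. *)
Require Import Defs.

(** In the orthonormal basis fb 2k = (e_(2k+1) + e_(2k+2)) / sqrt 2,
    fb (2k+1) = i (e_(2k+1) - e_(2k+2)) / sqrt 2 the space V_d is spanned by the
    first d vectors for every d, and every orthogonal d x d matrix gives an
    element of G_d.

    Finite dimension: let U be a quotient of a subrepresentation of a sum T of
    tensor powers. An H_d-invariant of U lifts, after averaging over the finite
    group of permutations of the basis vectors between d and m, to an element
    invariant under these permutations; such an element of T is determined by its
    coordinates on words in the first d + N letters, N being the largest tensor
    degree, so the dimension of U^(H_d) is bounded independently of m.

    Tensor products: every element of an algebraic representation is fixed by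
    some H_M. The slices (id (x) l)(x) of an H_d-invariant x in U (x) W form an
    H_d-stable space fixed by a single H_M, and every element of H_d is conjugate
    in H_d to one of H_M. So all slices are H_d-invariant, and x lies in
    U^(H_d) (x) W^(H_d).

    Fullness: since U is the union of the U^(H_d), a natural transformation
    defines a linear map U -> W, whose equivariance is naturality together with
    the fact that O(oo) is the union of the G_d. *)

Set Implicit Arguments.
Unset Strict Implicit.
Unset Printing Implicit Defensive.

Import Order.TTheory GRing.Theory Num.Theory.
Local Open Scope ring_scope.

(** * The form omega and its hyperbolic planes *)

Lemma sum_double (M : nmodType) n (F : nat -> M) :
  \sum_(i < n.*2) F i = \sum_(k < n) (F k.*2 + F k.*2.+1).
Proof.
elim: n => [|n IH]; first by rewrite !big_ord0.
by rewrite doubleS !big_ord_recr /= IH addrA.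
Qed.

Section Omega.
Variable K : fieldType.
Implicit Types v w : {poly K}.

(** Pairs beyond the support of [v] contribute nothing, so the bound in [omega] may be replaced by
    any even bound on the first argument; symmetry and linearity are then checked over a common
    range. *)
Lemma omegaE n v w : (size v <= n.*2)%N ->
  omega v w = \sum_(k < n) (v`_k.*2 * w`_k.*2.+1 + v`_k.*2.+1 * w`_k.*2).
Proof.
move=> sv; rewrite /omega; pose F k := v`_k.*2 * w`_k.*2.+1 + v`_k.*2.+1 * w`_k.*2.
have E p q : (size v <= p.*2)%N -> (p <= q)%N -> \sum_(k < q) F k = \sum_(k < p) F k.
  move=> sp pq; rewrite -!(big_mkord xpredT F).
  rewrite (big_cat_nat _ pq) //= [X in _ + X]big_nat [X in _ + X]big1 ?addr0 // => k.
  move=> /andP[pk _].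
  by rewrite /F [v`_k.*2]nth_default ?[v`_k.*2.+1]nth_default ?mul0r ?mul0r ?addr0 //;
    apply: leq_trans sp _; lia.
set m := maxn _ _.
rewrite -[LHS](E m (maxn m n)) ?leq_maxl ?(E n) ?leq_maxr //.
by rewrite (leq_trans (leq_maxl _ (size w))) // -/m; lia.
Qed.

Lemma omegaC v w : omega v w = omega w v.
Proof.
rewrite (@omegaE (size v + size w)) ?(@omegaE (size v + size w)); try lia.
by apply: eq_bigr => k _; rewrite addrC mulrC [_`_k.*2.+1 * _]mulrC.
Qed.

Lemma omega_linl w : linear ((@omega K)^~ w : {poly K} -> K^o).
Proof.
move=> a u v; have h := size_polyD (a *: u) v; have h' := size_scale_leq a u.
have h2 : (size (a *: u + v)%R <= maxn (size u) (size v))%N.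
  by apply: leq_trans h _; rewrite geq_max !leq_max h' leqnn orbT.
rewrite -[RHS]/(a * omega u w + omega v w).
rewrite !(@omegaE (size u + size v)); try lia.
rewrite mulr_sumr -big_split /=; apply: eq_bigr => k _.
by rewrite !coefD !coefZ; ring.
Qed.

Lemma omega_linr v : linear (@omega K v : {poly K} -> K^o).
Proof. by move=> a u w; rewrite !(omegaC v); exact: omega_linl. Qed.

Lemma omega_bilinear : @bilinear_map K {poly K} {poly K} K^o (@omega K).
Proof. by split; [exact: omega_linl|exact: omega_linr]. Qed.

(** A monomial pairs only with its partner in the hyperbolic plane spanned by the indices 2k and
    2k+1. *)
Lemma omegaX v i : omega v 'X^i = v`_(if odd i then i.-1 else i.+1).
Proof.
rewrite (@omegaE (size v + i.+1)); last lia.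
have h : (i./2 < size v + i.+1)%N by lia.
have kE (k : nat) : k <> i./2 -> (k.*2.+1 == i) = false /\ (k.*2 == i) = false by lia.
rewrite (bigD1 (Ordinal h)) //= big1 ?addr0 => [|k /eqP kh]; last first.
  have [|e1 e2] := kE k; first by move=> e; apply: kh; apply: val_inj.
  by rewrite !coefXn e1 e2 !mulr0 addr0.
rewrite !coefXn; case: ifP => oi.
  have -> : i./2.*2 = i.-1 by clear -oi; lia.
  have -> : i.-1.+1 = i by clear -oi; lia.
  have -> : (i.-1 == i) = false by clear -oi; lia.
  by rewrite eqxx mulr1 mulr0 addr0.
have -> : i./2.*2 = i by clear -oi; lia.
have -> : (i.+1 == i) = false by clear; lia.
by rewrite eqxx mulr1 mulr0 add0r.
Qed.

End Omega.

(** * An orthonormal basis adapted to all the V_d *)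

Section Basis.
Variable K : numClosedFieldType.
Notation V := {poly K}.
Implicit Types v w : V.

Definition sq2 : K := sqrtC 2.
Lemma sq2_neq0 : sq2 != 0. Proof. by rewrite sqrtC_eq0 pnatr_eq0. Qed.
Lemma sq2K : sq2 ^-1 * sq2^-1 = 2^-1.
Proof. by rewrite -invfM -expr2 sqrtCK. Qed.
Lemma sqi : ('i : K) * 'i = -1. Proof. by rewrite -expr2 sqrCi. Qed.

Definition fb i : V :=
  if odd i then ('i / sq2) *: ('X^(i.-1) - 'X^i) else sq2^-1 *: ('X^i + 'X^(i.+1)).

(** By orthonormality this is the i-th coordinate of [v] in the basis [fb]; see [co_fb] and
    [fb_expand]. *)
Definition co i v : K^o := omega v (fb i).
HB.instance Definition _ i := GRing.isLinear.Build K V K^o _ (co i) (omega_linl (fb i)).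

Lemma coE i v : co i v = omega v (fb i). Proof. by []. Qed.

(** A copy of [omega v] on which linearity in the second argument can be declared as a structure. *)
Definition om_r v w : K^o := omega v w.
HB.instance Definition _ v := GRing.isLinear.Build K V K^o _ (om_r v) (omega_linr v).

Lemma co_double k v : co k.*2 v = sq2^-1 * (v`_k.*2 + v`_k.*2.+1).
Proof.
rewrite coE /fb odd_double -[LHS]/(om_r v _) linearZ_LR linearD.
rewrite /= /om_r !omegaX /= odd_double /=.
by rewrite addrC.
Qed.

Lemma co_doubleS k v : co k.*2.+1 v = 'i / sq2 * (v`_k.*2.+1 - v`_k.*2).
Proof.
rewrite coE /fb /= odd_double /= -[LHS]/(om_r v _) linearZ_LR linearB.
rewrite /= /om_r !omegaX /= odd_double /=.
by [].
Qed.

(** Change of basis inside one hyperbolic plane; summing over the planes gives [fb_expand]. *)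
Lemma pairE k v : co k.*2 v *: fb k.*2 + co k.*2.+1 v *: fb k.*2.+1 =
  v`_k.*2 *: 'X^(k.*2) + v`_k.*2.+1 *: 'X^(k.*2.+1).
Proof.
rewrite co_double co_doubleS /fb /= odd_double /=.
set a := v`__; set b := v`__; rewrite !scalerA.
have h : (2 : K)^-1 + 2^-1 = 1 by rewrite [RHS]splitr mul1r.
have -> : sq2^-1 * (a + b) / sq2 = 2^-1 * (a + b).
  by rewrite mulrAC sq2K.
have -> : 'i / sq2 * (b - a) * ('i / sq2) = 2^-1 * (a - b).
  rewrite (_ : _ * _ = ('i * 'i) * (sq2^-1 * sq2^-1) * (b - a)); last by ring.
  by rewrite sqi sq2K; ring.
rewrite !scalerDr !scalerN addrACA -scalerDl -scalerBl; congr (_ *: _ + _ *: _).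
  by rewrite -mulrDr [a + b + _]addrACA subrr addr0 mulrDr -mulrDl h mul1r.
by rewrite -mulrBr opprB [a + b]addrC addrACA subrr addr0 mulrDr -mulrDl h mul1r.
Qed.

Lemma fb_expand n v : (size v <= n.*2)%N -> v = \sum_(i < n.*2) co i v *: fb i.
Proof.
move=> sv; rewrite (sum_double _ (fun i => co i v *: fb i)).
under eq_bigr do rewrite pairE.
rewrite -(sum_double _ (fun i => v`_i *: 'X^i)) -poly_def.
by apply/polyP => i; rewrite coef_poly; case: ltnP => // h; rewrite nth_default // (leq_trans sv).
Qed.

(** Splitting both indices by parity leaves two vectors in one plane, a direct computation, or in
    two planes, which involve disjoint sets of monomials. *)
Lemma co_fb i j : co j (fb i) = (i == j)%:R.
Proof.
have e1 a b : (a.*2 == b.*2.+1) = false by lia.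
have e2 a b : (a.*2.+1 == b.*2) = false by lia.
have e3 a b : (a.*2 == b.*2) = (a == b) by lia.
have h : (2 : K)^-1 + 2^-1 = 1 by rewrite [RHS]splitr mul1r.
rewrite -(odd_double_half j) -(odd_double_half i).
move: j./2 i./2 => p q.
case: (odd j); case: (odd i); rewrite ?add0n ?add1n ?co_double ?co_doubleS /fb /= ?odd_double /=;
  rewrite !(coefZ, coefD, coefN, coefXn) ?eqSS ?e1 ?e2 ?e3.
all: case: (eqVneq p q) => _ /=.
all: rewrite ?oppr0 ?addr0 ?add0r ?mulr0 ?mulr1 ?mulrN1 ?subrr ?addr0 ?mulr0 //.
- rewrite (_ : _ * _ = - ('i * 'i) * (sq2^-1 * sq2^-1 + sq2^-1 * sq2^-1)); last by ring.
  by rewrite sqi opprK sq2K mul1r h.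
- by rewrite mulrDr sq2K h.
Qed.

Lemma co_X i j : (j.+1 < i)%N -> co j ('X^i : V) = 0.
Proof.
rewrite -(odd_double_half j); case: (odd j); rewrite ?add0n ?add1n => h;
  rewrite ?co_double ?co_doubleS !coefXn ltn_eqF ?ltn_eqF ?subrr ?addr0 ?mulr0 //; lia.
Qed.

Definition proj d v : V := \sum_(i < d) co i v *: fb i.

Lemma proj_linear d : linear (proj d).
Proof.
move=> a u v; rewrite /proj scaler_sumr -big_split; apply: eq_bigr => i _ /=.
by rewrite linearP scalerDl -scalerA.
Qed.

HB.instance Definition _ d := GRing.isLinear.Build K V V _ (proj d) (proj_linear d).

Lemma co_sum d (c : 'I_d -> K) (j : 'I_d) : co j (\sum_(i < d) c i *: fb i) = c j.
Proof.
rewrite linear_sum (bigD1 j) //= linearZ_LR /= co_fb eqxx [_ *: _]mulr1 big1 ?addr0 // => i ij.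
by rewrite linearZ_LR /= co_fb val_eqE (negPf ij) [_ *: _]mulr0.
Qed.

Lemma co_sum_out d (c : 'I_d -> K) j : (d <= j)%N -> co j (\sum_(i < d) c i *: fb i) = 0.
Proof.
move=> dj; rewrite linear_sum big1 // => i _.
by rewrite linearZ_LR /= co_fb (_ : (_ == _) = false) ?[_ *: _]mulr0 //; have := ltn_ord i; lia.
Qed.

Lemma proj_fb d i : (i < d)%N -> proj d (fb i) = fb i.
Proof.
move=> id; rewrite /proj (bigD1 (Ordinal id)) //= co_fb eqxx scale1r big1 ?addr0 // => j ij.
by rewrite co_fb (_ : (_ == _) = false) ?scale0r // eq_sym; apply: negPf ij.
Qed.

Lemma projS d v : proj d.+1 v = proj d v + co d v *: fb d.
Proof. by rewrite /proj big_ord_recr. Qed.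

Lemma proj_gt d i v : (d <= i)%N -> proj d v = v -> co i v = 0.
Proof. by move=> di <-; rewrite co_sum_out. Qed.

Lemma proj_even n v : (size v <= n.*2)%N -> proj n.*2 v = v.
Proof. by move=> h; rewrite /proj -fb_expand. Qed.

Lemma in_Vd_lin d a v w : in_Vd d v -> in_Vd d w -> in_Vd d (a *: v + w).
Proof.
move=> [c ->] [c' ->]; exists (fun i => a * c i + c' i).
rewrite scaler_sumr -big_split; apply: eq_bigr => i _ /=.
by rewrite scalerDl scalerA.
Qed.

Lemma in_Vd0 d : in_Vd d (0 : V).
Proof. by exists (fun=> 0); rewrite big1 // => i _; rewrite scale0r. Qed.

Lemma in_Vd_gen d i : (i < d)%N -> in_Vd d (Vd_gen K d i).
Proof.
move=> id; exists (fun j => (val j == i)%:R).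
rewrite (bigD1 (Ordinal id)) //= eqxx scale1r big1 ?addr0 // => j ij.
by rewrite (_ : (_ == _) = false) ?scale0r //; apply: negPf ij.
Qed.

Lemma in_Vd_scale d a v : in_Vd d v -> in_Vd d (a *: v).
Proof. by move=> h; rewrite -[_ *: _]addr0; apply: in_Vd_lin (in_Vd0 d). Qed.

Lemma in_Vd_fb d i : (i < d)%N -> in_Vd d (fb i).
Proof.
move=> id; have H j : (j < d)%N -> ~~ (odd d && (j == d.-1)) -> in_Vd d ('X^j : V).
  by move=> jd nj; have := in_Vd_gen jd; rewrite /Vd_gen (negPf nj).
rewrite /fb; case: ifP => oi; apply: in_Vd_scale.
  rewrite -scaleN1r addrC; apply: in_Vd_lin; apply: H; lia.
have [e|ne] := boolP (odd d && (i == d.-1)).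
  by have := in_Vd_gen id; rewrite /Vd_gen e.
by rewrite -[X in in_Vd _ (X + _)]scale1r; apply: in_Vd_lin; apply: H; lia.
Qed.

(* For odd d the vector e_d + e_(d+1) is a multiple of fb d.-1; this is why V_d
   is spanned by the first d vectors of one orthonormal basis for all d. *)
Lemma in_VdP d v : in_Vd d v <-> proj d v = v.
Proof.
split=> [[c ->]|<-]; last first.
  rewrite /proj; elim/big_ind: _ => [|x y hx hy|i _]; first exact: in_Vd0.
    by rewrite -[x]scale1r; apply: in_Vd_lin.
  exact/in_Vd_scale/in_Vd_fb.
rewrite linear_sum; apply: eq_bigr => i _.
rewrite linearZ_LR; congr (_ *: _); rewrite /Vd_gen.
have hX j : (j < d)%N -> ~~ (odd d && (j == d.-1)) -> proj d ('X^j : V) = 'X^j.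
  move=> jd nj; have se : (size ('X^j : V) <= d./2.*2)%N by rewrite size_polyXn; lia.
  have [dE|dE] : d = d./2.*2 \/ d = d./2.*2.+1 by lia.
    by rewrite {1}dE proj_even.
  by rewrite {1}dE projS (proj_gt _ (proj_even se)) // scale0r addr0 proj_even.
case: ifP => [/andP[od /eqP iE]|/negbT]; last exact: hX.
have -> : 'X^i + 'X^(i.+1) = sq2 *: fb i.
  by rewrite /fb (_ : odd i = false) ?scalerA ?divff ?scale1r ?sq2_neq0 //; lia.
by rewrite linearZ_LR /= proj_fb.
Qed.

Lemma in_Vd'P d v : in_Vd' d v <-> forall i, (i < d)%N -> co i v = 0.
Proof.
split=> [h i id|h w /in_VdP <-]; first by rewrite coE; apply/h/in_Vd_fb.
rewrite -[LHS]/(om_r v _) linear_sum big1 // => i _.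
by rewrite linearZ_LR /= -[om_r v _]/(co i v) h // scaler0.
Qed.

Lemma omega_proj d v w : proj d w = w -> omega v w = \sum_(i < d) co i v * co i w.
Proof.
move=> {1}<-; rewrite -[LHS]/(om_r v _) linear_sum; apply: eq_bigr => i _.
by rewrite linearZ_LR mulrC.
Qed.

Lemma in_Vd_mono d d' v : (d <= d')%N -> in_Vd d v -> in_Vd d' v.
Proof.
move=> dd' /in_VdP <-; rewrite /proj; elim/big_ind: _ => [|x y hx hy|i _]; first exact: in_Vd0.
  by rewrite -[x]scale1r; apply: in_Vd_lin.
by apply/in_Vd_scale/in_Vd_fb; apply: leq_trans dd'.
Qed.

Lemma in_Vd_ex v : exists m, forall d, (m <= d)%N -> in_Vd d v.
Proof.
exists (size v).*2 => d hd; apply: (in_Vd_mono hd); apply/in_VdP/proj_even; lia.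
Qed.

End Basis.

(** * Elements of O(oo) given by orthogonal matrices *)

Section OrthogonalMatrices.
Variables (K : numClosedFieldType) (n : nat).
Notation V := {poly K}.
Implicit Types (v w : V) (r : 'rV[K]_n) (A B : 'M[K]_n).

Definition emb r : V := \sum_(i < n) r 0 i *: fb K i.
Definition cvec v : 'rV[K]_n := \row_i co i v.

Lemma emb_linear : linear emb.
Proof.
move=> a u v; rewrite /emb scaler_sumr -big_split; apply: eq_bigr => i _ /=.
by rewrite !mxE scalerDl scalerA.
Qed.

Lemma cvec_linear : linear cvec.
Proof. by move=> a u v; apply/rowP => i; rewrite !mxE linearP. Qed.

HB.instance Definition _ := GRing.isLinear.Build K _ _ _ emb emb_linear.
HB.instance Definition _ := GRing.isLinear.Build K _ _ _ cvec cvec_linear.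

Lemma cvec_emb r : cvec (emb r) = r.
Proof. by apply/rowP => i; rewrite mxE co_sum. Qed.

Lemma emb_cvec v : emb (cvec v) = proj n v.
Proof. by apply: eq_bigr => i _; rewrite mxE. Qed.

Lemma proj_emb r : proj n (emb r) = emb r.
Proof. by rewrite -emb_cvec cvec_emb. Qed.

Lemma in_Vd_emb r : in_Vd n (emb r).
Proof. exact/in_VdP/proj_emb. Qed.

Lemma emb_delta i : emb (delta_mx 0 i) = fb K i.
Proof.
rewrite /emb (bigD1 i) //= big1 ?addr0 => [|j ij]; rewrite mxE eqxx /=.
  by rewrite eqxx scale1r.
by rewrite (negPf ij) scale0r.
Qed.

Lemma omega_emb v r : omega v (emb r) = (cvec v *m r^T) 0 0.
Proof.
rewrite (omega_proj _ (proj_emb r)) mxE; apply: eq_bigr => i _.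
by rewrite !mxE co_sum.
Qed.

(** Adding only the change [A - 1] on the first n coordinates keeps the other basis vectors fixed.
    Rows are multiplied on the right, hence the reversed product in [mxact_comp]. *)
Definition mxact A v : V := v + emb (cvec v *m (A - 1%:M)).

Lemma mxact_linear A : linear (mxact A).
Proof.
by move=> a u v; rewrite /mxact linearP mulmxDl -scalemxAl linearP scalerDr addrACA.
Qed.

Lemma mxact_comp A B v : mxact B (mxact A v) = mxact (A *m B) v.
Proof.
rewrite /mxact [cvec (_ + _)]linearD /= cvec_emb -addrA -linearD; congr (_ + emb _).
rewrite -{2}[cvec v]mulmx1 -mulmxDr [1%:M + _]addrC subrK -mulmxA -mulmxDr; congr (_ *m _).
by rewrite mulmxBr mulmx1 addrC addrA subrK.
Qed.

Lemma mxact1 v : mxact 1%:M v = v.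
Proof. by rewrite /mxact subrr mulmx0 linear0 addr0. Qed.

(** With [D = A - 1], expanding the form leaves the error term [D^T + D + D *m D^T], which vanishes
    because [A *m A^T = 1]. *)
Lemma mxact_omega A v w : A *m A^T = 1%:M -> omega (mxact A v) (mxact A w) = omega v w.
Proof.
move=> AA; rewrite /mxact; set D := A - 1%:M.
have [bl br] := omega_bilinear K.
have addl x y z : omega (x + y) z = omega x z + omega y z :> K.
  by have := bl z 1 x y; rewrite !scale1r.
have addr x y z : omega z (x + y) = omega z x + omega z y :> K.
  by have := br z 1 x y; rewrite !scale1r.
rewrite addl !addr -!addrA -[RHS]addr0; congr (_ + _).
rewrite (omegaC (emb _) w) !omega_emb cvec_emb.
have tr11 (M : 'M[K]_1) : M 0 0 = M^T 0 0 by rewrite mxE.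
have add11 (M N P : 'M[K]_1) : M 0 0 + (N 0 0 + P 0 0) = (M + (N + P)) 0 0 by rewrite !mxE.
rewrite [X in _ + (X + _)]tr11 !trmx_mul !trmxK add11.
have E (D0 : 'M[K]_n) (a b : 'rV_n) : a *m (D0^T *m b^T) + (a *m D0 *m b^T + a *m D0 *m (D0^T *m b^T)) =
    a *m (D0^T + (D0 + D0 *m D0^T)) *m b^T.
  by rewrite !mulmxDr !mulmxDl !mulmxA.
rewrite E.
have DA : D *m A^T = 1%:M - A^T by rewrite mulmxBl AA mul1mx.
have -> : D^T + (D + D *m D^T) = 0.
  have -> : D^T = A^T - 1%:M by rewrite /D raddfB /= trmx1.
  by rewrite mulmxBr mulmx1 DA [D + _]addrCA subrr addr0 -opprB addNr.
by rewrite mulmx0 mul0mx mxE.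
Qed.

Lemma mxact_id A v : (forall i, (i < n)%N -> co i v = 0) -> mxact A v = v.
Proof.
move=> h; rewrite /mxact (_ : cvec v = 0) ?mul0mx ?linear0 ?addr0 //.
by apply/rowP => i; rewrite !mxE h.
Qed.

Lemma mxact_emb A r : mxact A (emb r) = emb (r *m A).
Proof. by rewrite /mxact cvec_emb -linearD mulmxBr mulmx1 addrC subrK. Qed.

Lemma mxact_fb A (i : 'I_n) : mxact A (fb K i) = emb (row i A).
Proof. by rewrite -emb_delta mxact_emb -rowE. Qed.

Lemma mxact_in_GL A : in_GL n.*2 (mxact A).
Proof.
(* [fb K i] may involve ['X^(i.+1)], so for odd n the bound n would be too small; doubling leaves
   room. *)
have sfb i : (i < n)%N -> (size (fb K i) <= n.*2)%N.
  move=> id; rewrite /fb; case: ifP => oi; apply: leq_trans (size_scale_leq _ _) _;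
    apply: leq_trans (size_polyD _ _) _; rewrite ?size_polyN !size_polyXn; lia.
have semb r : (size (emb r) <= n.*2)%N.
  apply: leq_trans (size_sum _ _ _) _; apply/bigmax_leqP => i _.
  by apply: leq_trans (size_scale_leq _ _) _; apply: sfb.
split=> [v hv|i hi].
  by apply: leq_trans (size_polyD _ _) _; rewrite geq_max hv semb.
by apply: mxact_id => j jn; apply: co_X; lia.
Qed.

Lemma mxact_bij A : A *m A^T = 1%:M -> bijective (mxact A).
Proof.
move=> AA; exists (mxact A^T) => v; rewrite mxact_comp ?AA ?mxact1 //.
by rewrite (mulmx1C AA) mxact1.
Qed.

Definition mxO A (AA : A *m A^T = 1%:M) : Oinf K :=
  @MkOinf K (mklin (mxact_linear A)) (mxact_bij AA) (ex_intro _ n.*2 (mxact_in_GL A))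
    (fun v w => mxact_omega v w AA).

Lemma mxOE A (AA : A *m A^T = 1%:M) v : mxO AA v = mxact A v.
Proof. by []. Qed.

End OrthogonalMatrices.

(** * The subgroups G_d and H_d *)

Section Subgroups.
Variable K : numClosedFieldType.
Notation V := {poly K}.
Implicit Types (g h : Oinf K) (v w : V).

Lemma OinfM g h v : (g * h)%g v = g (h v).
Proof. by []. Qed.

Lemma OinfVK g : cancel g (g^-1)%g.
Proof. by move=> v; rewrite -OinfM mulVg. Qed.

Lemma OinfKV g : cancel (g^-1)%g g.
Proof. by move=> v; rewrite -OinfM mulgV. Qed.

Lemma Oinf_proj d g v : proj d v = v -> g v = \sum_(i < d) co i v *: g (fb K i).
Proof.
move=> {1}<-; rewrite linear_sum; apply: eq_bigr => i _.
by rewrite linearZ_LR.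
Qed.

Lemma in_Vd_proj d v : in_Vd d (proj d v).
Proof. rewrite -emb_cvec; exact: in_Vd_emb. Qed.

(** If [g] fixes [w] in V_d, then [g v] pairs with [w] as [v] does, so [g] preserves the complement
    V_d'. *)
Lemma in_HdP d g : in_Hd d g <-> forall i, (i < d)%N -> g (fb K i) = fb K i.
Proof.
split=> [[_ h] i id|h]; first exact/h/in_Vd_fb.
have fixd v : in_Vd d v -> g v = v.
  move=> /in_VdP vd; rewrite (Oinf_proj g vd) -[RHS]vd; apply: eq_bigr => i _.
  by rewrite h.
by split=> // v hv w hw; rewrite -(fixd w hw) oval_omega; apply: hv.
Qed.

Lemma in_Hd_mono d d' g : (d <= d')%N -> in_Hd d' g -> in_Hd d g.
Proof.
by move=> dd' /in_HdP h; apply/in_HdP => i id; apply: h; apply: leq_trans dd'.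
Qed.

(** For [v] in V_d the part of [g v] outside V_d lies in V_d'. It is also orthogonal to V_d',
    because [g] fixes V_d' and preserves the form. Hence all its coordinates vanish. *)
Lemma in_GdP d g : (forall v, in_Vd' d v -> g v = v) -> in_Gd d g.
Proof.
move=> fixd; split=> // v hv; apply/in_VdP.
have pv w : in_Vd' d (w - proj d w).
  apply/in_Vd'P => i id; rewrite linearB /= /proj.
  by rewrite (co_sum (fun i : 'I_d => co i w) (Ordinal id)) subrr.
apply/eqP; rewrite eq_sym -subr_eq0; apply/eqP; set w := g v - _.
have w0 : in_Vd' d w by exact: pv.
have ow x : in_Vd' d x -> omega w x = 0.
  move=> hx; have -> : omega w x = omega (g v) x - omega (proj d (g v)) x.
    by rewrite !(omegaC _ x) -[LHS]/(om_r x w) linearB.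
  rewrite -{1}(fixd _ hx) oval_omega (omegaC v) (hx _ hv) omegaC (hx _) ?subr0 //.
  exact: in_Vd_proj.
have [m hm] := in_Vd_ex w; have /in_VdP <- := hm m (leqnn m).
rewrite /proj big1 // => i _; rewrite (_ : co i w = 0) ?scale0r //.
have := ow _ (pv (fb K i)); rewrite -[X in X = _]/(om_r w _) linearB /=.
by rewrite /om_r (w0 _ (in_Vd_proj _ _)) subr0.
Qed.

Lemma mxO_Gd d (A : 'M[K]_d) (AA : A *m A^T = 1%:M) : in_Gd d (mxO AA).
Proof. by apply: in_GdP => v /in_Vd'P h; apply: mxact_id. Qed.

(** An even cut-off does not split a hyperbolic plane, so the basis vectors [fb] from [n.*2] on
    involve only monomials that [g] fixes. *)
Lemma Oinf_Gd g : exists m, forall n, (m <= n)%N ->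
  in_Gd n.*2 g /\ forall i, (n.*2 <= i)%N -> g (fb K i) = fb K i.
Proof.
have [m [_ hm]] := oval_GL g; exists m => n mn.
have gX i : (n.*2 <= i)%N -> g 'X^i = 'X^i by move=> h; apply: hm; lia.
have gf i : (n.*2 <= i)%N -> g (fb K i) = fb K i.
  move=> ni; rewrite /fb; case: ifP => oi; rewrite linearZ_LR ?linearB ?linearD /= !gX //; lia.
split=> //; apply: in_GdP => v /in_Vd'P v0.
have [p hp] := in_Vd_ex v; have /in_VdP vp := hp p (leqnn p).
rewrite (Oinf_proj g vp) -[RHS]vp; apply: eq_bigr => i _.
by have [ni|ni] := leqP n.*2 i; [rewrite gf | rewrite v0 // !scale0r].
Qed.

Variable U : rep K (Oinf K).
Implicit Types u : U.

Lemma invariant_mono d d' u : (d <= d')%N -> invariant d u -> invariant d' u.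
Proof. by move=> dd' h g hg; apply: h; apply: in_Hd_mono hg. Qed.

(** The element [g^-1 * h] lies in H_d: on H_d-invariants only the restriction of a group element to
    V_d matters. *)
Lemma act_agree d u g h : invariant d u ->
  (forall i, (i < d)%N -> g (fb K i) = h (fb K i)) -> act U g u = act U h u.
Proof.
move=> hu gh; have <- : (g * (g^-1 * h))%g = h by rewrite mulgA mulgV mul1g.
rewrite actM [act U (_ * _)%g u]hu //; apply/in_HdP => i id.
by rewrite OinfM -gh // OinfVK.
Qed.

Lemma invariant_lin d a u u' : invariant d u -> invariant d u' -> invariant d (a *: u + u').
Proof. by move=> h h' g hg; rewrite linearP h // h'. Qed.

Lemma invariant0 d : invariant d (0 : U).
Proof. by move=> g _; rewrite linear0. Qed.

End Subgroups.

(** * Families of invariants *)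

Section Isometries.
Variable K : numClosedFieldType.
Implicit Types (V W : quad_space K) (U : rep K (Oinf K)).

Lemma quad_hom_inj V W (h : quad_hom V W) : injective h.
Proof.
move=> x y e; apply/eqP; rewrite -subr_eq0; apply/eqP; apply: qform_nondeg => z.
by rewrite -(qlin_form h) linearB /= e subrr (bilin0l _ (qform_bilinear W)).
Qed.

Lemma quad_hom_dim V W (h : quad_hom V W) : (\dim {:V} <= \dim {:W})%N.
Proof.
rewrite -(@limg_dim_eq _ _ _ (linfun h) {:V}) ?dimvS ?subvf //.
apply/eqP; rewrite -subv0; apply/subvP => x; rewrite memv_cap memv_ker => /andP[_].
rewrite lfunE memv0 => /eqP e; apply/eqP; apply: (quad_hom_inj (h := h)).
by rewrite e linear0.
Qed.

Lemma isometry_inj V (phi : isometry V) : injective phi.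
Proof.
move=> x y e; apply/eqP; rewrite -subr_eq0; apply/eqP; apply: qform_nondeg => z.
by rewrite -(iso_omega phi) linearB /= e subrr (bilin0l _ (omega_bilinear K)).
Qed.

(** Let [w i] be the preimage of the i-th basis vector under [phi]. The coordinates of the
    [psi (w i)] are the rows of an orthogonal matrix, since both maps preserve the form, and this
    matrix gives [g]. *)
Lemma isometry_transport V (phi psi : isometry V) :
  exists2 g, in_Gd (\dim {:V}) g & forall v, psi v = g (phi v).
Proof.
set d := \dim {:V}.
have ex (i : 'I_d) : exists w, phi w = fb K i by apply/iso_onto/in_Vd_fb.
have [w hw] := choice ex.
pose A : 'M[K]_d := \matrix_(i, j) co j (psi (w i)).
have rA i : emb (row i A) = psi (w i).
  have /in_VdP <- := iso_Vd psi (w i); rewrite -/d -emb_cvec; congr emb.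
  by apply/rowP => j; rewrite !mxE.
have AA : A *m A^T = 1%:M.
  apply/matrixP => i k; rewrite !mxE -[RHS]co_fb coE -[X in omega _ X]hw -[X in omega X]hw.
  rewrite iso_omega -(iso_omega psi) (omega_proj _ (_ : proj d _ = _)); last exact/in_VdP/iso_Vd.
  by apply: eq_bigr => j _; rewrite !mxE mulrC.
exists (mxO AA); first exact: mxO_Gd.
have hg i : mxO AA (phi (w i)) = psi (w i) by rewrite hw mxOE mxact_fb rA.
move=> v; have -> : v = \sum_(i < d) co i (phi v) *: w i.
  apply: (@isometry_inj _ phi); rewrite linear_sum.
  have /in_VdP {1}<- := iso_Vd phi v; apply: eq_bigr => i _.
  by rewrite linearZ_LR /= hw.
rewrite !linear_sum; apply: eq_bigr => i _.
rewrite !linearZ_LR; congr (_ *: _); exact/esym/hg.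
Qed.

Variable U : rep K (Oinf K).

Lemma fam_inv V (x : inv_sp U V) phi : invariant (\dim {:V}) (x phi).
Proof. by case: x => x /= /asboolP[]. Qed.

(** The element of G_d given by [isometry_transport] agrees with [g] on V_d, so compatibility under
    G_d extends to every [g] in O(oo) that carries [phi] to [psi]. *)
Lemma fam_act V (x : inv_sp U V) (phi psi : isometry V) (g : Oinf K) :
  (forall v, psi v = g (phi v)) -> x psi = act U g (x phi).
Proof.
move=> e; have [h hh he] := isometry_transport phi psi.
have -> : x psi = act U h (x phi).
  by case: x => x /= /asboolP[_ h2]; apply: h2.
apply: (act_agree (fam_inv x phi)) => i id.
have [v <-] := iso_onto phi (in_Vd_fb K id).
by rewrite -he e.
Qed.

(** G_d is transitive on isometries. Together with [fam_ex] this identifies families with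
    H_d-invariants through evaluation at a single isometry. *)
Lemma fam_eq V (x y : inv_sp U V) phi : x phi = y phi -> x = y.
Proof.
move=> e; apply: inv_sp_eq => psi; have [g _ hg] := isometry_transport phi psi.
by rewrite (fam_act x hg) (fam_act y hg) e.
Qed.

(** The vector is transported by a chosen [g psi] for each [psi]; by [act_agree] the choice does not
    affect the result. *)
Lemma fam_ex V (phi : isometry V) u : invariant (\dim {:V}) u ->
  exists x : inv_sp U V, x phi = u.
Proof.
move=> hu; have ex (psi : isometry V) : exists g : Oinf K, forall v, psi v = g (phi v).
  by have [g _ hg] := isometry_transport phi psi; exists g.
have [g hg] := choice ex.
have agr (psi : isometry V) (h : Oinf K) : (forall v, psi v = h (phi v)) -> act U (g psi) u = act U h u.
  move=> e; apply: (act_agree hu) => i id.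
  have [v <-] := iso_onto phi (in_Vd_fb K id).
  by rewrite -hg e.
have fam : (fun psi => act U (g psi) u) \in @is_familyb K U V.
  apply/asboolP; split=> [psi h hh|h psi1 psi2 hh e].
    rewrite -actM; apply: (act_agree hu) => i id.
    have [v <-] := iso_onto phi (in_Vd_fb K id).
    by rewrite OinfM -hg; apply: hh.2; apply: iso_Vd.
  by rewrite -actM; apply: agr => v; rewrite e hg.
exists (InvSp fam) => /=.
by rewrite (agr phi 1%g) ?act1.
Qed.

(** If [psi0], [phi0] is another compatible pair, an element carrying [psi0] to [psi] also carries
    [phi0] to [phi], so both pairs give the same family. *)
Lemma inv_mapP V W (h : quad_hom V W) (x : inv_sp U V) (phi : isometry V) (psi : isometry W) :
  (forall v, psi (h v) = phi v) -> inv_map h x psi = x phi.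
Proof.
move=> e; rewrite /inv_map; case: xgetP => [w _ [phi0 [psi0 [e0 ew]]]|no].
  have [g _ hg] := isometry_transport psi0 psi.
  rewrite (fam_act w hg) ew -(@fam_act _ x phi0 phi) // => v.
  by rewrite -e hg e0.
(* The default 0 of [xget] never occurs: [x phi] is also invariant under the smaller group attached
   to W, so it extends to a family at W. *)
have [w hw] := fam_ex psi (invariant_mono (quad_hom_dim h) (fam_inv x phi)).
by case: (no w); exists phi, psi.
Qed.

End Isometries.

(** * Extension of orthonormal families *)

Section StandardQuadraticSpace.
Variables (K : fieldType) (n : nat).

Definition std_form (x y : 'rV[K]_n) : K := (x *m y^T) 0 0.

Lemma std_formC x y : std_form x y = std_form y x.
Proof. by rewrite /std_form -[x *m _]trmxK trmx_mul trmxK mxE. Qed.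

Lemma std_form_bilinear : @bilinear_map K 'rV[K]_n 'rV[K]_n K^o std_form.
Proof.
have l y : linear (std_form^~ y : 'rV[K]_n -> K^o).
  by move=> a x z; rewrite /std_form mulmxDl -scalemxAl !mxE.
by split=> // x a y z; rewrite !(std_formC x); apply: l.
Qed.

Lemma std_form_nondeg x : (forall y, std_form x y = 0) -> x = 0.
Proof.
move=> h; apply/rowP => i; rewrite [RHS]mxE -(h (delta_mx 0 i)) /std_form trmx_delta -colE.
by rewrite mxE.
Qed.

(** A quadratic space of each dimension, used for dimension counts and to realise vectors of a
    representation as values of families. *)
Definition std_quad : quad_space K :=
  @QuadSpace K 'rV[K]_n std_form std_form_bilinear std_formC std_form_nondeg.

Lemma std_quad_dim : \dim {: std_quad} = n.
Proof. by rewrite dimvf /= /dim /= mul1n. Qed.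

End StandardQuadraticSpace.

Section OrthonormalBases.
Variable K : numClosedFieldType.
Implicit Types (V W : quad_space K).

Definition orthonormal V n (w : nat -> V) : Prop :=
  forall i j, (i < n)%N -> (j < n)%N -> qform (w i) (w j) = (i == j)%:R.

Definition extend V n (w : nat -> V) x i := if (i < n)%N then w i else x.

Section Form.
Variable V : quad_space K.
Implicit Types (x y z : V) (w : nat -> V).

Definition qf y x : K^o := qform x y.
HB.instance Definition _ y :=
  GRing.isLinear.Build K V K^o _ (qf y) ((qform_bilinear V).1 y).

Lemma qformDl x y z : qform (x + y) z = qform x z + qform y z.
Proof. by rewrite -[LHS]/(qf z _) linearD. Qed.

Lemma qformZl a x y : qform (a *: x) y = a * qform x y.
Proof. by rewrite -[LHS]/(qf y _) linearZ_LR. Qed.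

Lemma qformZr a x y : qform x (a *: y) = a * qform x y.
Proof. by rewrite !(qform_sym x) qformZl. Qed.

Definition oproj n w x : V := \sum_(i < n) qform x (w i) *: w i.

Lemma qform_sum n (c : 'I_n -> K) w y :
  qform (\sum_(i < n) c i *: w i) y = \sum_(i < n) c i * qform (w i) y.
Proof.
by rewrite -[LHS]/(qf y _) linear_sum; apply: eq_bigr => i _; rewrite linearZ_LR.
Qed.

Lemma qform_sum_on n (c : 'I_n -> K) w (j : 'I_n) : orthonormal n w ->
  qform (\sum_(i < n) c i *: w i) (w j) = c j.
Proof.
move=> ow; rewrite qform_sum (bigD1 j) //= ow // eqxx mulr1 big1 ?addr0 // => i ij.
by rewrite ow // val_eqE (negPf ij) mulr0.
Qed.

Lemma oproj_orth n w x i : orthonormal n w -> (i < n)%N -> qform (x - oproj n w x) (w i) = 0.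
Proof.
move=> ow id; rewrite -[LHS]/(qf (w i) _) linearB /= {2}/qf.
by rewrite (@qform_sum_on n _ w (Ordinal id) ow) subrr.
Qed.

Lemma oproj_orthl n w x z : orthonormal n w -> (forall i, (i < n)%N -> qform z (w i) = 0) ->
  qform (x - oproj n w x) z = qform x z.
Proof.
move=> ow hz; rewrite -[LHS]/(qf z _) linearB /= {2}/qf qform_sum big1 ?subr0 // => i _.
by rewrite (qform_sym (w i)) hz ?mulr0.
Qed.

(** It suffices to find a non-isotropic vector orthogonal to [w] and divide it by a square root. If
    [x] is isotropic, some [y] orthogonal to [w] has nonzero product with [x]; then [y] or [x + y]
    works. *)
Lemma orthonormal_extend n w x : orthonormal n w -> x != 0 ->
  (forall i, (i < n)%N -> qform x (w i) = 0) ->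
  exists z, orthonormal n.+1 (extend n w z).
Proof.
move=> ow x0 xw.
have [z [zz zw]] : exists z, qform z z != 0 /\ forall i, (i < n)%N -> qform z (w i) = 0.
  have [xx|xx] := eqVneq (qform x x) 0; last by exists x.
  have [y0 hy0] : exists y, qform x y != 0.
    apply: contrapT => no; move/eqP: x0; apply; apply: qform_nondeg => y.
    by apply: contrapT => /eqP h; apply: no; exists y.
  pose y := y0 - oproj n w y0.
  have yw i : (i < n)%N -> qform y (w i) = 0 by exact: oproj_orth.
  have xy : qform x y != 0 by rewrite qform_sym oproj_orthl // qform_sym.
  move: y yw xy => y yw xy.
  have [yy|yy] := eqVneq (qform y y) 0; last by exists y.
  exists (x + y); split; last first.
    by move=> i id; rewrite qformDl xw // yw // addr0.
  rewrite !qformDl !(qform_sym _ (x + y)) !qformDl xx yy.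
  by rewrite add0r addr0 (qform_sym y x) -mulr2n mulrn_eq0 negb_or /=.
have s0 : sqrtC (qform z z) != 0 by rewrite sqrtC_eq0.
exists ((sqrtC (qform z z))^-1 *: z) => i j; set u := _ *: z.
have uw k : (k < n)%N -> qform u (w k) = 0.
  by move=> kn; rewrite qformZl zw ?mulr0.
rewrite !ltnS /extend => ile jle; case: ltnP => hi; case: ltnP => hj.
- exact: ow.
- by rewrite qform_sym uw // ltn_eqF //; lia.
- by rewrite uw // gtn_eqF //; lia.
have -> : (i == j) by lia.
by rewrite qformZl qformZr mulrA -invfM -expr2 sqrtCK mulVf.
Qed.

End Form.

Definition row_comb V n (w : nat -> V) (r : 'rV[K]_n) : V := \sum_(i < n) r 0 i *: w i.

Lemma row_comb_linear V n w : linear (@row_comb V n w).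
Proof.
move=> a u v; rewrite /row_comb scaler_sumr -big_split; apply: eq_bigr => i _ /=.
by rewrite !mxE scalerDl scalerA.
Qed.

(** Linear combinations of [w] give a form-preserving, hence injective, map from the standard
    space. *)
Lemma orthonormal_le V n (w : nat -> V) : orthonormal n w -> (n <= \dim {:V})%N.
Proof.
move=> ow; have q : forall x y : std_quad K n,
    qform (mklin (@row_comb_linear V n w) x) (mklin (@row_comb_linear V n w) y) = qform x y.
  move=> x y; rewrite [LHS]qform_sum -[RHS]/(std_form x y) /std_form mxE.
  by apply: eq_bigr => i _; rewrite qform_sym mxE qform_sum_on.
by have := quad_hom_dim (QuadHom q); rewrite std_quad_dim.
Qed.

Definition complete V n (w : nat -> V) : Prop := forall v, oproj n w v = v.

Lemma complete_ge V n (w : nat -> V) : orthonormal n w -> complete n w -> (\dim {:V} <= n)%N.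
Proof.
move=> ow cw; have l : linear (fun v : V => \row_(i < n) qform v (w i)).
  by move=> a x y; apply/rowP => i; rewrite !mxE; apply: (qform_bilinear V).1.
have q : forall x y : V, @qform K (std_quad K n) (mklin l x) (mklin l y) = qform x y.
  move=> x y; rewrite -[X in _ = qform X _]cw qform_sum -[LHS]/(std_form _ _) /std_form mxE.
  by apply: eq_bigr => i _; rewrite !mxE (qform_sym y).
by have := quad_hom_dim (@QuadHom K V (std_quad K n) (mklin l) q); rewrite std_quad_dim.
Qed.

(** While some [v] differs from its projection, the nonzero difference is orthogonal to [w] and
    allows an extension; the dimension bounds the number of extensions. *)
Lemma orthonormal_complete V n (w : nat -> V) : orthonormal n w ->
  exists w', [/\ forall i, (i < n)%N -> w' i = w i,
    orthonormal (\dim {:V}) w' & complete (\dim {:V}) w'].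
Proof.
move: {2}(\dim {:V} - n)%N (leqnn (\dim {:V} - n)) => k.
elim: k n w => [|k IH] n w hk ow; have nle := orthonormal_le ow.
all: have [cw|ncw] := pselect (complete n w).
1,3: by exists w; have -> : \dim {:V} = n by apply/eqP; rewrite eqn_leq nle (complete_ge ow cw).
all: have [v hv] : exists v, oproj n w v <> v
  by apply: contrapT => no; apply: ncw => v; apply: contrapT => h; apply: no; exists v.
all: have [|z oz] := @orthonormal_extend _ n w (v - oproj n w v) ow _ (fun i => @oproj_orth _ n w v i ow);
  first by rewrite subr_eq0; apply/eqP => e; apply: hv.
  by have := orthonormal_le oz; lia.
have [|w' [h1 h2 h3]] := IH _ _ _ oz; first by lia.
exists w'; split=> // i ni; rewrite h1; last by lia.
by rewrite /extend ni.
Qed.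

Lemma orthonormal_isometry V (w : nat -> V) :
  orthonormal (\dim {:V}) w -> complete (\dim {:V}) w ->
  exists phi : isometry V, forall i, (i < \dim {:V})%N -> phi (w i) = fb K i.
Proof.
set d := \dim {:V} => ow cw.
have l : linear (fun v => emb (\row_(i < d) qform v (w i))).
  move=> a x y; rewrite -linearP; congr emb; apply/rowP => i; rewrite !mxE.
  exact: (qform_bilinear V).1.
have lE v : mklin l v = emb (\row_(i < d) qform v (w i)) by [].
have h1 v : in_Vd d (mklin l v) by exact: in_Vd_emb.
have lw i : (i < d)%N -> mklin l (w i) = fb K i.
  move=> id; rewrite lE -(emb_delta K (Ordinal id)); congr emb; apply/rowP => j.
  by rewrite !mxE ow // eq_sym.
have h2 u : in_Vd d u -> exists v, mklin l v = u.
  move=> /in_VdP <-; exists (\sum_(i < d) co i u *: w i).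
  by rewrite linear_sum; apply: eq_bigr => i _; rewrite linearZ_LR lw.
have h3 v v' : omega (mklin l v) (mklin l v') = qform v v'.
  rewrite lE omega_emb cvec_emb mxE -[X in _ = qform X _]cw qform_sum.
  by apply: eq_bigr => i _; rewrite !mxE (qform_sym v').
by exists (@Isometry K V (mklin l) h1 h2 h3).
Qed.

(** The image under [h] of an orthonormal basis of V is completed to one of W, and both bases are
    sent to the initial vectors of [fb]. *)
Lemma isometry_choice V W (h : quad_hom V W) :
  exists (phi : isometry V) (psi : isometry W), forall v, psi (h v) = phi v.
Proof.
have [w [_ ow cw]] : exists w', [/\ forall i, (i < 0)%N -> w' i = 0 :> V,
    orthonormal (\dim {:V}) w' & complete (\dim {:V}) w'].
  by apply: (@orthonormal_complete V 0 (fun=> 0)) => i j.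
have oh : orthonormal (\dim {:V}) (h \o w).
  by move=> i j id jd; rewrite /= qlin_form ow.
have [w' [e ow' cw']] := orthonormal_complete oh.
have [phi hphi] := orthonormal_isometry ow cw.
have [psi hpsi] := orthonormal_isometry ow' cw'.
exists phi, psi => v; rewrite -(cw v) !linear_sum; apply: eq_bigr => i _.
rewrite !linearZ_LR; congr (_ *: _); rewrite [RHS]hphi // -hpsi ?e //=.
exact: leq_trans (quad_hom_dim h).
Qed.

Lemma isometry_ex V : exists phi : isometry V, True.
Proof. by have [phi _] := isometry_choice (quad_id V); exists phi. Qed.

End OrthonormalBases.

(** * Invariants of tensor products *)

Section Slices.
Variable K : fieldType.
Implicit Types U W A B : lmodType K.

Lemma slice_bilinear U W (l : {linear W -> K^o}) : bilinear_map (fun (u : U) w => l w *: u).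
Proof.
split=> [w|u] a x y; first by rewrite scalerDr !scalerA mulrC.
by rewrite linearP scalerDl scalerA.
Qed.

Definition slice U W l : {linear tens U W -> U} := tlift (slice_bilinear U l).

Lemma slice_pure U W l (u : U) (w : W) : slice U l (pure u w) = l w *: u.
Proof. exact: tlift_pure. Qed.

Lemma pureZl U W a (u : U) (w : W) : pure (a *: u) w = a *: pure u w.
Proof. exact: bilinZl (pure_bilinear U W). Qed.

Lemma pureZr U W a (u : U) (w : W) : pure u (a *: w) = a *: pure u w.
Proof. exact: bilinZr (pure_bilinear U W). Qed.

Lemma pureDl U W (u v : U) (w : W) : pure (u + v) w = pure u w + pure v w.
Proof. by have := (pure_bilinear U W).1 w 1 u v; rewrite !scale1r. Qed.

Lemma pure_sumr U W n (u : U) (w : 'I_n -> W) :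
  pure u (\sum_(i < n) w i) = \sum_(i < n) pure u (w i).
Proof. exact: (linear_sum (mklin ((pure_bilinear U W).2 u))). Qed.

(** If the [w i] are independent, coordinates of a retraction serve as dual functionals and isolate
    each [u i]. Otherwise one [w j] is eliminated and the sum becomes shorter. *)
Lemma slice_sep_sum U W n (u : 'I_n -> U) (w : 'I_n -> W) :
  (forall l, slice U l (\sum_(i < n) pure (u i) (w i)) = 0) ->
  \sum_(i < n) pure (u i) (w i) = 0.
Proof.
elim: n u w => [|n IH] u w h0; first by rewrite big_ord0.
pose f (r : 'rV[K]_n.+1) : W := \sum_i r 0 i *: w i.
have lf : linear f.
  move=> a x y; rewrite /f scaler_sumr -big_split; apply: eq_bigr => i _ /=.
  by rewrite !mxE scalerDl scalerA.
have [fi|nfi] := pselect (injective f).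
  have [r hr] := @lin_retract K _ _ (mklin lf) fi.
  apply: big1 => i _.
  have ll : linear (fun x : W => r x 0 i : K^o) by move=> a x y; rewrite linearP !mxE.
  suff -> : u i = 0 by rewrite -(scale0r (0 : U)) pureZl scale0r.
  have rw j : r (w j) = delta_mx 0 j.
    rewrite -[RHS]hr; congr (r _); rewrite -[RHS]/(f _) /f (bigD1 j) //= mxE !eqxx scale1r.
    by rewrite big1 ?addr0 // => k kj; rewrite mxE eqxx (negPf kj) scale0r.
  have lw j : mklin ll (w j) = (i == j)%:R by rewrite -[LHS]/(r (w j) 0 i) rw mxE.
  rewrite -(h0 (mklin ll)) linear_sum (bigD1 i) // big1 => [|j ji].
    by rewrite [RHS]addr0 slice_pure lw eqxx scale1r.
  by rewrite slice_pure lw eq_sym (negPf ji) scale0r.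
have [c [fc c0]] : exists c, f c = 0 /\ c != 0.
  apply: contrapT => no; apply: nfi => x y e; apply/eqP; rewrite -subr_eq0.
  apply/negPn/negP => xy; apply: no; exists (x - y); split=> //.
  by rewrite -[LHS]/(mklin lf _) linearB -[mklin lf x]/(f x) e subrr.
have [j cj] : exists j, c 0 j != 0.
  by apply/existsP; rewrite -negb_forall; apply: contraNN c0 => /forallP h;
    apply/eqP/rowP => i; rewrite mxE; apply/eqP.
have wj : w j = \sum_(i < n) (- (c 0 (lift j i) / c 0 j)) *: w (lift j i).
  move: fc; rewrite /f (bigD1_ord j) //= => /eqP; rewrite addr_eq0 => /eqP e.
  rewrite -[LHS]scale1r -(mulVf cj) -scalerA e scalerN scaler_sumr -sumrN.
  by apply: eq_bigr => i _; rewrite scalerA scaleNr mulrC.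
pose u' i := u (lift j i) - (c 0 (lift j i) / c 0 j) *: u j.
have E : \sum_(i < n.+1) pure (u i) (w i) = \sum_(i < n) pure (u' i) (w (lift j i)).
  rewrite (bigD1_ord j) //= {1}wj pure_sumr -big_split; apply: eq_bigr => i _ /=.
  by rewrite /u' pureDl pureZr -scaleNr pureZl addrC.
by rewrite E; apply: IH => l; rewrite -E.
Qed.

Lemma slice_sep U W (x : tens U W) : (forall l, slice U l x = 0) -> x = 0.
Proof.
rewrite (tens_pureE x); set s := repr x.
case: s => [|p0 s]; first by rewrite big_nil.
rewrite (big_nth p0) big_mkord => h.
exact: (slice_sep_sum (u := fun i => (nth p0 (p0 :: s) i).1)
  (w := fun i => (nth p0 (p0 :: s) i).2)).
Qed.

(** The projection [i \o r] fixes every slice of [x], and slices separate tensors. *)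
Lemma slice_image U W A (i : {linear A -> U}) (r : {linear U -> A}) (x : tens U W) :
  (forall a, r (i a) = a) -> (forall l, exists a, i a = slice U l x) ->
  tmap (lin_comp i r) (lin_id W) x = x.
Proof.
move=> ri hx; apply/eqP; rewrite -subr_eq0; apply/eqP/slice_sep => l.
rewrite linearB; have [a ha] := hx l.
suff -> : slice U l (tmap (lin_comp i r) (lin_id W) x) = i (r (slice U l x)).
  by rewrite -ha ri subrr.
apply: (tens_ext (f := lin_comp (slice U l) (tmap (lin_comp i r) (lin_id W)))
  (g := lin_comp i (lin_comp r (slice U l)))) => u w.
by rewrite !lin_compE tensE !slice_pure !lin_compE !linearZ_LR.
Qed.

(** Retractions of [i] and [j] applied to [x] give the preimage: [slice_image] is used in the first
    factor, and through the braiding in the second. *)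
Lemma tens_image U W A B (i : {linear A -> U}) (j : {linear B -> W}) (x : tens U W) :
  injective i -> injective j ->
  (forall l, exists a, i a = slice U l x) ->
  (forall l, exists b, j b = slice W l (tbraid U W x)) ->
  exists t, tmap i j t = x.
Proof.
move=> /lin_retract[r ri] /lin_retract[s sj] hi hj.
exists (tmap r s x).
have e1 := slice_image ri hi.
have e2 := slice_image sj hj.
have e3 : tmap (lin_id U) (lin_comp j s) x = x.
  apply: (can_inj (g := tbraid W U)).
    by move=> y; exact: (f_equal (fun F : {linear _ -> _} => F y) (tbraidK U W)).
  rewrite -[RHS]e2.
  apply: (tens_ext (f := lin_comp (tbraid U W) (tmap (lin_id U) (lin_comp j s)))
    (g := lin_comp (tmap (lin_comp j s) (lin_id U)) (tbraid U W))) => u w.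
  by rewrite !lin_compE !tensE.
rewrite -[RHS]e1 -{2}e3.
apply: (tens_ext (f := lin_comp (tmap i j) (tmap r s))
  (g := lin_comp (tmap (lin_comp i r) (lin_id W)) (tmap (lin_id U) (lin_comp j s)))) => u w.
by rewrite !lin_compE !tensE.
Qed.

End Slices.

(** * Permutations of the orthonormal basis *)

Section Permutations.
Variable K : numClosedFieldType.

Lemma perm_mx_orth n (s : 'S_n) : perm_mx s *m (perm_mx s)^T = 1%:M :> 'M[K]_n.
Proof. by rewrite tr_perm_mx -perm_mxM mulgV perm_mx1. Qed.

Definition permO n (s : 'S_n) : Oinf K := mxO (perm_mx_orth s).

Lemma permO_fb n (s : 'S_n) (i : 'I_n) : permO s (fb K i) = fb K (s i).
Proof.
rewrite mxOE mxact_fb -emb_delta; congr emb; apply/rowP => j; rewrite !mxE eqxx /= eq_sym.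
by [].
Qed.

Lemma permO_out n (s : 'S_n) i : (n <= i)%N -> permO s (fb K i) = fb K i.
Proof. by move=> ni; apply: mxact_id => j jn; rewrite co_fb (gtn_eqF (leq_trans jn ni)). Qed.

Lemma permOM n (s t : 'S_n) : permO (s * t)%g = (permO t * permO s)%g.
Proof. by apply: Oinf_eq => v; rewrite OinfM !mxOE mxact_comp perm_mxM. Qed.

(* g is conjugated out of sight by an involution that exchanges the basis
   vectors between d and N, outside which g is the identity, with fresh ones. *)
Lemma conj_far d (g : Oinf K) M : in_Hd d g ->
  exists2 t : Oinf K, in_Hd d t & in_Hd M (t^-1 * (g * t))%g.
Proof.
move=> /in_HdP gd; have [m hm] := Oinf_Gd g.
pose N := (m + d + M).*2; have [_ gN] := hm (m + d + M)%N ltac:(lia).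
(* Translation by N exchanges [d, N) with [d + N, N + N). As M <= N, an index from d to M - 1 is
   sent to N or beyond, where [g] is the identity. *)
pose f i := if (d <= i < N)%N then (i + N)%N else
  if (d + N <= i < N + N)%N then (i - N)%N else i.
have fN (i : 'I_(N + N)) : (f i < N + N)%N.
  have := ltn_ord i; rewrite /f; move: (val i) => k; case: ifP; [lia|case: ifP; lia].
have fK i : f (f i) = i.
  rewrite /f; case: (boolP (d <= i < N)%N) => h1; case: (boolP (d + N <= i < N + N)%N) => h2;
    repeat (case: ifP => ?); lia.
pose F i := Ordinal (fN i).
have Fi : injective F.
  by move=> i j /(f_equal val) /= e; apply: val_inj; rewrite /= -(fK i) e fK.
have tE i : (i < N + N)%N -> permO (perm Fi) (fb K i) = fb K (f i).
  by move=> h; have := permO_fb (perm Fi) (Ordinal h); rewrite permE.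
exists (permO (perm Fi)).
  apply/in_HdP => i id; rewrite tE; last by rewrite /N; lia.
  by congr fb; rewrite /f; case: ifP => [|_]; last case: ifP; rewrite ?/N; lia.
apply/in_HdP => i iM; rewrite OinfM OinfM tE; last by rewrite /N; lia.
suff -> : g (fb K (f i)) = fb K (f i).
  by rewrite -(tE i) ?OinfVK // /N; lia.
have [id|di] := ltnP i d.
  have -> : f i = i by rewrite /f; case: ifP => [|_]; last case: ifP; rewrite ?/N; lia.
  exact: gd.
apply: gN; rewrite /f; case: ifP => [|/negbT]; rewrite -/N; first lia.
by rewrite /N; lia.
Qed.

End Permutations.

(** * Smooth representations and slices of invariant tensors *)

Section Smooth.
Variable K : numClosedFieldType.
Implicit Types U W : rep K (Oinf K).

(** Equivalently, U is the union of its subspaces of H_m-invariants. *)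
Definition smooth U := forall u : U, exists m, invariant m u.

Lemma smooth2 U W (u : U) (w : W) m p : invariant m u -> invariant p w ->
  invariant (maxn m p) u /\ invariant (maxn m p) w.
Proof.
by move=> hu hw; split; [apply: invariant_mono hu|apply: invariant_mono hw];
  rewrite ?leq_maxl ?leq_maxr.
Qed.

Lemma smooth_triv : smooth (triv_rep K (Oinf K)).
Proof. by move=> u; exists 0%N. Qed.

Lemma smooth_zero : smooth (zero_rep K (Oinf K)).
Proof. by move=> u; exists 0%N. Qed.

Lemma smooth_std : smooth (std_rep K).
Proof.
move=> v; have [m hm] := in_Vd_ex v; exists m => g [_ h].
exact/h/hm.
Qed.

Lemma smooth_tens U W : smooth U -> smooth W -> smooth (tens_rep U W).
Proof.
move=> sU sW x; rewrite (tens_pureE x); elim: (repr x) => [|p s [m hm]].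
  by rewrite big_nil; exists 0%N; apply: invariant0.
have [a ha] := sU p.1; have [b hb] := sW p.2.
have [ha' hb'] := smooth2 ha hb.
have hp : invariant (maxn a b) (pure p.1 p.2 : tens_rep U W).
  by move=> g hg; rewrite -[LHS]/(tmap _ _ _) tensE ha' ?hb'.
have [h1 h2] := smooth2 hp hm.
exists (maxn (maxn a b) m); rewrite big_cons -[pure _ _]scale1r.
exact: invariant_lin.
Qed.

Lemma smooth_dsum U W : smooth U -> smooth W -> smooth (dsum_rep U W).
Proof.
move=> sU sW [u w]; have [a ha] := sU u; have [b hb] := sW w.
have [ha' hb'] := smooth2 ha hb.
by exists (maxn a b) => g hg; rewrite -[LHS]/(act U g u, act W g w) ha' ?hb'.
Qed.

Lemma smooth_tpow_sum ns : smooth (tpow_sum (std_rep K) ns).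
Proof.
have st n : smooth (tpow (std_rep K) n).
  by elim: n => [|n IH] /=; [exact: smooth_triv|exact: smooth_tens smooth_std IH].
by elim: ns => [|n ns IH] /=; [exact: smooth_zero|exact: smooth_dsum].
Qed.

Lemma smooth_sub U W (f : rep_hom U W) : injective f -> smooth W -> smooth U.
Proof.
move=> fi sW u; have [m hm] := sW (f u); exists m => g hg.
by apply: fi; rewrite rep_equiv hm.
Qed.

Lemma smooth_quot U W (f : rep_hom U W) : (forall w, exists u, f u = w) -> smooth U -> smooth W.
Proof.
move=> fs sU w; have [u <-] := fs w; have [m hm] := sU u; exists m => g hg.
by rewrite -rep_equiv hm.
Qed.

Lemma smooth_algebraic U : algebraic (std_rep K) U -> smooth U.
Proof.
move=> [ns [S [i [p [hi hp]]]]].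
have h := smooth_sub hi (@smooth_tpow_sum ns). apply: (smooth_quot (f := p)). exact: hp. exact: h.
Qed.

(** Moving the functional along with the tensor makes slicing equivariant; hence the slices of an
    H_d-invariant tensor are permuted by H_d. *)
Lemma slice_act U W (l : {linear W -> K^o}) (h : Oinf K) (x : tens_rep U W) :
  act U h (slice U l x) = slice U (lin_comp l (act W h^-1%g)) (act (tens_rep U W) h x).
Proof.
apply: (tens_ext (f := lin_comp (act U h) (slice U l))
  (g := lin_comp (slice U (lin_comp l (act W h^-1%g))) (act (tens_rep U W) h))) => u w.
rewrite !lin_compE -[act (tens_rep U W) h]/(tmap _ _) tensE !slice_pure lin_compE.
by rewrite -actM mulVg act1 linearZ_LR.
Qed.

(** Every slice is a combination of the finitely many first factors in one expression of [x], so a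
    single M serves all functionals. *)
Lemma slice_smooth U W (x : tens U W) : smooth U ->
  exists M, forall l, invariant M (slice U l x : U).
Proof.
move=> sU; rewrite (tens_pureE x); elim: (repr x) => [|p s [m hm]].
  by exists 0%N => l; rewrite big_nil linear0; apply: invariant0.
have [a ha] := sU p.1; exists (maxn a m) => l.
rewrite big_cons linearD slice_pure; have [h1 h2] := smooth2 ha (hm l).
exact: invariant_lin.
Qed.

(* The slices of an H_d-invariant tensor form an H_d-stable space whose elements
   are all fixed by one H_M; the conjugates of H_M cover H_d. *)
Lemma slice_invariant U W d (x : tens_rep U W) l : smooth U ->
  invariant d x -> invariant d (slice U l x : U).
Proof.
move=> sU hx g hg; have [M hM] := slice_smooth x sU.
have [t ht hgt] := conj_far M hg.
have st h l' : in_Hd d h -> act U h (slice U l' x) = slice U (lin_comp l' (act W h^-1%g)) x.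
  by move=> hh; rewrite slice_act hx.
set y := slice U l x; have htV : in_Hd d (t^-1)%g.
  apply/in_HdP => i id; have /in_HdP h := ht; by rewrite -{1}(h i id) OinfVK.
(* The translate of [y] by [t^-1] is again a slice of [x], so it is fixed by the middle factor,
   which lies in H_M. *)
have -> : g = (t * (t^-1 * (g * t) * t^-1))%g.
  by rewrite !mulgA mulgV mul1g -mulgA mulgV mulg1.
by rewrite actM actM /y st // hM // -st // -actM mulgV act1.
Qed.

Lemma tens_invariants U W d (A B : lmodType K) (i : {linear A -> U}) (j : {linear B -> W})
    (x : tens_rep U W) :
  smooth U -> smooth W -> injective i -> injective j ->
  (forall u, invariant d u -> exists a, i a = u) ->
  (forall w, invariant d w -> exists b, j b = w) ->
  invariant d x -> exists t, tmap i j t = x.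
Proof.
move=> sU sW ii ij hi hj hx; apply: tens_image => // l.
  exact/hi/slice_invariant.
apply/hj/(@slice_invariant W U) => // g hg.
rewrite -{2}(hx g hg); apply/esym.
exact: (rep_equiv (rep_braid U W)).
Qed.

End Smooth.

(** * Finite dimension of the invariants *)

Section Dependence.
Variable K : fieldType.

(** If k + 1 independent vectors exist when any k + 2 are dependent, they span: a relation involving
    one more vector [u] has a nonzero coefficient at [u]. Otherwise induction applies. *)
Lemma findim_of_dependent (X : lmodType K) k :
  (forall x : 'I_k.+1 -> X, exists r : 'rV[K]_k.+1, r != 0 /\ \sum_i r 0 i *: x i = 0) ->
  findim X.
Proof.
elim: k => [|k IH] dep.
  exists 0%N, (fun=> 0) => u; exists (fun=> 0); rewrite big_ord0.
  have [r [r0]] := dep (fun=> u); rewrite big_ord1 => e.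
  have r00 : r 0 0 != 0.
    by apply: contraNN r0 => /eqP h; apply/eqP/rowP => i; rewrite (ord1 i) h mxE.
  by rewrite -[u]scale1r -(mulVf r00) -scalerA e scaler0.
have [h|] := pselect (forall x : 'I_k.+1 -> X, exists r : 'rV[K]_k.+1,
  r != 0 /\ \sum_i r 0 i *: x i = 0); first exact: IH.
move=> /existsNP[x nx]; exists k.+1, x => u.
pose y i := if unlift ord0 i is Some j then x j else u.
have [r [r0]] := dep y; rewrite big_ord_recl /y unlift_none => e.
have {}e : r 0 ord0 *: u + \sum_(i < k.+1) r 0 (lift ord0 i) *: x i = 0.
  by rewrite -[RHS]e; congr (_ + _); apply: eq_bigr => i _; rewrite liftK.
have r00 : r 0 ord0 != 0.
  apply/negP => /eqP h; apply: nx; exists (\row_i r 0 (lift ord0 i)); split.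
    apply: contraNN r0 => /eqP/rowP z; apply/eqP/rowP => i; rewrite mxE.
    by case: (unliftP ord0 i) => [j|] -> //; have := z j; rewrite !mxE.
  by rewrite -[RHS]e h scale0r add0r; apply: eq_bigr => i _; rewrite mxE.
exists (fun i => - (r 0 (lift ord0 i) / r 0 ord0)).
move/eqP: e; rewrite addr_eq0 => /eqP e.
rewrite -[u]scale1r -(mulVf r00) -scalerA e scalerN scaler_sumr -sumrN.
by apply: eq_bigr => i _; rewrite scalerA scaleNr mulrC.
Qed.

Lemma dependent_of_coord k (M : 'M[K]_(k.+1, k)) : exists r : 'rV[K]_k.+1, r != 0 /\ r *m M = 0.
Proof.
have : kermx M != 0.
  by rewrite -mxrank_eq0 mxrank_ker subn_eq0 -ltnNge ltnS rank_leq_col.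
by case/rowV0Pn => r /sub_kermxP h r0; exists r.
Qed.

End Dependence.

(** * Coordinates on tensor powers, indexed by words *)

Section Coordinates.
Variable K : numClosedFieldType.
Notation T := (tpow (std_rep K)).
Notation S := (tpow_sum (std_rep K)).

Lemma coord_bilinear (W : lmodType K) i (l : {linear W -> K^o}) :
  bilinear_map (fun (v : {poly K}) (t : W) => co i v *: l t : K^o).
Proof.
split=> [t|v] a x y; first by rewrite linearP scalerDl scalerA.
by rewrite linearP scalerDr !scalerA mulrC.
Qed.

(** The coefficient at the word [w] in the basis of tensor products of vectors [fb]; a word of the
    wrong length gives 0. *)
Fixpoint coordn n (w : seq nat) : {linear T n -> K^o} :=
  match n return {linear T n -> K^o} with
  | 0 => if w is [::] then lin_id K^o else \0
  | n'.+1 => if w is i :: w' then tlift (coord_bilinear i (coordn n' w')) else \0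
  end.

Lemma coordn_pure n i w v (t : T n) :
  coordn n.+1 (i :: w) (pure (v : std_rep K) t) = co i v * coordn n w t.
Proof. exact: (tlift_pure (coord_bilinear i (coordn n w))). Qed.

Lemma coordn_size n w t : size w != n -> coordn n w t = 0.
Proof.
elim: n w t => [|n IH] [|i w] t // sw.
apply: (tens_ext (f := coordn n.+1 (i :: w)) (g := \0)) => v t'; rewrite coordn_pure IH ?mulr0 //.
Qed.

Lemma co_eq0 (v : {poly K}) : (forall i, co i v = 0) -> v = 0.
Proof.
move=> h; have [m hm] := in_Vd_ex v; have /in_VdP <- := hm m (leqnn m).
by apply: big1 => i _; rewrite h scale0r.
Qed.

(** The i-th coordinate of a slice by [l] is [l] of the contraction of the first factor by [co i],
    and that contraction vanishes by induction. *)
Lemma coordn_sep n (t : T n) : (forall w, coordn n w t = 0) -> t = 0.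
Proof.
elim: n t => [|n IH] t h; first exact: (h [::]).
apply: (@slice_sep K {poly K} (T n)) => l; apply: co_eq0 => i.
pose c := slice (T n) (co i : {linear {poly K} -> K^o}).
have e : co i (slice {poly K} l t) = l (c (tbraid _ _ t)).
  apply: (tens_ext (f := lin_comp (co i : {linear {poly K} -> K^o}) (slice {poly K} l))
    (g := lin_comp l (lin_comp c (tbraid _ _)))) => v t'.
  by rewrite !lin_compE tensE !slice_pure !linearZ_LR /= [LHS]mulrC.
rewrite e (_ : c _ = 0) ?linear0 //; apply: IH => w.
rewrite -(h (i :: w)).
apply: (tens_ext (f := lin_comp (coordn n w) (lin_comp c (tbraid _ _)))
  (g := coordn n.+1 (i :: w))) => v t'.
by rewrite [RHS]coordn_pure !lin_compE tensE slice_pure linearZ_LR.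
Qed.

Lemma coordn_act n (g : Oinf K) (p : nat -> nat) w (t : T n) :
  (forall i, g (fb K i) = fb K (p i)) ->
  coordn n [seq p i | i <- w] (act (T n) g t) = coordn n w t.
Proof.
move=> gp; elim: n w t => [|n IH] [|i w] t //.
apply: (tens_ext (f := lin_comp (coordn n.+1 [seq p i | i <- i :: w]) (act (T n.+1) g))
  (g := coordn n.+1 (i :: w))) => v t'.
rewrite lin_compE -[act (T n.+1) g]/(tmap (oval g) (act (T n) g)) tensE.
by rewrite [LHS]coordn_pure IH [RHS]coordn_pure !coE -gp oval_omega.
Qed.

Lemma coordn_supp n (t : T n) : exists m, forall w, ~~ all (gtn m) w -> coordn n w t = 0.
Proof.
elim: n t => [|n IH] t; first by exists 0%N => -[].
rewrite (tens_pureE t); elim: (repr t) => [|p s [m hm]].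
  by exists 0%N => w _; rewrite big_nil linear0.
have [a ha] := in_Vd_ex p.1; have [b hb] := IH p.2.
exists (maxn m (maxn a b)) => -[|i w] hw //.
rewrite big_cons linearD coordn_pure hm; last first.
  by apply: contraNN hw; apply: sub_all => x; rewrite /= => xm; rewrite leq_max xm.
rewrite addr0; move: hw; rewrite /= negb_and; have [|ai _] := ltnP i (maxn _ _).
  move=> _ /= hw; rewrite hb ?mulr0 //.
  by apply: contraNN hw; apply: sub_all => x; rewrite /= => xm; rewrite !leq_max xm !orbT.
have /in_VdP e := ha a (leqnn a).
by rewrite (proj_gt _ e) ?mul0r //; lia.
Qed.

Fixpoint coordS ns (j : nat) (w : seq nat) : {linear S ns -> K^o} :=
  match ns return {linear S ns -> K^o} with
  | [::] => \0
  | n :: ns' => if j is j'.+1 then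
      lin_comp (coordS ns' j' w) (snd : {linear (T n * S ns')%type -> S ns'})
    else lin_comp (coordn n w) (fst : {linear (T n * S ns')%type -> T n})
  end.

Lemma coordS_sep ns (t : S ns) : (forall j w, coordS ns j w t = 0) -> t = 0.
Proof.
elim: ns t => [|n ns IH] t h; first exact: thinmx0.
case: t h => a b h; congr (_, _).
  by apply: coordn_sep => w; apply: (h 0%N w).
by apply: IH => j w; apply: (h j.+1 w).
Qed.

Lemma coordS_act ns (g : Oinf K) (p : nat -> nat) j w (t : S ns) :
  (forall i, g (fb K i) = fb K (p i)) ->
  coordS ns j [seq p i | i <- w] (act (S ns) g t) = coordS ns j w t.
Proof.
move=> gp; elim: ns j t => [|n ns IH] [|j] // [a b]; first exact: coordn_act.
exact: IH.
Qed.

Lemma coordS_supp ns (t : S ns) :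
  exists m, forall j w, ~~ all (gtn m) w -> coordS ns j w t = 0.
Proof.
elim: ns t => [|n ns IH] t; first by exists 0%N.
case: t => a b; have [m hm] := coordn_supp a; have [p hp] := IH b.
have sub k q w : (k <= q)%N -> ~~ all (gtn q) w -> ~~ all (gtn k) w.
  by move=> kq; apply: contraNN; apply: sub_all => x /= xk; apply: leq_trans kq.
exists (maxn m p) => -[|j] w hw.
  by rewrite -[LHS]/(coordn n w a) hm // (sub _ _ _ (leq_maxl m p)).
by rewrite -[LHS]/(coordS ns j w b) hp // (sub _ _ _ (leq_maxr m p)).
Qed.

Lemma coordS_out ns N j w (t : S ns) : all (geq N) ns ->
  (N < size w)%N || (size ns <= j)%N -> coordS ns j w t = 0.
Proof.
elim: ns j t => [|n ns IH] [|j] // [a b] /andP[nN nsN] h; last exact: IH.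
rewrite -[LHS]/(coordn n w a) coordn_size //; apply/eqP => e.
by move: h nN; rewrite e /= orbF => h h'; lia.
Qed.

Lemma seq_ord p (w : seq nat) : all (gtn p) w -> exists u : seq 'I_p, [seq val o | o <- u] = w.
Proof.
elim: w => [|i w IH] /=; first by exists [::].
by move=> /andP[ip /IH[u <-]]; exists (Ordinal ip :: u).
Qed.

Lemma count_lt (p q : pred nat) (w : seq nat) x : (forall y, q y -> p y) ->
  x \in w -> p x -> ~~ q x -> (count q w < count p w)%N.
Proof.
move=> qp; elim: w => [|y w IH] //; rewrite inE => /orP[/eqP <-|xw] px nqx /=.
  by rewrite px (negPf nqx) add0n add1n ltnS; apply: sub_count.
have lt := IH xw px nqx; have := qp y.
case: (q y); case: (p y) => h; rewrite ?add0n ?add1n ?ltnS //; first by have := h isT.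
exact: ltnW.
Qed.

Definition swap (a b i : nat) := if i == a then b else if i == b then a else i.

(** Induction on the number of letters that are at least d + N: such a letter [b] is exchanged with
    some [a] in [d, d + N) absent from the word, which leaves the coordinate of [t] unchanged. *)
Lemma coordS_swap_invariant ns N d m (t : S ns) : all (geq N) ns ->
  (forall j w, ~~ all (gtn m) w -> coordS ns j w t = 0) ->
  (forall a b, (d <= a < d + N)%N -> (d + N <= b < m)%N ->
    exists2 g : Oinf K, forall i, g (fb K i) = fb K (swap a b i) & act (S ns) g t = t) ->
  (forall j w, (j < size ns)%N -> (size w <= N)%N -> all (gtn (d + N)) w ->
    coordS ns j w t = 0) ->
  t = 0.
Proof.
move=> nsN tm tinv t0; apply: coordS_sep => j w.
have [h|] := boolP ((N < size w)%N || (size ns <= j)%N); first exact: (coordS_out _ nsN).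
rewrite negb_or -leqNgt -ltnNge => /andP[wN jn].
move: {2}(count _ w).+1 (ltnSn (count (leq (d + N)) w)) => k.
elim: k w wN => // k IH w wN cw.
have [wd|] := boolP (all (gtn (d + N)) w); first exact: t0.
move=> /allPn[b bw]; rewrite /= -leqNgt => db.
have [wm|] := boolP (all (gtn m) w); last exact: tm.
have bm : (b < m)%N by have /allP := wm; apply.
(* Pigeonhole: [b] and the N letters from d to d + N - 1 cannot all occur in a word of length at
   most N. *)
have [a ad aw] : exists2 a, (d <= a < d + N)%N & a \notin w.
  have [/allP h|/allPn[a]] := boolP (all (mem w) (iota d N)); last first.
    by rewrite mem_iota => ad aw; exists a.
  have u : uniq (b :: iota d N) by rewrite /= iota_uniq mem_iota andbT; lia.
  have := uniq_leq_size (s2 := w) u; rewrite /= size_iota => /(_ _) le.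
  suff : (N < size w)%N by lia.
  by apply: le => x; rewrite inE => /orP[/eqP ->|/h].
have [||g gp gt] := tinv a b; [by []|by apply/andP|].
rewrite -(coordS_act j w t gp) gt; apply: IH; first by rewrite size_map.
rewrite ltnS in cw; apply: leq_trans cw; rewrite count_map.
have -> : count (preim (swap a b) (leq (d + N))) w = count (fun i => (i != b) && (d + N <= i))%N w.
  apply: eq_in_count => i iw; rewrite /= /swap; have [e|_] := eqVneq i a.
    by move: aw; rewrite -e iw.
  by have [->|_] := eqVneq i b => //=; lia.
apply: (@count_lt _ _ _ b) => //; last by rewrite /= eqxx.
by move=> y /andP[].
Qed.

End Coordinates.

(** * Averaging over finite groups of permutations *)

Section Averaging.
Variable K : numClosedFieldType.

Definition perm_nat n (s : 'S_n) (i : nat) := if insub i is Some o then val (s o) else i.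

Lemma permO_nat n (s : 'S_n) i : permO K s (fb K i) = fb K (perm_nat s i).
Proof.
rewrite /perm_nat; case: insubP => [o _ <-|]; first exact: permO_fb.
by rewrite -leqNgt; apply: permO_out.
Qed.

Lemma perm_nat_ord n (s : 'S_n) (o : 'I_n) : perm_nat s o = s o.
Proof. by rewrite /perm_nat valK. Qed.

Lemma perm_natK n (s : 'S_n) : cancel (perm_nat s^-1) (perm_nat s).
Proof.
move=> i; rewrite {2}/perm_nat; case: insubP => [o _ <-|h].
  by rewrite perm_nat_ord permKV.
by rewrite /perm_nat insubN.
Qed.

Lemma perm_nat_ge n (s : 'S_n) i : (perm_nat s i < n)%N = (i < n)%N.
Proof.
rewrite /perm_nat; case: insubP => [o _ <-|/negPf //].
by rewrite !ltn_ord.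
Qed.

Definition fixes_below d m (s : 'S_m) : bool := [forall i : 'I_m, (i < d)%N ==> (s i == i)].

Lemma fixes_belowP d m (s : 'S_m) : reflect (forall i : 'I_m, (i < d)%N -> s i = i) (fixes_below d s).
Proof.
by apply: (iffP forallP) => h i; [move=> id; apply/eqP/(implyP (h i))|apply/implyP => id; apply/eqP/h].
Qed.

Lemma permO_Hd d m (s : 'S_m) : fixes_below d s -> in_Hd d (permO K s).
Proof.
move=> /fixes_belowP h; apply/in_HdP => i id; have [im|mi] := ltnP i m; last exact: permO_out.
by have := permO_fb K s (Ordinal im); rewrite h.
Qed.

Variable U : rep K (Oinf K).

(** The sum is not divided by the order [nfix d m] of the group; this factor is cleared at the end
    of [inv_sp_findim]. *)
Definition avg d m (u : U) : U := \sum_(s : 'S_m | fixes_below d s) act U (permO K s) u.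

Lemma avg_fixed d m (s : 'S_m) u : fixes_below d s -> act U (permO K s) (avg d m u) = avg d m u.
Proof.
(* [permO] reverses products, so acting by [permO K s] amounts to right multiplication by [s]. *)
move=> hs; rewrite {2}/avg (reindex_inj (mulIg s)) /avg linear_sum.
apply: eq_big => [t|t _]; last by rewrite permOM actM.
apply/fixes_belowP/fixes_belowP => h i id; last first.
  by apply: (@perm_inj _ s); rewrite -permM h // (fixes_belowP _ _ hs).
by rewrite permM h // (fixes_belowP _ _ hs).
Qed.

Definition nfix d m : nat := #|[pred s : 'S_m | fixes_below d s]|.

Lemma nfix_gt0 d m : (0 < nfix d m)%N.
Proof.
apply/card_gt0P; exists 1%g; apply/fixes_belowP => i _; exact: perm1.
Qed.

Lemma avg_invariant d m u : invariant d u -> avg d m u = (nfix d m)%:R *: u.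
Proof.
move=> hu; rewrite /avg /nfix -sum1_card natr_sum scaler_suml.
apply: eq_big => [//|s hs]; rewrite scale1r hu //; exact: permO_Hd.
Qed.

End Averaging.

Lemma avg_hom (K : numClosedFieldType) (U W : rep K (Oinf K)) (f : rep_hom U W) d m u :
  f (avg d m u) = avg d m (f u).
Proof. by rewrite /avg linear_sum; apply: eq_bigr => s _; rewrite rep_equiv. Qed.

(** * The bound on the dimension of the invariants *)

Section FiniteDimension.
Variable K : numClosedFieldType.
Notation S := (tpow_sum (std_rep K)).

Lemma avg_supp ns d m (t : S ns) :
  (forall j w, ~~ all (gtn m) w -> coordS K ns j w t = 0) ->
  forall j w, ~~ all (gtn m) w -> coordS K ns j w (avg d m t) = 0.
Proof.
move=> h j w hw; rewrite /avg linear_sum; apply: big1 => s _.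
have -> : w = [seq perm_nat s i | i <- [seq perm_nat (s^-1)%g i | i <- w]].
  by rewrite -map_comp map_id_in // => i _; apply: perm_natK.
rewrite (coordS_act _ _ _ (permO_nat K s)) h // all_map.
by apply: contraNN hw; apply: sub_all => i; rewrite /= perm_nat_ge.
Qed.

Lemma inv_sp_findim (U : rep K (Oinf K)) V : algebraic (std_rep K) U -> findim (inv_sp U V).
Proof.
move=> [ns [S0 [i [p [hi hp]]]]].
have [phi _] := isometry_ex V; set d := \dim {:V}.
pose N := (\max_(n <- ns) n)%N.
have nsN : all (geq N) ns by apply/allP => n nin; apply: leq_bigmax_seq.
(* A summand and a word of length at most N in the first d + N letters. This set depends on d and
   the presentation of U, not on the vectors [x]; its size bounds the dimension. *)
pose idx : finType := ('I_(size ns) * (N.-bseq 'I_(d + N)))%type.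
apply: (@findim_of_dependent _ _ #|idx|) => x.
have [s hs] := choice (fun a => hp (x a phi)).
have [b hb] := choice (fun a => coordS_supp (i (s a))).
(* All letters occurring in the lifts [s a] lie below m, and permuting the letters below m preserves
   this. *)
pose m := (d + N + \max_a b a)%N.
pose t a := i (avg d m (s a)).
pose c (q : idx) : {linear S ns -> K^o} := coordS K ns q.1 [seq val o | o <- q.2].
have [r [r0 rM]] := dependent_of_coord (\matrix_(a, q) c (enum_val q) (t a)).
exists r; split=> //.
have tsupp a : forall j w, ~~ all (gtn m) w -> coordS K ns j w (t a) = 0.
  rewrite /t avg_hom; apply: avg_supp => j w hw; apply: hb.
  apply: contraNN hw; apply: sub_all => y /= hy; apply: leq_trans hy _.
  exact: leq_trans (leq_bigmax a) (leq_addl _ _).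
have tot : \sum_a r 0 a *: t a = 0.
  apply: (@coordS_swap_invariant K ns N d m) => //.
  - move=> j w hw; rewrite linear_sum big1 // => a _.
    by rewrite linearZ_LR tsupp // scaler0.
  (* The transposition of [y] and [z] fixes the letters below d, so it belongs to the group averaged
     over. *)
  - move=> y z /andP[dy yd] /andP[dz zm].
    have ym : (y < m)%N by apply: leq_trans yd _; apply: leq_addr.
    pose s' := tperm (Ordinal ym) (Ordinal zm).
    exists (permO K s').
      move=> k; rewrite permO_nat /perm_nat /swap; congr fb; case: insubP => [o _ <-|].
        rewrite /s'; case: tpermP => [->|->|/eqP h1 /eqP h2] /=; rewrite ?eqxx //.
          by rewrite gtn_eqF //; lia.
        by rewrite -!val_eqE /= in h1 h2; rewrite (negPf h1) (negPf h2).
      by rewrite -leqNgt => mk; rewrite !gtn_eqF //; apply: leq_trans mk.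
    rewrite linear_sum; apply: eq_bigr => a _; rewrite linearZ_LR; congr (_ *: _).
    rewrite /t -rep_equiv avg_fixed //; apply/fixes_belowP => o od.
    by rewrite tpermD //; apply/eqP => /(f_equal val) /= e; move: od; rewrite -e; lia.
  - move=> j w jn wN wd; have [w' e] : exists w' : N.-bseq 'I_(d + N), [seq val o | o <- w'] = w.
      have [u e] := seq_ord wd; have us : (size u <= N)%N by rewrite -(size_map val) e.
      by exists (Bseq us).
    rewrite -e.
    have := f_equal (fun M : 'rV_ _ => M 0 (enum_rank ((Ordinal jn, w') : idx))) rM.
    rewrite !mxE => h; rewrite -[RHS]h linear_sum; apply: eq_bigr => a _.
    by rewrite linearZ_LR mxE enum_rankK.
have e0 : \sum_a r 0 a *: avg d m (s a) = 0.
  apply: hi; rewrite linear0 -[RHS]tot linear_sum; apply: eq_bigr => a _.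
  by rewrite linearZ_LR.
apply: (@fam_eq _ _ _ _ _ phi).
have ev_lin : linear (fun y : inv_sp U V => y phi) by [].
rewrite -[LHS]/(mklin ev_lin _) linear_sum.
(* Applying [p] gives the desired relation among the [x a] multiplied by the order of the group,
   which is invertible in characteristic zero. *)
have nz : (nfix d m)%:R != 0 :> K by rewrite pnatr_eq0 -lt0n nfix_gt0.
rewrite -[LHS]scale1r -(mulVf nz) -scalerA scaler_sumr.
have E a : p (r 0 a *: avg d m (s a)) = (nfix d m)%:R *: mklin ev_lin (r 0 a *: x a).
  have -> : mklin ev_lin (r 0 a *: x a) = r 0 a *: x a phi by [].
  have e : p (avg d m (s a)) = (nfix d m)%:R *: x a phi.
    by rewrite avg_hom hs avg_invariant //; apply: fam_inv.
  by rewrite linearZ_LR e !scalerA [X in X *: _ = _]mulrC.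
have <- : p (\sum_a r 0 a *: avg d m (s a)) = \sum_a (nfix d m)%:R *: mklin ev_lin (r 0 a *: x a).
  by rewrite linear_sum; apply: eq_bigr => a _; apply: E.
by rewrite e0 linear0 scaler0.
Qed.

End FiniteDimension.

(** * The functor *)

Section WellDefined.
Variable K : numClosedFieldType.
Implicit Types V W X : quad_space K.

Section OneRep.
Variable U : rep K (Oinf K).

Lemma inv_map_is_linear V W (h : quad_hom V W) : linear (@inv_map K U V W h).
Proof.
move=> a x y; have [phi [psi e]] := isometry_choice h.
apply: (fam_eq (phi := psi)).
rewrite -[RHS]/(a *: inv_map h x psi + inv_map h y psi).
by rewrite !(inv_mapP _ e).
Qed.

Lemma inv_map_is_id V (x : inv_sp U V) : inv_map (quad_id V) x = x.
Proof.
by have [phi _] := isometry_ex V; apply: (fam_eq (phi := phi)); apply: inv_mapP.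
Qed.

End OneRep.

Lemma in_Gd_inv d (g : Oinf K) : in_Gd d g -> in_Gd d (g^-1)%g.
Proof. by move=> [_ h]; apply: in_GdP => v hv; rewrite -{1}(h v hv) OinfVK. Qed.

Lemma in_Gd_mono d d' (g : Oinf K) : (d <= d')%N -> in_Gd d g -> in_Gd d' g.
Proof.
move=> dd' [_ h]; apply: in_GdP => v /in_Vd'P h0; apply: h; apply/in_Vd'P => i id.
by apply: h0; apply: leq_trans dd'.
Qed.

Lemma isometry_act V (phi : isometry V) (g : Oinf K) : in_Gd (\dim {:V}) g ->
  exists psi : isometry V, forall v, psi v = g (phi v).
Proof.
move=> hg; have h1 v : in_Vd (\dim {:V}) (lin_comp g phi v) by apply: hg.1; apply: iso_Vd.
have h2 w : in_Vd (\dim {:V}) w -> exists v, lin_comp g phi v = w.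
  move=> hw; have [v hv] := iso_onto phi ((in_Gd_inv hg).1 _ hw).
  by exists v; rewrite lin_compE hv OinfKV.
have h3 v w : omega (lin_comp g phi v) (lin_comp g phi w) = qform v w.
  by rewrite !lin_compE oval_omega iso_omega.
by exists (Isometry h1 h2 h3).
Qed.

(** An arbitrary compatible pair is corrected by an element of G_d, which also acts on isometries of
    W. Prescribing [phi] lets isometries be chosen along composites. *)
Lemma isometry_extend V W (h : quad_hom V W) (phi : isometry V) :
  exists psi : isometry W, forall v, psi (h v) = phi v.
Proof.
have [phi0 [psi0 e]] := isometry_choice h.
have [g hg hphi] := isometry_transport phi0 phi.
have [psi hpsi] := isometry_act psi0 (in_Gd_mono (quad_hom_dim h) hg).
by exists psi => v; rewrite hpsi e hphi.
Qed.

Lemma inv_map_is_comp (U : rep K (Oinf K)) V W X (h : quad_hom W X) (k : quad_hom V W)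
    (x : inv_sp U V) :
  inv_map (quad_comp h k) x = inv_map h (inv_map k x).
Proof.
have [phi [chi e]] := isometry_choice k; have [psi e'] := isometry_extend h chi.
apply: (fam_eq (phi := psi)); rewrite (inv_mapP _ e') (inv_mapP _ e).
by apply: inv_mapP => v; rewrite -e -e'.
Qed.

Lemma inv_mor_natural (U U' : rep K (Oinf K)) (f : rep_hom U U') V W (h : quad_hom V W)
    (x : inv_sp U V) :
  inv_mor f W (inv_map h x) = inv_map h (inv_mor f V x).
Proof.
have [phi [psi e]] := isometry_choice h; apply: (fam_eq (phi := psi)).
by rewrite -[LHS]/(f _) !(inv_mapP _ e).
Qed.

Lemma well_defined : inv_well_defined K.
Proof.
split.
- exact: isometry_choice.
- by move=> U V W h u phi psi; exact: inv_mapP.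
- by move=> U V; apply: inv_sp_findim; exact: (svalP U).
- by move=> U V W h; exact: inv_map_is_linear.
- by move=> U V; exact: inv_map_is_id.
- by move=> U V W X h k; exact: inv_map_is_comp.
- by move=> U U' f V W h; exact: inv_mor_natural.
Qed.

End WellDefined.

(** * Linearity and full faithfulness *)

Section Faithful.
Variable K : numClosedFieldType.
Implicit Types V W X : quad_space K.
Let wd := well_defined K.
Let F := invariants_functor wd.

Lemma invariants_linear : @linear_functor K (RepO K) (FunT1 K) F.
Proof.
move=> U W s f g; apply: nat_hom_eq => V; apply: lin_eq => x.
by apply: inv_sp_eq => phi.
Qed.

Lemma smooth_obj (U : RepO K) : smooth (sval U).
Proof. by apply: smooth_algebraic; exact: (svalP U). Qed.

(** Smoothness makes [u] invariant for the standard space of any large enough dimension; the bound M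
    allows further conditions on that dimension. *)
Lemma element_is_value (U : rep K (Oinf K)) (u : U) M : smooth U -> exists V (phi : isometry V) (x : inv_sp U V),
  (M <= \dim {:V})%N /\ x phi = u.
Proof.
move=> sU; have [m hm] := sU u.
pose V := std_quad K (maxn M m); have dV : \dim {:V} = maxn M m by exact: std_quad_dim.
have [phi _] := isometry_ex V.
have hu : invariant (\dim {:V}) u by apply: invariant_mono hm; rewrite dV leq_maxr.
have [x hx] := fam_ex phi hu.
by exists V, phi, x; split=> //; rewrite dV leq_maxl.
Qed.

(** Since V_d is contained in V_d', the inverse of [psi] can be applied after [phi]. *)
Lemma isometry_between V W (phi : isometry V) (psi : isometry W) :
  (\dim {:V} <= \dim {:W})%N -> exists h : quad_hom V W, forall v, psi (h v) = phi v.
Proof.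
move=> le; have ex v : exists w, psi w = phi v.
  by apply: iso_onto; apply: in_Vd_mono le _; apply: iso_Vd.
have [h hh] := choice ex.
have lh : linear h.
  by move=> a x y; apply: (@isometry_inj _ _ psi); rewrite linearP !hh linearP.
have fh x y : qform (mklin lh x) (mklin lh y) = qform x y.
  by rewrite -(iso_omega psi) -(iso_omega phi) -!hh.
by exists (QuadHom fh).
Qed.

Section Full.
Variables (U W : rep K (Oinf K)).
Variable s : forall V : quad_space K, {linear inv_sp U V -> inv_sp W V}.
Hypothesis s_nat : forall V V' (h : quad_hom V V') (x : inv_sp U V),
  s V' (inv_map h x) = inv_map h (s V x).

(** When V has the smaller dimension, [y] is the image of [x] under the map from [isometry_between],
    and naturality applies. This makes the map U -> W of [nat_trans_is_mor] well defined. *)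
Lemma nat_value V V' (phi : isometry V) (psi : isometry V') (x : inv_sp U V) (y : inv_sp U V') :
  x phi = y psi -> s V x phi = s V' y psi.
Proof.
wlog le : V V' phi psi x y / (\dim {:V} <= \dim {:V'})%N.
  move=> H e; have [le|/ltnW le] := leqP (\dim {:V}) (\dim {:V'}); first exact: H.
  by apply/esym/H.
have [h hh] := isometry_between phi psi le.
move=> e; have -> : y = inv_map h x.
  by apply: (fam_eq (phi := psi)); rewrite (inv_mapP _ hh).
by rewrite s_nat (inv_mapP _ hh).
Qed.

Lemma nat_trans_is_mor : smooth U -> exists f : rep_hom U W, forall V (x : inv_sp U V), inv_mor f V x = s V x.
Proof.
move=> sU.
have ex (u : U) : exists w : W, forall V (phi : isometry V) (x : inv_sp U V),
    x phi = u -> s V x phi = w.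
  have [V [phi [x [_ <-]]]] := element_is_value u 0 sU.
  by exists (s V x phi) => V' psi y e; apply: nat_value.
have [f hf] := choice ex.
have lf : linear f.
  (* Both vectors are realised over one space V', chosen of dimension at least that of V. *)
  move=> a u u'; have [V [phi [x [_ ex1]]]] := element_is_value u 0 sU.
  have [V' [psi [y [le ey]]]] := element_is_value u' (\dim {:V}) sU.
  have [h hh] := isometry_between phi psi le.
  have e : inv_map h x psi = u by rewrite (inv_mapP _ hh).
  rewrite -(hf u _ psi _ e) -(hf u' _ psi _ ey).
  rewrite -(hf _ _ psi (a *: inv_map h x + y)); first by rewrite linearP.
  by rewrite -[LHS]/(a *: inv_map h x psi + y psi) e ey.
have ef g u : mklin lf (act U g u) = act W g (mklin lf u).
  (* V is taken so large that [g] lies in its G_d; then [g] after [phi] is another isometry [psi],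
     and acting by [g] passes from the [phi]-component to the [psi]-component. *)
  have [m hm] := Oinf_Gd g; have [V [phi [x [le <-]]]] := element_is_value u m.*2 sU.
  have gV : in_Gd (\dim {:V}) g by apply: in_Gd_mono le _; have [] := hm m (leqnn m).
  have [psi hpsi] := isometry_act phi gV.
  rewrite -(fam_act x hpsi) -[LHS]/(f _) -[mklin lf _]/(f _).
  by rewrite -(hf _ _ psi x erefl) -(hf _ _ phi x erefl) (fam_act _ hpsi).
exists (RepHom ef) => V x; apply: inv_sp_eq => phi.
by rewrite -[LHS]/(f (x phi)) (hf _ _ phi x erefl).
Qed.

End Full.

Lemma invariants_fully_faithful : fully_faithful F.
Proof.
move=> U W.
have inj : injective (@fmor _ _ F U W).
  move=> f f' e; apply/rep_cat_eq/lin_eq => u.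
  have [V [phi [x [_ <-]]]] := element_is_value u 0 (@smooth_obj U).
  have := f_equal (fun t : nat_trans (inv_obj wd U) (inv_obj wd W) => t V) e.
  by move=> /(f_equal (fun l : {linear inv_sp (sval U) V -> inv_sp (sval W) V} => l x phi)).
have surj : forall s, exists f, @fmor _ _ F U W f = s.
  move=> s; have [f hf] := @nat_trans_is_mor (sval U) (sval W) (@ncomp _ _ _ _ s)
    (fun V V' h x => f_equal (fun l : {linear inv_sp (sval U) V -> inv_sp (sval W) V'} => l x)
      (ncomp_nat s h)) (@smooth_obj U).
  by exists f; apply: nat_hom_eq => V; apply: lin_eq => x; exact: hf.
have [G hG] := choice surj.
by exists G => // f; apply: inj; rewrite hG.
Qed.

End Faithful.

(** * Kernels *)

Section KernelRep.
Variables (K : fieldType) (G : groupType).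

Section Ker.
Variables (U W : rep K G) (f : rep_hom U W).

Definition kerp : pred U := fun u => f u == 0.

Record ker_sp := KerSp { kval : U; kvalP : kval \in kerp }.

HB.instance Definition _ := [isSub for kval].
HB.instance Definition _ := [Choice of ker_sp by <:].

Lemma kerp_closed : submod_closed kerp.
Proof.
split; first by rewrite unfold_in linear0.
by move=> a u v; rewrite !unfold_in linearP => /eqP -> /eqP ->; rewrite scaler0 addr0.
Qed.

HB.instance Definition _ := GRing.isSubmodClosed.Build K U kerp kerp_closed.
HB.instance Definition _ := [SubChoice_isSubLmodule of ker_sp by <:].

Lemma ker_act_subproof g (u : ker_sp) : act U g (kval u) \in kerp.
Proof. by case: u => u /= /eqP h; rewrite unfold_in rep_equiv h linear0. Qed.

Definition ker_act_fun g (u : ker_sp) : ker_sp := KerSp (ker_act_subproof g u).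

Lemma ker_act_linear g : linear (ker_act_fun g).
Proof. by move=> a u v; apply: val_inj; rewrite /= linearP. Qed.

Definition ker_rep : rep K G.
Proof.
refine (@Rep K G ker_sp (fun g => mklin (ker_act_linear g)) _ _).
- abstract (by move=> u; apply: val_inj; exact: act1).
- abstract (by move=> g h u; apply: val_inj; exact: actM).
Defined.

Lemma kval_linear : linear (kval : ker_sp -> U).
Proof. by []. Qed.

Definition ker_incl : rep_hom ker_rep U :=
  @RepHom K G ker_rep U (mklin kval_linear) (fun g x => erefl).

Lemma ker_incl_inj : injective ker_incl.
Proof. exact: val_inj. Qed.

Lemma ker_inclK (u : ker_rep) : f (ker_incl u) = 0.
Proof. by case: u => u /= /eqP. Qed.

Lemma ker_incl_img u : f u = 0 -> exists x, ker_incl x = u.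
Proof. by move=> /eqP h; exists (KerSp h). Qed.

End Ker.

(** If U is the quotient of S by [p], then [p] maps the subrepresentation ker (f p) of S onto ker
    f. *)
Lemma algebraic_ker (T U W : rep K G) (f : rep_hom U W) :
  algebraic T U -> algebraic T (ker_rep f).
Proof.
move=> [ns [S [i [p [hi hp]]]]].
pose fp := rep_comp f p.
have ex (x : ker_rep fp) : exists y : ker_rep f, ker_incl f y = p (ker_incl fp x).
  by apply: ker_incl_img; exact: (ker_inclK x).
have [q hq] := choice ex.
have lq : linear q.
  move=> a x y; apply: (@ker_incl_inj _ _ f).
  transitivity (a *: p (ker_incl fp x) + p (ker_incl fp y)); first by rewrite hq !linearP.
  by rewrite -!hq linearP.
have eq g x : mklin lq (act (ker_rep fp) g x) = act (ker_rep f) g (mklin lq x).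
  apply: (@ker_incl_inj _ _ f); rewrite -[mklin lq _]/(q _) hq !rep_equiv.
  by rewrite -[mklin lq x]/(q _) hq.
exists ns, (ker_rep fp), (rep_comp i (ker_incl fp)), (RepHom eq); split.
  exact: inj_comp hi (@ker_incl_inj _ _ fp).
move=> u; have [s hs] := hp (ker_incl f u).
have [x hx] : exists x, ker_incl fp x = s.
  by apply: ker_incl_img; rewrite -[LHS]/(f (p s)) hs ker_inclK.
by exists x; apply: (@ker_incl_inj _ _ f); rewrite -[RHS]hs -hx; apply: hq.
Qed.

End KernelRep.

(** * Left exactness *)

Section LeftExact.
Variable K : numClosedFieldType.
Implicit Types V : quad_space K.
Let wd := well_defined K.
Let F := invariants_functor wd.

Definition nval (X Y : functor (T1 K) (vectf_tcat K)) (s : nat_trans X Y) V :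
  {linear sval (X V) -> sval (Y V)} := s V.

Lemma nval_nat X Y (s : nat_trans X Y) V W (h : quad_hom V W) x :
  nval s W ((fmor X h : {linear sval (X V) -> sval (X W)}) x) =
  (fmor Y h : {linear sval (Y V) -> sval (Y W)}) (nval s V x).
Proof.
exact: (f_equal (fun l : {linear sval (X V) -> sval (Y W)} => l x) (ncomp_nat s h)).
Qed.

Section OneKernel.
Variables (a b c : RepO K) (k : hom a b) (f : hom b c).
Hypothesis kf : is_kernel k f.

Definition kerO (x y : RepO K) (g : hom x y) : RepO K :=
  exist _ (ker_rep g) (algebraic_ker g (svalP x)).

Definition inclO (x y : RepO K) (g : hom x y) : hom (kerO g) x := ker_incl g.

Lemma inclOK (x y : RepO K) (g : hom x y) :
  g \oc inclO g = hzero (tlin (RepO K)) (kerO g) y.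
Proof. by apply/rep_cat_eq/lin_eq => u; exact: (ker_inclK u). Qed.

(** The inclusion of ker k and the zero map have the same composite with [k], so uniqueness of
    factorisations makes the inclusion zero. *)
Lemma kernel_inj : injective (k : rep_hom (sval a) (sval b)).
Proof.
have [z [_ uz]] := kf.2 _ (hzero (tlin (RepO K)) (kerO k) b) (comp_zeror _ _ _).
have e : inclO k = hzero (tlin (RepO K)) (kerO k) a.
  by rewrite -(uz _ (inclOK k)) -(uz _ (comp_zeror _ _ _)).
move=> x y /eqP; rewrite -subr_eq0 -linearB => /eqP h.
have [t ht] := ker_incl_img h.
apply/eqP; rewrite -subr_eq0 -ht.
by have := f_equal (fun g : rep_hom _ _ => g t) e => /= ->.
Qed.

(** The inclusion of ker f factors through [k]. *)
Lemma kernel_img (u : sval b) : (f : rep_hom (sval b) (sval c)) u = 0 ->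
  exists x, (k : rep_hom (sval a) (sval b)) x = u.
Proof.
move=> h; have [g [hg _]] := kf.2 _ (inclO f) (inclOK f).
have [t <-] := ker_incl_img h.
exists ((g : rep_hom _ _) t).
exact: (f_equal (fun g : rep_hom (sval (kerO f)) (sval b) => g t) hg).
Qed.

Lemma kernel_comp (u : sval a) : (f : rep_hom (sval b) (sval c)) ((k : rep_hom _ _) u) = 0.
Proof. exact: (f_equal (fun g : rep_hom (sval a) (sval c) => g u) kf.1). Qed.

Lemma inv_mor_inj V : injective (inv_mor (k : rep_hom (sval a) (sval b)) V).
Proof.
move=> x y e; apply: inv_sp_eq => phi; apply: kernel_inj.
exact: (f_equal (fun z : inv_sp (sval b) V => z phi) e).
Qed.

(** The preimage under [k] of an H_d-invariant vector is itself H_d-invariant, because [k] is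
    injective and equivariant. *)
Lemma inv_mor_img V (y : inv_sp (sval b) V) :
  inv_mor (f : rep_hom (sval b) (sval c)) V y = 0 ->
  exists x, inv_mor (k : rep_hom (sval a) (sval b)) V x = y.
Proof.
move=> h; have [phi _] := isometry_ex V.
have h0 : (f : rep_hom (sval b) (sval c)) (y phi) = 0.
  exact: (f_equal (fun z : inv_sp (sval c) V => z phi) h).
have [u hu] := kernel_img h0.
have iu : invariant (\dim {:V}) u.
  by move=> g hg; apply: kernel_inj; rewrite rep_equiv hu (fam_inv y).
have [x hx] := fam_ex phi iu; exists x; apply: (fam_eq (phi := phi)).
by rewrite -hu -hx.
Qed.

(** The factorisation is built separately at each V; injectivity of [inv_mor k] yields its
    linearity, naturality and uniqueness. *)
Lemma functor_kernel : @is_kernel K (FunT1 K) _ _ _ (fmor F k) (fmor F f).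
Proof.
split=> [|X g hg].
  by apply: nat_hom_eq => V; apply: lin_eq => x; apply: inv_sp_eq => phi; exact: kernel_comp.
pose g0 : nat_trans X (inv_obj wd b) := g.
have ex V (x : sval ((X : functor _ _) V)) : exists y : inv_sp (sval a) V,
    inv_mor (k : rep_hom (sval a) (sval b)) V y = nval g0 V x.
  apply: inv_mor_img.
  exact: (f_equal (fun s : nat_trans X (inv_obj wd c) => nval s V x) hg).
pose q V x := projT1 (cid (ex V x)).
have hq V x : inv_mor (k : rep_hom (sval a) (sval b)) V (q V x) = nval g0 V x.
  exact: projT2 (cid (ex V x)).
have lq V : linear (q V).
  by move=> t x y; apply: inv_mor_inj; rewrite linearP !hq linearP.
have nq V W (h : quad_hom V W) :
    @comp (vectf_tcat K) _ _ _ (mklin (lq W) : hom ((X : functor (T1 K) _) W) (inv_obj wd a W))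
      (fmor (X : functor (T1 K) _) h) =
    fmor (inv_obj wd a) h \oc (mklin (lq V) : hom ((X : functor (T1 K) _) V) (inv_obj wd a V)).
  apply: lin_eq => x; apply: inv_mor_inj.
  transitivity (inv_map h (nval g0 V x)); last by rewrite -hq -inv_mor_natural.
  rewrite -[RHS](nval_nat g0 h x); exact: hq.
exists (@NatTrans (T1 K) (vectf_tcat K) X (inv_obj wd a) (fun V => mklin (lq V)) nq); split.
  by apply: nat_hom_eq => V; apply: lin_eq => x; exact: hq.
move=> g' hg'; apply: nat_hom_eq => V; apply: lin_eq => x; apply: inv_mor_inj.
transitivity (nval g0 V x); first exact: hq.
exact: (f_equal (fun s : nat_trans X (inv_obj wd b) => nval s V x) (esym hg')).
Qed.

End OneKernel.

Lemma invariants_left_exact : @left_exact K (RepO K) (FunT1 K) F.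
Proof. by move=> a b c k f; exact: functor_kernel. Qed.

End LeftExact.

(** * The monoidal structure *)

Section Monoidal.
Variable K : numClosedFieldType.
Let wd := well_defined K.
Let F := invariants_functor wd.
Implicit Types (U W : rep K (Oinf K)) (V : quad_space K).

Lemma ev_linear U V (phi : isometry V) : linear (fun x : inv_sp U V => x phi).
Proof. by []. Qed.

Definition ev U V (phi : isometry V) : {linear inv_sp U V -> U} := mklin (@ev_linear U V phi).

Lemma ev_inj U V (phi : isometry V) : injective (@ev U V phi).
Proof. by move=> x y; apply: fam_eq. Qed.

Lemma act_tmap_ev U W V g (phi psi : isometry V) (t : tens (inv_sp U V) (inv_sp W V)) :
  (forall x : inv_sp U V, act U g (x phi) = x psi) ->
  (forall x : inv_sp W V, act W g (x phi) = x psi) ->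
  act (tens_rep U W) g (tmap (ev U phi) (ev W phi) t) = tmap (ev U psi) (ev W psi) t.
Proof.
move=> hU hW; apply: (tens_ext (f := lin_comp (act (tens_rep U W) g) (tmap (ev U phi) (ev W phi)))
  (g := tmap (ev U psi) (ev W psi))) => x y.
by rewrite lin_compE !tensE; congr (pure _ _); [exact: hU|exact: hW].
Qed.

Lemma tens_family U W V (t : tens (inv_sp U V) (inv_sp W V)) :
  (fun phi => tmap (ev U phi) (ev W phi) t) \in @is_familyb K (tens_rep U W) V.
Proof.
apply/asboolP; split=> [phi g hg|g phi psi hg e].
  by apply: act_tmap_ev => x; apply: (fam_inv x phi).
by apply/esym/act_tmap_ev => x; apply/esym/fam_act.
Qed.

Lemma mu_fun_linear U W V :
  linear (fun t => InvSp (tens_family t) : inv_sp (tens_rep U W) V).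
Proof. by move=> a x y; apply: inv_sp_eq => phi; exact: (linearP (tmap (ev U phi) (ev W phi)) a x y). Qed.

Definition mu_lin U W V : {linear tens (inv_sp U V) (inv_sp W V) -> inv_sp (tens_rep U W) V} :=
  mklin (@mu_fun_linear U W V).

Lemma mu_linE U W V t (phi : isometry V) : mu_lin U W V t phi = tmap (ev U phi) (ev W phi) t.
Proof. by []. Qed.

Lemma mu_lin_pure U W V (x : inv_sp U V) (y : inv_sp W V) (phi : isometry V) :
  mu_lin U W V (pure x y) phi = pure (x phi) (y phi).
Proof. by rewrite mu_linE tensE. Qed.

(** After evaluation at [phi], injectivity is that of a tensor product of injections over a field,
    and surjectivity is [tens_invariants]. *)
Lemma mu_lin_bij U W V : smooth U -> smooth W -> bijective (mu_lin U W V).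
Proof.
move=> sU sW; have [phi _] := isometry_ex V.
have inj : injective (mu_lin U W V).
  move=> x y e; apply: (tmap_inj (@ev_inj U V phi) (@ev_inj W V phi)).
  exact: (f_equal (fun z : inv_sp (tens_rep U W) V => z phi) e).
have surj z : exists t, mu_lin U W V t = z.
  have [t ht] := @tens_invariants K U W (\dim {:V}) _ _ (ev U phi) (ev W phi) (z phi) sU sW
    (@ev_inj U V phi) (@ev_inj W V phi) (fun u => @fam_ex K U V phi u)
    (fun w => @fam_ex K W V phi w) (fam_inv z phi).
  by exists t; apply: (fam_eq (phi := phi)).
have [G hG] := choice surj.
by exists G => // x; apply: inj; rewrite hG.
Qed.

Lemma bij_lin_iso (A B : vectf_tcat K) (f : {linear sval A -> sval B}) :
  bijective f -> @is_iso (vectf_tcat K) A B f.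
Proof.
move=> [g fg gf]; have lg : linear g.
  by move=> a x y; apply: (can_inj fg); rewrite gf linearP !gf.
by exists (mklin lg); split; apply: lin_eq => x; [apply: fg|apply: gf].
Qed.

Lemma mu_lin_nat U U' W W' (f : rep_hom U U') (g : rep_hom W W') V (t : tens _ _) :
  mu_lin U' W' V (tmap (inv_mor f V) (inv_mor g V) t) = inv_mor (rep_tmap f g) V (mu_lin U W V t).
Proof.
apply: (tens_ext (f := lin_comp (mu_lin U' W' V) (tmap (inv_mor f V) (inv_mor g V)))
  (g := lin_comp (inv_mor (rep_tmap f g) V) (mu_lin U W V))) => x y.
apply: inv_sp_eq => phi; rewrite !lin_compE tensE mu_lin_pure.
by rewrite -[RHS]/(tmap f g (mu_lin U W V (pure x y) phi)) mu_lin_pure tensE.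
Qed.

Lemma mu_lin_map U W V V' (h : quad_hom V V')
    (lU : linear (@inv_map K U V V' h)) (lW : linear (@inv_map K W V V' h)) t :
  mu_lin U W V' (tmap (mklin lU) (mklin lW) t) = inv_map h (mu_lin U W V t).
Proof.
have lT := @inv_map_is_linear K (tens_rep U W) V V' h.
apply: (tens_ext (f := lin_comp (mu_lin U W V') (tmap (mklin lU) (mklin lW)))
  (g := lin_comp (mklin lT) (mu_lin U W V))) => x y.
have [phi [psi e]] := isometry_choice h; apply: (fam_eq (phi := psi)).
rewrite !lin_compE tensE mu_lin_pure.
rewrite -[mklin lT _]/(inv_map h _) -[mklin lU _]/(inv_map h _) -[mklin lW _]/(inv_map h _).
by rewrite !(inv_mapP _ e) mu_lin_pure.
Qed.

Definition mu_nt (U W : RepO K) : @hom (FunT1 K) (ot (tmon (FunT1 K)) (F U) (F W))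
  (F (ot (tmon (RepO K)) U W)).
Proof.
refine (@NatTrans (T1 K) (vectf_tcat K) (functor_ot (inv_obj wd U) (inv_obj wd W))
  (inv_obj wd (ot (tmon (RepO K)) U W)) (fun V => mu_lin (sval U) (sval W) V) _).
abstract (move=> V V' h; apply: lin_eq => t; exact: mu_lin_map).
Defined.

Lemma eps_family V (a : K^o) :
  (fun _ : isometry V => a : triv_rep K (Oinf K)) \in @is_familyb K (triv_rep K (Oinf K)) V.
Proof. by apply/asboolP; split. Qed.

Lemma eps_fun_linear V : linear (fun a : K^o => InvSp (eps_family V a)).
Proof. by move=> a x y; apply: inv_sp_eq. Qed.

Definition eps_lin V : {linear K^o -> inv_sp (triv_rep K (Oinf K)) V} := mklin (@eps_fun_linear V).

Lemma eps_lin_bij V : bijective (eps_lin V).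
Proof.
have [phi _] := isometry_ex V; exists (fun x : inv_sp (triv_rep K (Oinf K)) V => x phi) => // x.
exact: (fam_eq (phi := phi)).
Qed.

Definition eps_nt : @hom (FunT1 K) (un (tmon (FunT1 K))) (F (un (tmon (RepO K)))).
Proof.
refine (@NatTrans (T1 K) (vectf_tcat K) (functor_un (T1 K) (vectf_tcat K))
  (inv_obj wd (un (tmon (RepO K)))) (fun V => eps_lin V) _).
abstract (move=> V V' h; apply: lin_eq => a; have [phi [psi e]] := isometry_choice h;
  apply: (fam_eq (phi := psi)); exact/esym/(inv_mapP (eps_lin V a) e)).
Defined.

Lemma mu_nt_iso (U W : RepO K) : is_iso (mu_nt U W).
Proof.
by apply: nat_iso => V; apply: bij_lin_iso; apply: mu_lin_bij; exact: smooth_obj.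
Qed.

Lemma eps_nt_iso : is_iso eps_nt.
Proof. by apply: nat_iso => V; apply: bij_lin_iso; exact: eps_lin_bij. Qed.

End Monoidal.

(** * Coherence of the monoidal structure *)

Section SymmetricMonoidal.
Variable K : numClosedFieldType.
Let wd := well_defined K.
Let F := invariants_functor wd.
Implicit Types (U W X : rep K (Oinf K)) (V : quad_space K).

Notation triv := (triv_rep K (Oinf K)).

(** On pure tensors, evaluated at an isometry, [mu_lin] is the inclusion of invariants, so this and
    the following coherence conditions reduce to those of vector spaces. *)
Lemma mu_lin_assoc U W X V (t : tens (tens (inv_sp U V) (inv_sp W V)) (inv_sp X V)) :
  inv_mor (rep_assoc U W X) V (mu_lin (tens_rep U W) X V (tmap (mu_lin U W V) (lin_id _) t)) =
  mu_lin U (tens_rep W X) V (tmap (lin_id _) (mu_lin W X V) (tassoc _ _ _ t)).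
Proof.
pose f1 := lin_comp (inv_mor (rep_assoc U W X) V)
  (lin_comp (mu_lin (tens_rep U W) X V) (tmap (mu_lin U W V) (lin_id _))).
pose f2 := lin_comp (mu_lin U (tens_rep W X) V)
  (lin_comp (tmap (lin_id _) (mu_lin W X V)) (tassoc (inv_sp U V) (inv_sp W V) (inv_sp X V))).
suff e : f1 = f2 by exact: (f_equal (fun f : {linear _ -> _} => f t) e).
apply: tens_eq3l => x y z; apply: inv_sp_eq => phi.
rewrite !lin_compE !tensE !lin_idE.
rewrite -[LHS]/(tassoc _ _ _ (mu_lin (tens_rep U W) X V (pure (mu_lin U W V (pure x y)) z) phi)).
by rewrite !mu_lin_pure tensE.
Qed.

Lemma mu_lin_lunit U V (t : tens K^o (inv_sp U V)) :
  inv_mor (rep_lunit U) V (mu_lin triv U V (tmap (eps_lin V) (lin_id _) t)) = tlunit _ t.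
Proof.
pose f1 := lin_comp (inv_mor (rep_lunit U) V)
  (lin_comp (mu_lin triv U V) (tmap (eps_lin V) (lin_id (inv_sp U V)))).
suff e : f1 = tlunit _ by exact: (f_equal (fun f : {linear _ -> _} => f t) e).
apply: tens_eq => a x; apply: inv_sp_eq => phi.
rewrite !lin_compE !tensE !lin_idE.
rewrite -[LHS]/(tlunit _ (mu_lin triv U V (pure (eps_lin V a) x) phi)).
by rewrite mu_lin_pure tensE.
Qed.

Lemma mu_lin_runit U V (t : tens (inv_sp U V) K^o) :
  inv_mor (rep_runit U) V (mu_lin U triv V (tmap (lin_id _) (eps_lin V) t)) = trunit _ t.
Proof.
pose f1 := lin_comp (inv_mor (rep_runit U) V)
  (lin_comp (mu_lin U triv V) (tmap (lin_id (inv_sp U V)) (eps_lin V))).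
suff e : f1 = trunit _ by exact: (f_equal (fun f : {linear _ -> _} => f t) e).
apply: tens_eq => x a; apply: inv_sp_eq => phi.
rewrite !lin_compE !tensE !lin_idE.
rewrite -[LHS]/(trunit _ (mu_lin U triv V (pure x (eps_lin V a)) phi)).
by rewrite mu_lin_pure tensE.
Qed.

Lemma mu_lin_braid U W V (t : tens (inv_sp U V) (inv_sp W V)) :
  inv_mor (rep_braid U W) V (mu_lin U W V t) = mu_lin W U V (tbraid _ _ t).
Proof.
apply: (tens_ext (f := lin_comp (inv_mor (rep_braid U W) V) (mu_lin U W V))
  (g := lin_comp (mu_lin W U V) (tbraid _ _))) => x y.
apply: inv_sp_eq => phi; rewrite !lin_compE !tensE.
rewrite -[LHS]/(tbraid _ _ (mu_lin U W V (pure x y) phi)).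
by rewrite !mu_lin_pure tensE.
Qed.

Definition invariants_monoidal : @symmetric_monoidal K (RepO K) (FunT1 K) F.
Proof.
refine (@SymmetricMonoidal K (RepO K) (FunT1 K) F (@mu_nt K) (eps_nt K) _ _ _ _ _ _ _).
- abstract exact: mu_nt_iso.
- abstract exact: eps_nt_iso.
- abstract (by move=> U U' W W' f g; apply: nat_hom_eq => V; apply: lin_eq => t; exact: mu_lin_nat).
- abstract (by move=> U W X; apply: nat_hom_eq => V; apply: lin_eq => t; exact: mu_lin_assoc).
- abstract (by move=> U; apply: nat_hom_eq => V; apply: lin_eq => t; exact: mu_lin_lunit).
- abstract (by move=> U; apply: nat_hom_eq => V; apply: lin_eq => t; exact: mu_lin_runit).
- abstract (by move=> U W; apply: nat_hom_eq => V; apply: lin_eq => t; exact: mu_lin_braid).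
Defined.

Lemma invariants_pointwise_mu : pointwise_mu invariants_monoidal.
Proof. by move=> U W V x y phi; exact: mu_lin_pure. Qed.

End SymmetricMonoidal.

Theorem mainTheorem12 (R : realType) :
  exists wd : inv_well_defined R[i],
    let F := invariants_functor wd in
    [/\ left_exact F, fully_faithful F, linear_functor F
      & exists M : symmetric_monoidal F, pointwise_mu M].
Proof.
exists (well_defined R[i]); split.
- exact: invariants_left_exact.
- exact: invariants_fully_faithful.
- exact: invariants_linear.
- by exists (invariants_monoidal _); exact: invariants_pointwise_mu.
Qed.
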